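(* (Over $\mathsf{RCA}_0$.) Cousin's lemma for Baire class 1 functions implies $\mathsf{ACA}_0$. That is, $\mathsf{RCA}_0$ proves that if every Baire class 1 gauge $\delta\colon[0,1]\to\mathbb{R}^+$ admits a $\delta$-fine cover of $[0,1]$, then arithmetical comprehension holds.
   Context: $\mathsf{RCA}_0$ is recursive comprehension with $\Sigma^0_1$-induction; $\mathsf{ACA}_0$ is $\mathsf{RCA}_0$ plus arithmetical comprehension. In second-order arithmetic, a code for a Baire class 1 function $\delta$ is a sequence $\langle \delta_n\rangle$ of codes of continuous functions such that for every $x$, $\langle \delta_n(x)\rangle$ is Cauchy (its limit need not exist in the model); ''$\delta(x)\in B(y,r)$'' means that for some $s<r$, for all but finitely many $n$, $\delta_n(x)\in B(y,s)$; $\delta$ is a gauge if for every $x$, $\delta(x)>\epsilon$ for some $\epsilon>0$ in this sense. A $\delta$-fine cover of $[0,1]$ is a finite set $P\subseteq[0,1]$ together with $p\mapsto r_p\in\mathbb{R}^+$ such that $[0,1]=\bigcup_{p\in P}(p-r_p,p+r_p)$ and $r_p\le\delta(p)$ for all $p\in P$. *)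

(* Defs.v *)
From Stdlib Require Import List.
Import ListNotations.

(** * The language of second-order arithmetic

    Two sorts, number variables and set variables, each with its own de Bruijn
    indices.  The only set terms are variables, and equality is primitive for
    numbers only. *)

Inductive tm : Type :=
| tvar : nat -> tm
| tzero : tm
| tone : tm
| tadd : tm -> tm -> tm
| tmul : tm -> tm -> tm.

Inductive fm : Type :=
| feq : tm -> tm -> fm
| flt : tm -> tm -> fm
| fmem : tm -> nat -> fm
| fbot : fm
| fimp : fm -> fm -> fm
| fall : fm -> fm
| fallS : fm -> fm.

Definition fneg (p : fm) : fm := fimp p fbot.
Definition fand (p q : fm) : fm := fneg (fimp p (fneg q)).
Definition for_ (p q : fm) : fm := fimp (fneg p) q.
Definition fiff (p q : fm) : fm := fand (fimp p q) (fimp q p).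
Definition fex (p : fm) : fm := fneg (fall (fneg p)).
Definition fexS (p : fm) : fm := fneg (fallS (fneg p)).

Fixpoint tsubst (s : nat -> tm) (t : tm) : tm :=
  match t with
  | tvar n => s n
  | tzero => tzero
  | tone => tone
  | tadd a b => tadd (tsubst s a) (tsubst s b)
  | tmul a b => tmul (tsubst s a) (tsubst s b)
  end.

Definition tlift : tm -> tm := tsubst (fun n => tvar (S n)).

Definition up (s : nat -> tm) (n : nat) : tm :=
  match n with 0 => tvar 0 | S m => tlift (s m) end.

Definition upS (r : nat -> nat) (n : nat) : nat :=
  match n with 0 => 0 | S m => S (r m) end.

(** Simultaneous substitution: terms for the number variables, set variables
    for the set variables. *)
Fixpoint fsubst (s : nat -> tm) (r : nat -> nat) (p : fm) : fm :=
  match p with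
  | feq a b => feq (tsubst s a) (tsubst s b)
  | flt a b => flt (tsubst s a) (tsubst s b)
  | fmem a x => fmem (tsubst s a) (r x)
  | fbot => fbot
  | fimp p1 p2 => fimp (fsubst s r p1) (fsubst s r p2)
  | fall p1 => fall (fsubst (up s) r p1)
  | fallS p1 => fallS (fsubst s (upS r) p1)
  end.

Definition flift : fm -> fm := fsubst (fun n => tvar (S n)) (fun n => n).
Definition fliftS : fm -> fm := fsubst tvar S.

Definition finst (t : tm) : fm -> fm :=
  fsubst (fun n => match n with 0 => t | S m => tvar m end) (fun n => n).
Definition finstS (x : nat) : fm -> fm :=
  fsubst tvar (fun n => match n with 0 => x | S m => m end).

(** * Classical two-sorted natural deduction with equality *)

Inductive nd : list fm -> fm -> Prop :=
| nd_hyp G p : In p G -> nd G p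
| nd_impI G p q : nd (p :: G) q -> nd G (fimp p q)
| nd_impE G p q : nd G (fimp p q) -> nd G p -> nd G q
| nd_dne G p : nd G (fneg (fneg p)) -> nd G p
| nd_allI G p : nd (map flift G) p -> nd G (fall p)
| nd_allE G p t : nd G (fall p) -> nd G (finst t p)
| nd_allSI G p : nd (map fliftS G) p -> nd G (fallS p)
| nd_allSE G p x : nd G (fallS p) -> nd G (finstS x p)
| nd_refl G t : nd G (feq t t)
| nd_subst G p t u : nd G (feq t u) -> nd G (finst t p) -> nd G (finst u p).

Definition provable (T : fm -> Prop) (p : fm) : Prop :=
  exists G : list fm, (forall q, In q G -> T q) /\ nd G p.

(** * RCA_0 and ACA_0 *)

(** The Sigma^0_0 formulas. Set parameters are allowed. *)
Inductive bounded : fm -> Prop :=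
| bd_eq a b : bounded (feq a b)
| bd_lt a b : bounded (flt a b)
| bd_mem a x : bounded (fmem a x)
| bd_bot : bounded fbot
| bd_imp p q : bounded p -> bounded q -> bounded (fimp p q)
| bd_all t p :
    bounded p -> bounded (fall (fimp (flt (tvar 0) (tlift t)) p)).

Inductive sigma1 : fm -> Prop :=
| sigma1_ex p : bounded p -> sigma1 (fex p).

Inductive pi1 : fm -> Prop :=
| pi1_all p : bounded p -> pi1 (fall p).

Fixpoint arithmetical (p : fm) : Prop :=
  match p with
  | feq _ _ | flt _ _ | fmem _ _ | fbot => True
  | fimp p1 p2 => arithmetical p1 /\ arithmetical p2
  | fall p1 => arithmetical p1
  | fallS _ => False
  end.

Inductive basic_axiom : fm -> Prop :=
| ax_succ_nz : basic_axiom (fneg (feq (tadd (tvar 0) tone) tzero))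
| ax_succ_inj :
    basic_axiom (fimp (feq (tadd (tvar 0) tone) (tadd (tvar 1) tone))
                      (feq (tvar 0) (tvar 1)))
| ax_add0 : basic_axiom (feq (tadd (tvar 0) tzero) (tvar 0))
| ax_addS :
    basic_axiom (feq (tadd (tvar 0) (tadd (tvar 1) tone))
                     (tadd (tadd (tvar 0) (tvar 1)) tone))
| ax_mul0 : basic_axiom (feq (tmul (tvar 0) tzero) tzero)
| ax_mulS :
    basic_axiom (feq (tmul (tvar 0) (tadd (tvar 1) tone))
                     (tadd (tmul (tvar 0) (tvar 1)) (tvar 0)))
| ax_lt0 : basic_axiom (fneg (flt (tvar 0) tzero))
| ax_ltS :
    basic_axiom (fiff (flt (tvar 0) (tadd (tvar 1) tone))
                      (for_ (flt (tvar 0) (tvar 1)) (feq (tvar 0) (tvar 1)))).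

(** In the three schemes number variable 0 is the distinguished variable of
    [p] (and [q]); all other variables are parameters. *)

Definition fsucc : fm -> fm :=
  fsubst (fun n => match n with
                   | 0 => tadd (tvar 0) tone
                   | S m => tvar (S m)
                   end) (fun n => n).

Definition induction_for (p : fm) : fm :=
  fimp (fand (finst tzero p) (fall (fimp p (fsucc p)))) (fall p).

(** [fliftS p] does not contain the set variable bound by [fexS]. *)
Definition comprehension_for (p : fm) : fm :=
  fexS (fall (fiff (fmem (tvar 0) 0) (fliftS p))).

Inductive sigma1_induction : fm -> Prop :=
| sigma1_induction_ax p : sigma1 p -> sigma1_induction (induction_for p).

Inductive delta1_comprehension : fm -> Prop :=
| delta1_ca p q :
    sigma1 p -> pi1 q ->
    delta1_comprehension (fimp (fall (fiff p q)) (comprehension_for p)).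

Inductive arithmetical_comprehension : fm -> Prop :=
| arith_ca p :
    arithmetical p -> arithmetical_comprehension (comprehension_for p).

(** The schemes have free variables; the theories contain their universal
    generalizations. *)
Inductive generalization (A : fm -> Prop) : fm -> Prop :=
| gen_base p : A p -> generalization A p
| gen_all p : generalization A p -> generalization A (fall p)
| gen_allS p : generalization A p -> generalization A (fallS p).

Definition RCA0 : fm -> Prop :=
  generalization
    (fun p => basic_axiom p \/ sigma1_induction p \/ delta1_comprehension p).

Definition ACA0 : fm -> Prop :=
  fun p => RCA0 p \/ generalization arithmetical_comprehension p.

(** * Writing formulas with Rocq binders

    A [form] is a formula awaiting the numbers of enclosing number and set
    quantifiers.  A variable remembers the depth at which it was bound, and the
    depth at which it is used turns this into a de Bruijn index.  Applying a
    [form] to [0 0] gives a sentence. *)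

Definition nterm : Type := nat -> tm.
Definition sterm : Type := nat -> nat.
Definition form : Type := nat -> nat -> fm.

Definition Zero : nterm := fun _ => tzero.
Definition One : nterm := fun _ => tone.
Definition Add (a b : nterm) : nterm := fun n => tadd (a n) (b n).
Definition Mul (a b : nterm) : nterm := fun n => tmul (a n) (b n).

Definition Eq (a b : nterm) : form := fun n _ => feq (a n) (b n).
Definition Lt (a b : nterm) : form := fun n _ => flt (a n) (b n).
Definition Mem (a : nterm) (X : sterm) : form := fun n s => fmem (a n) (X s).
Definition Imp (p q : form) : form := fun n s => fimp (p n s) (q n s).
Definition And (p q : form) : form := fun n s => fand (p n s) (q n s).
Definition Or (p q : form) : form := fun n s => for_ (p n s) (q n s).
Definition Neg (p : form) : form := fun n s => fneg (p n s).
Definition Iff (p q : form) : form := fun n s => fiff (p n s) (q n s).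
Definition All (p : nterm -> form) : form :=
  fun n s => fall (p (fun n' => tvar (n' - S n)) (S n) s).
Definition Ex (p : nterm -> form) : form :=
  fun n s => fex (p (fun n' => tvar (n' - S n)) (S n) s).
Definition AllS (p : sterm -> form) : form :=
  fun n s => fallS (p (fun s' => s' - S s) n (S s)).
Definition ExS (p : sterm -> form) : form :=
  fun n s => fexS (p (fun s' => s' - S s) n (S s)).

Declare Scope nterm_scope.
Delimit Scope nterm_scope with nterm.
Bind Scope nterm_scope with nterm.
Declare Scope form_scope.
Delimit Scope form_scope with form.
Bind Scope form_scope with form.

Notation "0" := Zero : nterm_scope.
Notation "1" := One : nterm_scope.
Notation "2" := (Add One One) : nterm_scope.
Infix "+" := Add : nterm_scope.
Infix "*" := Mul : nterm_scope.

Definition Le (a b : nterm) : form := Or (Lt a b) (Eq a b).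

Infix "=" := Eq : form_scope.
Infix "<" := Lt : form_scope.
Infix "<=" := Le : form_scope.
Infix "==>" := Imp (at level 99, right associativity) : form_scope.
Infix "<=>" := Iff (at level 95, no associativity) : form_scope.
Infix "/\" := And : form_scope.
Infix "\/" := Or : form_scope.
Notation "~ p" := (Neg p) : form_scope.
Notation "'ALL' x .. y , p" := (All (fun x => .. (All (fun y => p)) ..))
  (at level 200, x binder, y binder, right associativity) : form_scope.
Notation "'EX' x .. y , p" := (Ex (fun x => .. (Ex (fun y => p)) ..))
  (at level 200, x binder, y binder, right associativity) : form_scope.
Notation "'ALLS' x .. y , p" := (AllS (fun x => .. (AllS (fun y => p)) ..))
  (at level 200, x binder, y binder, right associativity) : form_scope.
Notation "'EXS' x .. y , p" := (ExS (fun x => .. (ExS (fun y => p)) ..))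
  (at level 200, x binder, y binder, right associativity) : form_scope.

Local Open Scope nterm_scope.
Local Open Scope form_scope.

(** * Coding of rationals and reals *)

(** The usual injective polynomial pairing (i + j)^2 + i. *)
Definition Pair (i j : nterm) : nterm := (i + j) * (i + j) + i.

(** [Pow2 k e]: e = 2^k, via a set coding the graph of the exponential. *)
Definition Pow2 (k e : nterm) : form :=
  EXS E,
    (ALL z, Mem (Pair 0 z) E <=> z = 1) /\
    (ALL n y, Mem (Pair n y) E ==>
       ALL z, Mem (Pair (n + 1) z) E <=> z = 2 * y) /\
    Mem (Pair k e) E.

(** A rational is a triple of numbers with value (rpos - rneg) / (rden + 1).
    Every triple is a valid name; order and distance do not depend on the
    choice of names. *)
Record rat : Type := Rat { rpos : nterm; rneg : nterm; rden : nterm }.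

Definition QCode (q : rat) : nterm := Pair (Pair (rpos q) (rneg q)) (rden q).

Definition AllQ (p : rat -> form) : form := ALL a b c, p (Rat a b c).
Definition ExQ (p : rat -> form) : form := EX a b c, p (Rat a b c).

Notation "'ALLQ' x .. y , p" := (AllQ (fun x => .. (AllQ (fun y => p)) ..))
  (at level 200, x binder, y binder, right associativity) : form_scope.
Notation "'EXQ' x .. y , p" := (ExQ (fun x => .. (ExQ (fun y => p)) ..))
  (at level 200, x binder, y binder, right associativity) : form_scope.

Definition Q0 : rat := Rat 0 0 0.
Definition Q1 : rat := Rat 1 0 0.

Definition QAdd (x y : rat) : rat :=
  Rat (rpos x * (rden y + 1) + rpos y * (rden x + 1))
      (rneg x * (rden y + 1) + rneg y * (rden x + 1))
      (rden x * rden y + rden x + rden y).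
Definition QOpp (x : rat) : rat := Rat (rneg x) (rpos x) (rden x).
Definition QSub (x y : rat) : rat := QAdd x (QOpp y).

Definition QLt (x y : rat) : form :=
  rpos x * (rden y + 1) + rneg y * (rden x + 1)
  < rpos y * (rden x + 1) + rneg x * (rden y + 1).
Definition QLe (x y : rat) : form :=
  rpos x * (rden y + 1) + rneg y * (rden x + 1)
  <= rpos y * (rden x + 1) + rneg x * (rden y + 1).

Definition QDistLe (x y e : rat) : form :=
  QLe (QSub x y) e /\ QLe (QSub y x) e.

(** A real is given by its entries: [x k q] says that q is the k-th term of the
    sequence x.  Real numbers of the model are sets read by [RealOf]; [RealAt]
    reads the i-th member of a sequence of reals. *)
Definition real : Type := nterm -> rat -> form.

Definition RealOf (X : sterm) : real := fun k q => Mem (Pair k (QCode q)) X.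
Definition RealAt (X : sterm) (i : nterm) : real :=
  fun k q => Mem (Pair i (Pair k (QCode q))) X.

(** A sequence of rationals with |q_k - q_(k+i)| <= 2^(-k).  Below,
    [Pow2 k (c + 1)] makes [Rat 1 0 c] the rational 2^(-k). *)
Definition IsReal (x : real) : form :=
  (ALL k, EXQ q, x k q /\ ALLQ q', x k q' ==> QCode q' = QCode q) /\
  (ALL k i c, ALLQ q q',
     Pow2 k (c + 1) ==> x k q ==> x (k + i) q' ==> QDistLe q q' (Rat 1 0 c)).

Definition RLe (x y : real) : form :=
  ALL k c, ALLQ q q',
    Pow2 k (c + 1) ==> x k q ==> y k q' ==> QLe q (QAdd q' (Rat 2 0 c)).
Definition RLt (x y : real) : form := ~ RLe y x.
Definition REq (x y : real) : form := RLe x y /\ RLe y x.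

Definition ROfQ (q : rat) : real := fun _ q' => QCode q' = QCode q.
Definition RAdd (x y : real) : real :=
  fun k q => EXQ a b,
    x (k + 1) a /\ y (k + 1) b /\ QCode q = QCode (QAdd a b).
Definition ROpp (x : real) : real :=
  fun k q => EXQ a, x k a /\ QCode q = QCode (QOpp a).
Definition RSub (x y : real) : real := RAdd x (ROpp y).

Definition RDistLt (x y e : real) : form :=
  RLt (RSub x y) e /\ RLt (RSub y x) e.
Definition RDistLe (x y e : real) : form :=
  RLe (RSub x y) e /\ RLe (RSub y x) e.

Definition UnitPoint (x : real) : form :=
  IsReal x /\ RLe (ROfQ Q0) x /\ RLe x (ROfQ Q1).

(** * Codes of continuous functions from [0,1] to the reals *)

(** [F a r b s] is the relation (a, r) F (b, s), which says that the function
    maps the ball B(a, r) of [0,1] into the closed ball of centre b and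
    radius s. *)
Definition cts : Type := rat -> rat -> rat -> rat -> form.

Definition UnitRat (a : rat) : form := QLe Q0 a /\ QLe a Q1.

(** (a, r) < (a', r'): |a - a'| + r < r'. *)
Definition BallLt (a r a' r' : rat) : form :=
  QLt (QAdd (QSub a a') r) r' /\ QLt (QAdd (QSub a' a) r) r'.

Definition IsCts (F : cts) : form :=
  (ALLQ a r b s, F a r b s ==> UnitRat a /\ QLt Q0 r /\ QLt Q0 s) /\
  (ALLQ a r b s b' s',
     F a r b s ==> F a r b' s' ==> QDistLe b b' (QAdd s s')) /\
  (ALLQ a r b s a' r',
     F a r b s ==> UnitRat a' ==> QLt Q0 r' ==> BallLt a' r' a r ==>
     F a' r' b s) /\
  (ALLQ a r b s b' s',
     F a r b s ==> BallLt b s b' s' ==> F a r b' s').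

Definition InDom (F : cts) (x : real) : form :=
  ALLQ e, QLt Q0 e ==>
    EXQ a r b s, F a r b s /\ RDistLt x (ROfQ a) (ROfQ r) /\ QLt s e.

(** [Value F x y]: F(x) = y, for x in the domain of F. *)
Definition Value (F : cts) (x y : real) : form :=
  ALLQ a r b s,
    F a r b s ==> RDistLt x (ROfQ a) (ROfQ r) ==>
    RDistLe y (ROfQ b) (ROfQ s).

(** The n-th code in the sequence of codes D; the code itself is a set of
    quintuples (m, a, r, b, s). *)
Definition CtsAt (D : sterm) (n : nterm) : cts := fun a r b s =>
  EX m, Mem (Pair n (Pair m
          (Pair (QCode a) (Pair (QCode r) (Pair (QCode b) (QCode s)))))) D.

(** * Baire class 1 functions, gauges and fine covers *)

Definition BaireOne (D : sterm) : form :=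
  (ALL n, IsCts (CtsAt D n)) /\
  (ALLS X, UnitPoint (RealOf X) ==>
     (ALL n, InDom (CtsAt D n) (RealOf X)) /\
     (ALLQ e, QLt Q0 e ==> EX N, ALL m n, N <= m ==> N <= n ==>
        ALLS V W, IsReal (RealOf V) ==> IsReal (RealOf W) ==>
          Value (CtsAt D m) (RealOf X) (RealOf V) ==>
          Value (CtsAt D n) (RealOf X) (RealOf W) ==>
          RDistLt (RealOf V) (RealOf W) (ROfQ e))).

(** D(x) lies in B(y, r), in the sense that does not require the limit D(x) to
    exist. *)
Definition LimInBall (D : sterm) (x : real) (y r : rat) : form :=
  EXQ s, QLt s r /\ EX N, ALL n, N <= n ==>
    EXS V, IsReal (RealOf V) /\ Value (CtsAt D n) x (RealOf V) /\
      RDistLt (RealOf V) (ROfQ y) (ROfQ s).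

(** D(x) > e: D(x) lies in some ball contained in the half-line (e, oo). *)
Definition LimGt (D : sterm) (x : real) (e : rat) : form :=
  EXQ y r, QLe e (QSub y r) /\ LimInBall D x y r.

(** r <= D(x): D(x) > e for all e < r. *)
Definition LeLim (r : real) (D : sterm) (x : real) : form :=
  ALLQ e, RLt (ROfQ e) r ==> LimGt D x e.

Definition Gauge (D : sterm) : form :=
  ALLS X, UnitPoint (RealOf X) ==>
    EXQ e, QLt Q0 e /\ LimGt D (RealOf X) e.

(** The finite set of points is listed as P_0, ..., P_(k-1), and R_i is the
    radius at P_i.  The second clause makes the radius a function of the point
    also when the list has repetitions.  The intervals are open in [0,1]. *)
Definition FineCover (D : sterm) (k : nterm) (P R : sterm) : form :=
  (ALL i, i < k ==>
     UnitPoint (RealAt P i) /\ IsReal (RealAt R i) /\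
     RLt (ROfQ Q0) (RealAt R i) /\ LeLim (RealAt R i) D (RealAt P i)) /\
  (ALL i j, i < k ==> j < k ==> REq (RealAt P i) (RealAt P j) ==>
     REq (RealAt R i) (RealAt R j)) /\
  (ALLS X, UnitPoint (RealOf X) ==>
     EX i, i < k /\
       RLt (RSub (RealAt P i) (RealAt R i)) (RealOf X) /\
       RLt (RealOf X) (RAdd (RealAt P i) (RealAt R i))).

Definition CousinBaireOne : fm :=
  (ALLS D, BaireOne D ==> Gauge D ==> EX k, EXS P R, FineCover D k P R) 0%nat 0%nat.

(* Main.v *)
(** By completeness of natural deduction it suffices to show that every model of
    RCA_0 in which Cousin's lemma for Baire class 1 functions holds satisfies
    arithmetical comprehension, which reduces to comprehension for
    [{n | exists t, th n t}] with [th] bounded.  Let [c_s] be the sum of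
    [2^-(n+1)] over the [n < s] with [th n t] for some [t < s], an increasing
    sequence of rationals that is Cauchy by Sigma_1 induction.  If it has a limit
    in the model then the set is Delta_1 in that limit.  Otherwise the continuous
    functions [x |-> |x - c_s|] form a code of a Baire class 1 gauge: the limit
    [|x - c|] is positive although [c] is not in the model.  In a fine cover by
    intervals [(p_i - r_i, p_i + r_i)] take [T] so large that every right end
    [p_i + r_i] that is exceeded by some [c_s] is exceeded by [c_T].  The
    interval that covers [c_T] has its right end above all [c_s], and
    [r_i <= |p_i - c|] forces [p_i + r_i = c], a contradiction. *)

From HB Require Import structures.
From mathcomp Require Import all_boot all_order ssralg ssrnum.
From mathcomp Require Import boolp zify ring lra.
(* The notations of [Defs] are incompatible with those of [ssrbool]. *)
From Pilot Require Import -(notations) Defs.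

Set Implicit Arguments.
Unset Strict Implicit.
Unset Printing Implicit Defensive.
Import Order.TTheory GRing.Theory Num.Theory.

(** * Substitution *)

(** The numbers of a model may be nonstandard, and every point, code and cover has to be a set of
    the model. The rationals are therefore fractions of the model's own numbers, and an induction is
    allowed only for a statement shown to be Sigma_1; this is why inequalities are so often recast
    before an induction. Powers of two are not terms of the language and come from the beta
    function. The number of intervals in a cover may be nonstandard too, so [T] is not a finite
    maximum. It comes from strong Sigma_1 collection: the binary number recording which indices have
    appeared can only grow, and it is bounded. The same growth argument makes [c_s] Cauchy. The
    equation [p_i + r_i = c] arises as follows. The left end of the interval is below [c_T], hence
    below [c]. If [p_i >= c], then [r_i <= p_i - c] would put the left end at or above [c]. So
    [r_i <= c - p_i], while the choice of [T] gives [c <= p_i + r_i]. The contradiction is that the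
    model then contains [c], as a sum of two of its reals. *)

Definition scons {A : Type} (x : A) (s : nat -> A) (n : nat) : A :=
  match n with 0 => x | S m => s m end.

Notation "x .: s" := (scons x s) (at level 55, right associativity).

Lemma tsubst_comp s s' t :
  tsubst s (tsubst s' t) = tsubst (fun n => tsubst s (s' n)) t.
Proof. by elim: t => //= [a -> b ->|a -> b ->]. Qed.

Lemma tsubst_id t : tsubst tvar t = t.
Proof. by elim: t => //= [a -> b ->|a -> b ->]. Qed.

Lemma up_comp s s' :
  (fun n => tsubst (up s) (up s' n)) = up (fun n => tsubst s (s' n)).
Proof. by apply: funext => -[|n] //=; rewrite /tlift !tsubst_comp. Qed.

Lemma upS_comp r r' : (fun n => upS r (upS r' n)) = upS (fun n => r (r' n)).
Proof. by apply: funext => -[|n]. Qed.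

Lemma fsubst_comp s r s' r' p :
  fsubst s r (fsubst s' r' p)
  = fsubst (fun n => tsubst s (s' n)) (fun n => r (r' n)) p.
Proof.
elim: p s r s' r' => [a b|a b|a x||p IHp q IHq|p IHp|p IHp] s r s' r' //=;
  rewrite ?tsubst_comp ?IHp ?IHq //.
  by rewrite up_comp.
by rewrite upS_comp.
Qed.

Lemma fsubst_id p : fsubst tvar id p = p.
Proof.
have upid : up tvar = tvar by apply: funext => -[].
have upSid : upS id = id by apply: funext => -[].
elim: p => [a b|a b|a x||p IHp q IHq|p IHp|p IHp] //=; rewrite ?tsubst_id //.
- by rewrite IHp IHq.
- by rewrite upid IHp.
by rewrite upSid IHp.
Qed.

Lemma finst_fsubst t s r p :
  finst t (fsubst (up s) r p) = fsubst (t .: s) r p.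
Proof.
rewrite /finst fsubst_comp; congr (fsubst _ _ p); apply: funext => -[|n] //=.
by rewrite /tlift tsubst_comp tsubst_id.
Qed.

Lemma finstS_fsubst x s r p :
  finstS x (fsubst s (upS r) p) = fsubst s (x .: r) p.
Proof.
rewrite /finstS fsubst_comp; congr (fsubst _ _ p).
  by apply: funext => n; rewrite tsubst_id.
by apply: funext => -[|n].
Qed.

Lemma fsubst_finst s r t p :
  fsubst s r (finst t p) = finst (tsubst s t) (fsubst (up s) r p).
Proof.
rewrite finst_fsubst /finst fsubst_comp; congr (fsubst _ _ p).
by apply: funext => -[|n].
Qed.

Lemma fsubst_finstS s r x p :
  fsubst s r (finstS x p) = finstS (r x) (fsubst s (upS r) p).
Proof.
rewrite finstS_fsubst /finstS fsubst_comp; congr (fsubst _ _ p).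
by apply: funext => -[|n].
Qed.

Lemma fsubst_flift s r p : fsubst (up s) r (flift p) = flift (fsubst s r p).
Proof. by rewrite /flift !fsubst_comp. Qed.

Lemma fsubst_fliftS s r p : fsubst s (upS r) (fliftS p) = fliftS (fsubst s r p).
Proof.
rewrite /fliftS !fsubst_comp; congr (fsubst _ _ p).
by apply: funext => n /=; rewrite tsubst_id.
Qed.

Lemma nd_weak G G' p : nd G p -> List.incl G G' -> nd G' p.
Proof.
move=> D; elim: D G' => {G p}
  [G p Gp|G p q _ IH|G p q _ IH1 _ IH2|G p _ IH|G p _ IH|G p t _ IH
  |G p _ IH|G p x _ IH|G t|G p t u _ IH1 _ IH2] G' sG.
- by apply: nd_hyp; apply: sG.
- apply: nd_impI; apply: IH => r [->|Gr]; first by left.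
  by right; apply: sG.
- by apply: nd_impE (IH1 _ sG) (IH2 _ sG).
- by apply: nd_dne; apply: IH.
- by apply: nd_allI; apply: IH; apply: List.incl_map.
- by apply: nd_allE; apply: IH.
- by apply: nd_allSI; apply: IH; apply: List.incl_map.
- by apply: nd_allSE; apply: IH.
- exact: nd_refl.
by apply: nd_subst (IH1 _ sG) (IH2 _ sG).
Qed.

(** Needed to trade a fresh free variable for a bound one, and to undo the renaming of variables in
    [completeness]. *)
Lemma nd_fsubst G p s r :
  nd G p -> nd (List.map (fsubst s r) G) (fsubst s r p).
Proof.
move=> D; elim: D s r => {G p}
  [G p Gp|G p q _ IH|G p q _ IH1 _ IH2|G p _ IH|G p _ IH|G p t _ IH
  |G p _ IH|G p x _ IH|G t|G p t u _ IH1 _ IH2] s r /=.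
- by apply: nd_hyp; apply: List.in_map.
- by apply: nd_impI; apply: IH.
- by apply: nd_impE (IH1 _ _) (IH2 _ _).
- by apply: nd_dne; apply: IH.
- apply: nd_allI; move: (IH (up s) r); rewrite !List.map_map.
  by under List.map_ext => q do rewrite fsubst_flift.
- by rewrite fsubst_finst; apply: nd_allE; apply: IH.
- apply: nd_allSI; move: (IH s (upS r)); rewrite !List.map_map.
  by under List.map_ext => q do rewrite fsubst_fliftS.
- by rewrite fsubst_finstS; apply: nd_allSE; apply: IH.
- exact: nd_refl.
rewrite fsubst_finst; apply: (nd_subst _ _ _ _ (IH1 _ _)).
by rewrite -fsubst_finst; apply: IH2.
Qed.

(** * Provability from a theory *)

Section Provability.
Implicit Types (T S : fm -> Prop) (p q : fm).

Definition add_ax T p q := q = p \/ T q.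

Lemma provable_hyp T p : T p -> provable T p.
Proof.
move=> Tp; exists [:: p]%list; split; first by move=> q [<-|[]].
by apply: nd_hyp; left.
Qed.

Lemma provable_mono T S p :
  (forall q, T q -> S q) -> provable T p -> provable S p.
Proof. by move=> TS [G [GT D]]; exists G; split=> // q /GT /TS. Qed.

Lemma provable_impE T p q :
  provable T (fimp p q) -> provable T p -> provable T q.
Proof.
move=> [G [GT D]] [G' [GT' D']]; exists (G ++ G')%list; split.
  by move=> r /List.in_app_iff[/GT|/GT'].
by apply: nd_impE (nd_weak D _) (nd_weak D' _) => r Gr;
  apply/List.in_app_iff; [left|right].
Qed.

Lemma provable_impI T p q : provable (add_ax T p) q -> provable T (fimp p q).
Proof.
move=> [G [GT D]].
have [G' [GT' sG]] : exists G', (forall r, List.In r G' -> T r) /\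
    List.incl G (p :: G').
  elim: G GT {D} => [|r G IH] GT; first by exists nil; split=> // q' [].
  have [|G' [GT' sG]] := IH; first by move=> q' Gq'; apply: GT; right.
  have [->|Tr] := GT r (or_introl erefl).
    by exists G'; split=> // q' [<-|/sG //]; left.
  exists (r :: G'); split; first by move=> q' [<-|/GT'].
  by move=> q' [<-|/sG [->|?]]; [right; left|left|right; right].
by exists G'; split=> //; apply: nd_impI; apply: nd_weak D sG.
Qed.

Lemma provable_dne T p : provable T (fneg (fneg p)) -> provable T p.
Proof. by move=> [G [GT D]]; exists G; split=> //; apply: nd_dne. Qed.

Lemma provable_exfalso T p : provable T fbot -> provable T p.
Proof.
move=> Tb; apply: provable_dne; apply: provable_impI.
by apply: provable_mono Tb => q; right.
Qed.

Lemma provable_allE T p t : provable T (fall p) -> provable T (finst t p).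
Proof. by move=> [G [GT D]]; exists G; split=> //; apply: nd_allE. Qed.

Lemma provable_allSE T p x : provable T (fallS p) -> provable T (finstS x p).
Proof. by move=> [G [GT D]]; exists G; split=> //; apply: nd_allSE. Qed.

(** Absence of a free variable is expressed by indifference to the value of the substitution there,
    which is the only form in which it is used. *)
Definition unused c p := forall s s' r,
  (forall n, n <> c -> s n = s' n) -> fsubst s r p = fsubst s' r p.

Definition unusedS c p := forall s r r',
  (forall n, n <> c -> r n = r' n) -> fsubst s r p = fsubst s r' p.

Lemma provable_generalize T c p :
  (forall q, T q -> unused c q) -> unused c (fall p) ->
  provable T (finst (tvar c) p) -> provable T (fall p).
Proof.
move=> Tc pc [G [GT D]]; exists G; split=> //; apply: nd_allI.
(* [s] sends [c] to the variable about to be bound and lifts all others. It acts as [flift] on the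
   hypotheses and undoes the instance of [p] at [c]. *)
pose s n := if n == c then tvar 0 else tvar n.+1.
have sE n : n <> c -> s n = tvar n.+1 by rewrite /s; case: eqP.
have := nd_fsubst s id D.
have -> : List.map (fsubst s id) G = List.map flift G.
  by apply: List.map_ext_in => q /GT /Tc uq; apply: uq => n /sE.
suff -> : fsubst s id (finst (tvar c) p) = p by [].
have /= := pc s (fun n => tvar n.+1) id sE; case=> pE.
rewrite fsubst_finst /= {1}/s eqxx pE finst_fsubst -{2}[p]fsubst_id.
by congr (fsubst _ _ p); apply: funext => -[].
Qed.

Lemma provable_generalizeS T c p :
  (forall q, T q -> unusedS c q) -> unusedS c (fallS p) ->
  provable T (finstS c p) -> provable T (fallS p).
Proof.
move=> Tc pc [G [GT D]]; exists G; split=> //; apply: nd_allSI.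
pose s n := if n == c then 0 else n.+1.
have sE n : n <> c -> s n = n.+1 by rewrite /s; case: eqP.
have := nd_fsubst tvar s D.
have -> : List.map (fsubst tvar s) G = List.map fliftS G.
  by apply: List.map_ext_in => q /GT /Tc; apply.
suff -> : fsubst tvar s (finstS c p) = p by [].
have /= := pc tvar s S sE; case=> pE.
rewrite fsubst_finstS {1}/s eqxx pE finstS_fsubst -{2}[p]fsubst_id.
by congr (fsubst _ _ p); apply: funext => -[].
Qed.

Lemma tsubst_bounded t : exists N, forall s s',
  (forall n, n < N -> s n = s' n) -> tsubst s t = tsubst s' t.
Proof.
elim: t => [n|||a [N IHa] b [N' IHb]|a [N IHa] b [N' IHb]].
- by exists n.+1 => s s' /=; apply.
- by exists 0.
- by exists 0.
- exists (maxn N N') => s s' E /=.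
  by rewrite (IHa s s') ?(IHb s s') // => n ltn; apply: E; lia.
exists (maxn N N') => s s' E /=.
by rewrite (IHa s s') ?(IHb s s') // => n ltn; apply: E; lia.
Qed.

Lemma fsubst_bounded p : exists N, forall s s' r r',
  (forall n, n < N -> s n = s' n) -> (forall n, n < N -> r n = r' n) ->
  fsubst s r p = fsubst s' r' p.
Proof.
elim: p => [a b|a b|a x||p [N IHp] q [N' IHq]|p [N IHp]|p [N IHp]] /=.
- have [N IHa] := tsubst_bounded a; have [N' IHb] := tsubst_bounded b.
  exists (maxn N N') => s s' r r' E _.
  by rewrite (IHa s s') ?(IHb s s') // => n ltn; apply: E; lia.
- have [N IHa] := tsubst_bounded a; have [N' IHb] := tsubst_bounded b.
  exists (maxn N N') => s s' r r' E _.
  by rewrite (IHa s s') ?(IHb s s') // => n ltn; apply: E; lia.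
- have [N IHa] := tsubst_bounded a.
  exists (maxn N x.+1) => s s' r r' E E'.
  by rewrite (IHa s s') ?E' //; [lia|move=> n ltn; apply: E; lia].
- by exists 0.
- exists (maxn N N') => s s' r r' E E'.
  by rewrite (IHp s s' r r') ?(IHq s s' r r') // => n ltn;
    [apply: E|apply: E'|apply: E|apply: E']; lia.
- exists N => s s' r r' E E'; rewrite (IHp (up s) (up s') r r') //.
  by case=> //= n ltn; rewrite E //; lia.
exists N => s s' r r' E E'; rewrite (IHp s s' (upS r) (upS r')) //.
by case=> //= n ltn; rewrite E' //; lia.
Qed.

Lemma unused_large p :
  exists N, forall c, N <= c -> unused c p /\ unusedS c p.
Proof.
have [N H] := fsubst_bounded p; exists N => c lec.
by split=> s s' r E; apply: H => // n ltn; apply: E; lia.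
Qed.

End Provability.

(** * Complete Henkin theories *)

Definition consistent (T : fm -> Prop) := ~ provable T fbot.

Lemma consistent_add T p :
  consistent T -> ~ consistent (add_ax T p) -> provable T (fneg p).
Proof. by move=> _ /contrapT; apply: provable_impI. Qed.

(** The fresh variables serve as Henkin constants. A formula uses up only finitely many of them, so
    the property survives each stage of the construction. *)
Definition has_fresh (T : fm -> Prop) := forall N,
  exists2 c, N <= c & forall q, T q -> unused c q /\ unusedS c q.

Lemma has_fresh_add T p : has_fresh T -> has_fresh (add_ax T p).
Proof.
move=> fT N; have [N' H] := unused_large p.
have [c lec Tc] := fT (maxn N N'); exists c; first lia.
by move=> q [->|/Tc //]; apply: H; lia.
Qed.

(** Witnesses are attached to negated universal formulas because existential quantifiers are
    abbreviations. *)
Definition decides (T : fm -> Prop) (p : fm) :=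
  T p \/ [/\ T (fneg p),
    forall q, p = fall q -> exists c, T (fneg (finst (tvar c) q)) &
    forall q, p = fallS q -> exists c, T (fneg (finstS c q))].

(** When a universal [p] is refuted, the negation of its instance at a fresh variable may be added
    as well: a proof of that instance would generalize to a proof of [p]. *)
Lemma henkin_step T p : consistent T -> has_fresh T ->
  exists T', [/\ consistent T', has_fresh T', (forall q, T q -> T' q) &
    decides T' p].
Proof.
move=> cT fT; have [cTp|ncTp] := pselect (consistent (add_ax T p)).
  exists (add_ax T p); split=> //; first exact: has_fresh_add.
    by move=> q; right.
  by left; left.
have Tnp := consistent_add cT ncTp.
have cT1 : consistent (add_ax T (fneg p)).
  move=> H; apply: cT; apply: provable_impE (provable_impI H) _.
  exact: Tnp.
have fT1 := has_fresh_add (fneg p) fT.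
set T1 := add_ax T (fneg p) in cT1 fT1.
have T1p : T1 (fneg p) by left.
have T1b : provable T1 p -> False.
  by move=> H; apply: cT1; apply: provable_impE (provable_hyp T1p) H.
have close q : ~ provable T1 q -> exists T',
    [/\ consistent T', has_fresh T', (forall q', T1 q' -> T' q') & T' (fneg q)].
  move=> nq; exists (add_ax T1 (fneg q)); split.
  - by move=> H; apply: nq; apply: provable_dne; apply: provable_impI.
  - exact: has_fresh_add.
  - by move=> q'; right.
  by left.
have [N HN] := unused_large p; have [c lec Tc] := fT1 N.
case: (HN c lec) => pc pcS.
have TT1 q : T q -> T1 q by right.
case: p @T1 T1p T1b close pc pcS TT1 Tc {ncTp Tnp HN cT1 fT1 lec} (cT1) (fT1)
  => [a b|a b|a x||p q|p|p] T1 T1p T1b close pc pcS TT1 Tc cT1 fT1.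
1-5: by exists T1; split=> //; right.
- have [|T' [cT' fT' sT' T'c]] := close (finst (tvar c) p).
    move=> /(provable_generalize _ pc) H; apply: T1b; apply: H.
    by move=> q /Tc[].
  exists T'; split=> //; first by move=> q /TT1 /sT'.
  right; split=> // [|q [<-]]; last by exists c.
  exact: sT'.
have [|T' [cT' fT' sT' T'c]] := close (finstS c p).
  move=> /(provable_generalizeS _ pcS) H; apply: T1b; apply: H.
  by move=> q /Tc[].
exists T'; split=> //; first by move=> q /TT1 /sT'.
right; split=> // [|q [<-]]; last by exists c.
exact: sT'.
Qed.

(** Embedding the syntax in generic trees gives the enumeration of formulas along which the Henkin
    construction runs. *)
Fixpoint tm_tree (t : tm) : GenTree.tree nat :=
  match t with
  | tvar n => GenTree.Leaf n
  | tzero => GenTree.Node 0 nil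
  | tone => GenTree.Node 1 nil
  | tadd a b => GenTree.Node 2 [:: tm_tree a; tm_tree b]
  | tmul a b => GenTree.Node 3 [:: tm_tree a; tm_tree b]
  end.

Fixpoint tree_tm (t : GenTree.tree nat) : tm :=
  match t with
  | GenTree.Leaf n => tvar n
  | GenTree.Node 1 _ => tone
  | GenTree.Node 2 [:: a; b] => tadd (tree_tm a) (tree_tm b)
  | GenTree.Node 3 [:: a; b] => tmul (tree_tm a) (tree_tm b)
  | GenTree.Node _ _ => tzero
  end.

Lemma tm_treeK : cancel tm_tree tree_tm.
Proof. by elim=> //= [a -> b ->|a -> b ->]. Qed.

Fixpoint fm_tree (p : fm) : GenTree.tree nat :=
  match p with
  | feq a b => GenTree.Node 0 [:: tm_tree a; tm_tree b]
  | flt a b => GenTree.Node 1 [:: tm_tree a; tm_tree b]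
  | fmem a x => GenTree.Node 2 [:: tm_tree a; GenTree.Leaf x]
  | fbot => GenTree.Node 3 nil
  | fimp p q => GenTree.Node 4 [:: fm_tree p; fm_tree q]
  | fall p => GenTree.Node 5 [:: fm_tree p]
  | fallS p => GenTree.Node 6 [:: fm_tree p]
  end.

Fixpoint tree_fm (t : GenTree.tree nat) : fm :=
  match t with
  | GenTree.Node 0 [:: a; b] => feq (tree_tm a) (tree_tm b)
  | GenTree.Node 1 [:: a; b] => flt (tree_tm a) (tree_tm b)
  | GenTree.Node 2 [:: a; GenTree.Leaf x] => fmem (tree_tm a) x
  | GenTree.Node 4 [:: p; q] => fimp (tree_fm p) (tree_fm q)
  | GenTree.Node 5 [:: p] => fall (tree_fm p)
  | GenTree.Node 6 [:: p] => fallS (tree_fm p)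
  | _ => fbot
  end.

Lemma fm_treeK : cancel fm_tree tree_fm.
Proof. by elim=> //= *; rewrite ?tm_treeK //; congruence. Qed.

Definition fm_enum (n : nat) : fm :=
  if unpickle n is Some t then tree_fm t else fbot.

Lemma fm_enum_surj p : exists n, fm_enum n = p.
Proof. by exists (pickle (fm_tree p)); rewrite /fm_enum pickleK fm_treeK. Qed.

(** By [henkin_var] every element of the term model is the value of a number variable, so that
    parameters in the axiom schemes can be supplied by variables. *)
Record henkin (H : fm -> Prop) : Prop := {
  henkin_con : consistent H;
  henkin_dec : forall p, H p \/ H (fneg p);
  henkin_ex : forall p, H (fneg (fall p)) ->
    exists t, H (fneg (finst t p));
  henkin_var : forall t, exists n, H (feq t (tvar n));
  henkin_exS : forall p, H (fneg (fallS p)) ->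
    exists x, H (fneg (finstS x p)) }.

Lemma henkin_extension T : consistent T -> has_fresh T ->
  exists H, (forall q, T q -> H q) /\ henkin H.
Proof.
move=> cT fT.
pose stage := {S : fm -> Prop | consistent S /\ has_fresh S}.
have step (S : stage) n : {S' : stage |
    (forall q, sval S q -> sval S' q) /\ decides (sval S') (fm_enum n)}.
  apply: cid; case: S => S [cS fS] /=.
  have [S' [cS' fS' sS' dS']] := henkin_step (fm_enum n) cS fS.
  by exists (exist _ S' (conj cS' fS')).
pose chain := fix chain n : stage :=
  match n with
  | 0 => exist _ T (conj cT fT)
  | S m => sval (step (chain m) m)
  end.
have chain_le m n q : m <= n -> sval (chain m) q -> sval (chain n) q.
  elim: n => [|n IH]; first by rewrite leqn0 => /eqP->.
  rewrite leq_eqVlt => /orP[/eqP-> //|]; rewrite ltnS => /IH{}IH Hq.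
  by have [sub _] := svalP (step (chain n) n); apply: sub; apply: IH.
have chain_dec n : decides (sval (chain n.+1)) (fm_enum n).
  by have [_] := svalP (step (chain n) n).
pose H q := exists n, sval (chain n) q.
have H_con : consistent H.
  move=> [G [GH D]].
  have [N HN] : exists N, forall q, List.In q G -> sval (chain N) q.
    elim: G GH {D} => [|q G IH] GH; first by exists 0 => q [].
    have [|N HN] := IH; first by move=> q' Gq'; apply: GH; right.
    have [M HM] := GH q (or_introl erefl).
    exists (maxn M N) => q' [<-|/HN]; last by apply: chain_le; lia.
    by apply: chain_le HM; lia.
  by have [cN _] := svalP (chain N); apply: cN; exists G.
have H_dec p : H p \/ [/\ H (fneg p),
    forall q, p = fall q -> exists c, H (fneg (finst (tvar c) q)) &
    forall q, p = fallS q -> exists c, H (fneg (finstS c q))].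
  have [n <-] := fm_enum_surj p.
  case: (chain_dec n) => [Hp|[Hp Ha Hs]]; first by left; exists n.+1.
  right; split; first by exists n.+1.
    by move=> q /Ha[c Hc]; exists c, n.+1.
  by move=> q /Hs[c Hc]; exists c, n.+1.
have clash p : H p -> H (fneg p) -> False.
  move=> Hp Hnp; apply: H_con.
  exact: provable_impE (provable_hyp Hnp) (provable_hyp Hp).
exists H; split; first by move=> q Tq; exists 0.
have H_ex p : H (fneg (fall p)) -> exists c, H (fneg (finst (tvar c) p)).
  by move=> Hnp; case: (H_dec (fall p)) => [/clash/(_ Hnp)|[_ /(_ p erefl)]].
split=> //.
- by move=> p; case: (H_dec p) => [|[]]; [left|right].
- by move=> p /H_ex[c Hc]; exists (tvar c).
(* The formula [forall x, t <> x] fails at [t] itself; the Henkin witness for its negation is a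
   variable equal to [t]. *)
- move=> t; pose p := fneg (feq (tlift t) (tvar 0)).
  have pE u : finst u p = fneg (feq t u).
    by rewrite /finst /= /tlift tsubst_comp tsubst_id.
  case: (H_dec (fall p)) => [Hp|[Hp _ _]].
    exfalso; apply: H_con.
    apply: (@provable_impE H (feq t t)).
      by rewrite -/(fneg _) -pE; apply: provable_allE; apply: provable_hyp.
    by exists nil; split=> //; apply: nd_refl.
  have [c] := H_ex _ Hp; rewrite pE => Hc; exists c.
  case: (H_dec (feq t (tvar c))) => // -[Hn _ _].
  by case: (clash _ Hn Hc).
by move=> p Hnp; case: (H_dec (fallS p)) => [/clash/(_ Hnp)|[_ _ /(_ p erefl)]].
Qed.

(** * Models and completeness *)

Record model : Type := Model {
  dom : Type;
  sets : Type;
  mzero : dom;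
  mone : dom;
  madd : dom -> dom -> dom;
  mmul : dom -> dom -> dom;
  mlt : dom -> dom -> Prop;
  mmem : dom -> sets -> Prop }.

Fixpoint teval (M : model) (e : nat -> dom M) (t : tm) : dom M :=
  match t with
  | tvar n => e n
  | tzero => mzero M
  | tone => mone M
  | tadd a b => madd (teval e a) (teval e b)
  | tmul a b => mmul (teval e a) (teval e b)
  end.

Fixpoint sat (M : model) (e : nat -> dom M) (f : nat -> sets M) (p : fm) : Prop :=
  match p with
  | feq a b => teval e a = teval e b
  | flt a b => mlt (teval e a) (teval e b)
  | fmem a x => mmem (teval e a) (f x)
  | fbot => False
  | fimp p q => sat e f p -> sat e f q
  | fall p => forall d, sat (d .: e) f p
  | fallS p => forall X, sat e (X .: f) p
  end.

Section TermModel.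
Variable H : fm -> Prop.
Hypothesis hH : henkin H.

Lemma henkin_closed p : provable H p -> H p.
Proof.
move=> Hp; case: (henkin_dec hH p) => // Hn; case: (henkin_con hH).
exact: provable_impE (provable_hyp Hn) Hp.
Qed.

Lemma henkin_imp p q : H (fimp p q) <-> (H p -> H q).
Proof.
split=> [Hpq Hp|Hpq].
  apply: henkin_closed.
  exact: provable_impE (provable_hyp Hpq) (provable_hyp Hp).
apply: henkin_closed; case: (henkin_dec hH p) => [/Hpq Hq|Hn].
  apply: provable_impI; apply: provable_hyp; by right.
apply: provable_impI; apply: provable_exfalso; apply: (@provable_impE _ p).
  by apply: provable_hyp; right.
by apply: provable_hyp; left.
Qed.

Lemma henkin_neg p : H (fneg p) <-> ~ H p.
Proof.
rewrite henkin_imp; split=> h /h //.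
by move=> Hb; case: (henkin_con hH); apply: provable_hyp.
Qed.

Lemma henkin_all p : H (fall p) <-> forall t, H (finst t p).
Proof.
split=> [Hp t|Hp].
  by apply: henkin_closed; apply: provable_allE; apply: provable_hyp.
case: (henkin_dec hH (fall p)) => // /(henkin_ex hH)[t /henkin_neg []].
exact: Hp.
Qed.

Lemma henkin_allS p : H (fallS p) <-> forall x, H (finstS x p).
Proof.
split=> [Hp t|Hp].
  by apply: henkin_closed; apply: provable_allSE; apply: provable_hyp.
case: (henkin_dec hH (fallS p)) => // /(henkin_exS hH)[t /henkin_neg []].
exact: Hp.
Qed.

Lemma henkin_refl t : H (feq t t).
Proof. by apply: henkin_closed; exists nil; split=> //; apply: nd_refl. Qed.

Lemma henkin_subst p t u : H (feq t u) -> H (finst t p) -> H (finst u p).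
Proof.
move=> Htu Ht; apply: henkin_closed.
exists [:: feq t u; finst t p]%list; split; first by move=> q [<-|[<-|[]]].
by apply: (@nd_subst _ p t); apply: nd_hyp; [left|right; left].
Qed.

Lemma tsubst_inst_tlift u t : tsubst (u .: tvar) (tlift t) = t.
Proof. by rewrite /tlift tsubst_comp tsubst_id. Qed.

Lemma henkin_sym t u : H (feq t u) -> H (feq u t).
Proof.
move=> Htu; have := @henkin_subst (feq (tvar 0) (tlift t)) t u Htu.
by rewrite /finst /= !tsubst_inst_tlift; apply; apply: henkin_refl.
Qed.

Lemma henkin_trans t u v : H (feq t u) -> H (feq u v) -> H (feq t v).
Proof.
move=> Htu Huv; have := @henkin_subst (feq (tlift t) (tvar 0)) u v Huv.
by rewrite /finst /= !tsubst_inst_tlift; apply.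
Qed.

Lemma henkin_add t t' u u' :
  H (feq t t') -> H (feq u u') -> H (feq (tadd t u) (tadd t' u')).
Proof.
move=> Ht Hu.
have := @henkin_subst (feq (tlift (tadd t u)) (tadd (tvar 0) (tlift u))) _ _ Ht.
rewrite /finst /= !tsubst_inst_tlift => /(_ (henkin_refl _)) H1.
have := @henkin_subst (feq (tlift (tadd t u)) (tadd (tlift t') (tvar 0))) _ _ Hu.
by rewrite /finst /= !tsubst_inst_tlift; apply.
Qed.

Lemma henkin_mul t t' u u' :
  H (feq t t') -> H (feq u u') -> H (feq (tmul t u) (tmul t' u')).
Proof.
move=> Ht Hu.
have := @henkin_subst (feq (tlift (tmul t u)) (tmul (tvar 0) (tlift u))) _ _ Ht.
rewrite /finst /= !tsubst_inst_tlift => /(_ (henkin_refl _)) H1.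
have := @henkin_subst (feq (tlift (tmul t u)) (tmul (tlift t') (tvar 0))) _ _ Hu.
by rewrite /finst /= !tsubst_inst_tlift; apply.
Qed.

Lemma henkin_lt t t' u u' :
  H (feq t t') -> H (feq u u') -> H (flt t u) -> H (flt t' u').
Proof.
move=> Ht Hu Htu.
have := @henkin_subst (flt (tvar 0) (tlift u)) _ _ Ht.
rewrite /finst /= !tsubst_inst_tlift => /(_ Htu) H1.
have := @henkin_subst (flt (tlift t') (tvar 0)) _ _ Hu.
by rewrite /finst /= !tsubst_inst_tlift; apply.
Qed.

Lemma henkin_mem t t' x : H (feq t t') -> H (fmem t x) -> H (fmem t' x).
Proof. by move=> Ht; have := @henkin_subst (fmem (tvar 0) x) _ _ Ht. Qed.

Definition term_class (t u : tm) : Prop := H (feq t u).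

Definition term_dom : Type := {P : tm -> Prop | exists t, P = term_class t}.

Definition cls (t : tm) : term_dom := exist _ (term_class t) (ex_intro _ t erefl).

Definition repr (d : term_dom) : tm := sval (cid (svalP d)).

Lemma clsP t u : cls t = cls u <-> H (feq t u).
Proof.
split=> [[E]|Htu].
  have : term_class u u by apply: henkin_refl.
  by rewrite -E.
apply: eq_exist; rewrite /=; apply: funext => v; apply: propext.
split; last exact: henkin_trans Htu.
exact: henkin_trans (henkin_sym Htu).
Qed.

Lemma cls_repr d : cls (repr d) = d.
Proof.
rewrite /repr; case: cid => t; case: d => P hP /= E.
by apply: eq_exist; rewrite E.
Qed.

Lemma repr_cls t : H (feq (repr (cls t)) t).
Proof. by apply/clsP; rewrite cls_repr. Qed.

(** Only the numbers are divided by provable equality. The sets are the set variables themselves, as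
    the language has no equality between sets. *)
Definition term_model : model := @Model term_dom nat (cls tzero) (cls tone)
  (fun a b => cls (tadd (repr a) (repr b)))
  (fun a b => cls (tmul (repr a) (repr b)))
  (fun a b => H (flt (repr a) (repr b)))
  (fun a x => H (fmem (repr a) x)).

Lemma term_model_eval s t :
  teval (M := term_model) (fun n => cls (s n)) t = cls (tsubst s t).
Proof.
elim: t => //= a -> b ->; apply/clsP; [apply: henkin_add|apply: henkin_mul];
  exact: repr_cls.
Qed.

Lemma term_model_sat p s r :
  sat (M := term_model) (fun n => cls (s n)) r p <-> H (fsubst s r p).
Proof.
elim: p s r => [a b|a b|a x||p IHp q IHq|p IHp|p IHp] s r /=;
  rewrite ?term_model_eval.
- exact: clsP.
- split; apply: henkin_lt; try exact: repr_cls; exact: henkin_sym (repr_cls _).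
- split; apply: henkin_mem; try exact: repr_cls; exact: henkin_sym (repr_cls _).
- by split=> // Hb; case: (henkin_con hH); apply: provable_hyp.
- by rewrite henkin_imp IHp IHq.
- rewrite henkin_all; split=> h t.
    rewrite finst_fsubst -IHp.
    have := h (cls t); congr (sat _ _ p); apply: funext => -[] //.
  have := h (repr t); rewrite finst_fsubst -IHp; congr (sat _ _ p).
  by apply: funext => -[|n] //=; apply: cls_repr.
rewrite henkin_allS; split=> h t.
  by rewrite finstS_fsubst -IHp; apply: h.
by apply/IHp; rewrite -finstS_fsubst.
Qed.

End TermModel.

(** The surjective assignments [e0] and [f0] name all parameters later on. The refuting assignment
    is a different one, which uses only the even variables. *)
Lemma completeness T p : ~ provable T p ->
  exists (M : model) (e0 : nat -> dom M) (f0 : nat -> sets M),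
    [/\ forall d, exists n, e0 n = d, forall X, exists n, f0 n = X &
      exists e f, (forall q, T q -> sat (M := M) e f q) /\ ~ sat (M := M) e f p].
Proof.
move=> nTp.
(* Renaming all variables to even ones leaves the odd ones as Henkin witnesses. *)
pose ev n := tvar n.*2; pose evS n := n.*2.
pose T1 q' := exists2 q, add_ax T (fneg p) q & q' = fsubst ev evS q.
have cT1 : consistent T1.
  move=> [G [GT D]]; apply: nTp; apply: provable_dne; apply: provable_impI.
  have := nd_fsubst (fun n => tvar n./2) half D.
  exists (List.map (fsubst (fun n => tvar n./2) half) G); split=> //.
  move=> _ /List.in_map_iff[_ [<- /GT[q Tq ->]]].
  rewrite fsubst_comp; suff -> : fsubst (fun n => tvar (n.*2)./2)
    (fun n => (n.*2)./2) q = q by [].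
  rewrite -[RHS]fsubst_id; congr (fsubst _ _ q); apply: funext => n;
    by rewrite doubleK.
have fT1 : has_fresh T1.
  move=> N; exists N.*2.+1; first lia.
  move=> _ [q _ ->]; split=> s s' r E; rewrite !fsubst_comp;
    congr (fsubst _ _ q); apply: funext => n; apply: E; rewrite /evS; lia.
have [H [TH hH]] := henkin_extension cT1 fT1.
exists (term_model H), (fun n => cls H (tvar n)), id; split.
- move=> d; have [n Hn] := henkin_var hH (repr d).
  by exists n; rewrite -[d]cls_repr; apply/esym/clsP.
- by move=> X; exists X.
exists (fun n => cls H (ev n)), evS; split=> [q Tq|].
  by apply/term_model_sat => //; apply: TH; exists q => //; right.
rewrite (term_model_sat hH).
by apply/(henkin_neg hH); apply: TH; exists (fneg p) => //; left.
Qed.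

(** * Models of RCA_0 *)

Lemma teval_tsubst (M : model) (e : nat -> dom M) s t :
  teval e (tsubst s t) = teval (fun n => teval e (s n)) t.
Proof. by elim: t => //= [a -> b ->|a -> b ->]. Qed.

Lemma sat_fsubst (M : model) (e : nat -> dom M) (f : nat -> sets M) s r p :
  sat e f (fsubst s r p) <-> sat (fun n => teval e (s n)) (fun n => f (r n)) p.
Proof.
elim: p e f s r => [a b|a b|a x||p IHp q IHq|p IHp|p IHp] e f s r //=;
  rewrite ?teval_tsubst //.
- by rewrite IHp IHq.
- suff E d : sat (d .: e) f (fsubst (up s) r p)
      <-> sat (d .: (fun n => teval e (s n))) (fun n => f (r n)) p.
    by split=> h d; apply/E.
  rewrite IHp; suff -> : (fun n => teval (d .: e) (up s n))
    = d .: (fun n => teval e (s n)) by [].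
  by apply: funext => -[|n] //=; rewrite /tlift teval_tsubst.
suff E X : sat e (X .: f) (fsubst s (upS r) p)
    <-> sat (fun n => teval e (s n)) (X .: (fun n => f (r n))) p.
  by split=> h d; apply/E.
rewrite IHp; suff -> : (fun n => (X .: f) (upS r n))
  = X .: (fun n => f (r n)) by [].
by apply: funext => -[|n].
Qed.

Definition append {A : Type} (k : nat) (v e : nat -> A) (n : nat) : A :=
  if n < k then v n else e (n - k).

Lemma append_cons A k (x : A) v e : append k.+1 (x .: v) e = x .: append k v e.
Proof. by apply: funext => -[]. Qed.

Lemma append0 A (v e : nat -> A) : append 0 v e = e.
Proof. by apply: funext => n; rewrite /append subn0. Qed.

Definition tl {A : Type} (v : nat -> A) : nat -> A := fun n => v n.+1.

Lemma scons_tl A (v : nat -> A) : v 0 .: tl v = v.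
Proof. by apply: funext => -[]. Qed.

Lemma sat_bounded p : exists N, forall (M : model) (e e' : nat -> dom M)
    (f f' : nat -> sets M), (forall n, n < N -> e n = e' n) ->
  (forall n, n < N -> f n = f' n) -> sat e f p -> sat e' f' p.
Proof.
have [N HN] := fsubst_bounded p; exists N.+1 => M e e' f f' E E'.
pose s n := if n < N then n else 0.
have pE : p = fsubst (fun n => tvar (s n)) s p.
  rewrite -[LHS]fsubst_id; apply: HN => n ltn; by rewrite /s ltn.
rewrite pE !sat_fsubst /=; congr (sat _ _ p); apply: funext => n.
  by apply: E; rewrite /s; case: (ltnP n N); lia.
by apply: E'; rewrite /s; case: (ltnP n N); lia.
Qed.

Lemma sat_iter_fall (M : model) (e v : nat -> dom M) f k p :
  sat e f (iter k fall p) -> sat (append k v e) f p.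
Proof.
elim: k p v => [|k IH] p v; first by rewrite append0.
by rewrite iterSr -[v]scons_tl append_cons => /(IH _ (tl v)); apply.
Qed.

Lemma sat_iter_fallS (M : model) (e : nat -> dom M) (f v : nat -> sets M) k p :
  sat e f (iter k fallS p) -> sat e (append k v f) p.
Proof.
elim: k p v => [|k IH] p v; first by rewrite append0.
by rewrite iterSr -[v]scons_tl append_cons => /(IH _ (tl v)); apply.
Qed.

(** A formula has finitely many variables, and prefixing it with enough quantifiers of both sorts
    gives a further member of [generalization A]; its truth under one assignment yields the original
    under all of them. *)
Lemma sat_generalization (A : fm -> Prop) (M : model) (e : nat -> dom M) f :
  (forall q, generalization A q -> sat e f q) ->
  forall q, generalization A q -> forall e' f', sat (M := M) e' f' q.
Proof.
move=> h q Aq e' f'; have [N HN] := sat_bounded q.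
apply: (HN M (append N e' e) _ (append N f' f)).
- by move=> n ltn; rewrite /append ltn.
- by move=> n ltn; rewrite /append ltn.
apply: sat_iter_fallS; apply: sat_iter_fall; apply: h.
elim: {1}N => [|k IH]; last exact: gen_all.
by elim: {1}N => [|k IH]; [|apply: gen_allS].
Qed.

Record rca_model : Type := RcaModel {
  rca_carrier :> model;
  par : nat -> dom rca_carrier;
  parS : nat -> sets rca_carrier;
  par_surj : forall d, exists n, par n = d;
  parS_surj : forall X, exists n, parS n = X;
  rca_sat : forall q, RCA0 q -> forall e f, sat (M := rca_carrier) e f q }.

Lemma not_all_not (A : Type) (P : A -> Prop) :
  ~ (forall x, ~ P x) <-> exists x, P x.
Proof.
split=> [h|[x Px] h]; last exact: h Px.
by apply: contrapT => nP; apply: h => x Px; apply: nP; exists x.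
Qed.

Lemma not_imp_not (P Q : Prop) : ~ (P -> ~ Q) <-> P /\ Q.
Proof.
split=> [h|[p q] h]; last exact: h.
by split; apply: contrapT => n; apply: h => // p q; apply: n.
Qed.

Lemma not_imp (P Q : Prop) : (~ P -> Q) <-> P \/ Q.
Proof. by split=> [h|[]] //; case: (pselect P) => [|/h]; [left|right]. Qed.

Section Connectives.
Variables (M : model) (e : nat -> dom M) (f : nat -> sets M).

Lemma sat_fex p : sat e f (fex p) <-> exists d, sat (d .: e) f p.
Proof. exact: not_all_not. Qed.

Lemma sat_fexS p : sat e f (fexS p) <-> exists X, sat e (X .: f) p.
Proof. exact: not_all_not. Qed.

Lemma sat_fand p q : sat e f (fand p q) <-> sat e f p /\ sat e f q.
Proof. exact: not_imp_not. Qed.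

Lemma sat_fiff p q : sat e f (fiff p q) <-> (sat e f p <-> sat e f q).
Proof. exact: not_imp_not. Qed.

End Connectives.

(** * Definable relations of a model, and the schemes of RCA_0 applied to them *)

Section Definability.
Variable M : rca_model.
Notation D := (dom M).
Notation env := (nat -> D).
Notation e0 := (@par M).
Notation f0 := (@parS M).
Implicit Types (k : nat) (v : env) (P Q : env -> Prop).

(* [k] is the number of variables in the context; all later variables of the
   defining formula are parameters. *)
Definition definable_tm k (t : env -> D) :=
  exists a, forall v, teval (append k v e0) a = t v.

Definition definable0 k P :=
  exists2 p, bounded p & forall v, sat (append k v e0) f0 p <-> P v.

Definition definable1 k P :=
  exists2 Q, definable0 k.+1 Q & forall v, P v <-> exists y, Q (y .: v).

Lemma def_var k n : n < k -> definable_tm k (fun v => v n).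
Proof. by move=> ltn; exists (tvar n) => v /=; rewrite /append ltn. Qed.

Lemma def_const k d : definable_tm k (fun=> d).
Proof.
have [n <-] := par_surj d; exists (tvar (k + n)) => v /=.
by rewrite /append ltnNge leq_addr addKn.
Qed.

Lemma def_add k s t : definable_tm k s -> definable_tm k t ->
  definable_tm k (fun v => madd (s v) (t v)).
Proof.
by move=> [a aE] [b bE]; exists (tadd a b) => v /=; rewrite aE bE.
Qed.

Lemma def_mul k s t : definable_tm k s -> definable_tm k t ->
  definable_tm k (fun v => mmul (s v) (t v)).
Proof.
by move=> [a aE] [b bE]; exists (tmul a b) => v /=; rewrite aE bE.
Qed.

Lemma def_lift k t : definable_tm k t -> definable_tm k.+1 (fun v => t (tl v)).
Proof.
move=> [a aE]; exists (tlift a) => v.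
by rewrite /tlift teval_tsubst /= -aE -[v]scons_tl append_cons.
Qed.

Lemma def0_ext k P Q : (forall v, P v <-> Q v) -> definable0 k P -> definable0 k Q.
Proof. by move=> E [p bp pE]; exists p => // v; rewrite pE E. Qed.

Lemma def0_eq k s t : definable_tm k s -> definable_tm k t ->
  definable0 k (fun v => s v = t v).
Proof.
move=> [a aE] [b bE]; exists (feq a b); first exact: bd_eq.
by move=> v /=; rewrite aE bE.
Qed.

Lemma def0_lt k s t : definable_tm k s -> definable_tm k t ->
  definable0 k (fun v => mlt (s v) (t v)).
Proof.
move=> [a aE] [b bE]; exists (flt a b); first exact: bd_lt.
by move=> v /=; rewrite aE bE.
Qed.

Lemma def0_mem k s X : definable_tm k s -> definable0 k (fun v => mmem (s v) X).
Proof.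
move=> [a aE]; have [n <-] := parS_surj X; exists (fmem a n); first exact: bd_mem.
by move=> v /=; rewrite aE.
Qed.

Lemma def0_imp k P Q : definable0 k P -> definable0 k Q ->
  definable0 k (fun v => P v -> Q v).
Proof.
move=> [p bp pE] [q bq qE]; exists (fimp p q); first exact: bd_imp.
by move=> v /=; rewrite pE qE.
Qed.

Lemma def0_const k (A : Prop) : definable0 k (fun=> A).
Proof.
have [a|na] := pselect A.
  exists (fimp fbot fbot); first by apply: bd_imp; apply: bd_bot.
  by move=> v; split=> /=.
by exists fbot; first exact: bd_bot.
Qed.

Lemma def0_not k P : definable0 k P -> definable0 k (fun v => ~ P v).
Proof. by move=> dP; apply: def0_imp => //; apply: def0_const. Qed.

Lemma def0_and k P Q : definable0 k P -> definable0 k Q ->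
  definable0 k (fun v => P v /\ Q v).
Proof.
move=> dP dQ.
apply: (@def0_ext _ (fun v => ~ (P v -> ~ Q v))) => [v|]; first exact: not_imp_not.
by apply: def0_not; apply: def0_imp => //; apply: def0_not.
Qed.

Lemma def0_or k P Q : definable0 k P -> definable0 k Q ->
  definable0 k (fun v => P v \/ Q v).
Proof.
move=> dP dQ.
apply: (@def0_ext _ (fun v => ~ P v -> Q v)) => [v|]; first exact: not_imp.
by apply: def0_imp => //; apply: def0_not.
Qed.

Lemma def0_iff k P Q : definable0 k P -> definable0 k Q ->
  definable0 k (fun v => P v <-> Q v).
Proof. by move=> dP dQ; apply: def0_and; apply: def0_imp. Qed.

Lemma def0_ball k t (P : D -> env -> Prop) : definable_tm k t ->
  definable0 k.+1 (fun v => P (v 0) (tl v)) ->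
  definable0 k (fun v => forall y, mlt y (t v) -> P y v).
Proof.
move=> [a aE] [p bp pE].
exists (fall (fimp (flt (tvar 0) (tlift a)) p)); first exact: bd_all.
move=> v /=; rewrite /tlift; split=> h y.
  have := h y; rewrite -append_cons pE teval_tsubst /= append_cons /=.
  by rewrite aE.
by rewrite teval_tsubst /= aE -append_cons pE; apply: h.
Qed.

Lemma def0_bex k t (P : D -> env -> Prop) : definable_tm k t ->
  definable0 k.+1 (fun v => P (v 0) (tl v)) ->
  definable0 k (fun v => exists2 y, mlt y (t v) & P y v).
Proof.
move=> dt dP.
apply: (@def0_ext _ (fun v => ~ forall y, mlt y (t v) -> ~ P y v)) => [v|].
  split=> [/existsNP[y /not_implyP[ly /contrapT Py]]|[y ly Py] h];
    [by exists y|exact: h Py].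
by apply: def0_not; apply: def0_ball => //; apply: def0_not.
Qed.

Lemma def0_exists_lt k t (P : D -> env -> Prop) : definable_tm k t ->
  definable0 k.+1 (fun v => P (v 0) (tl v)) ->
  definable0 k (fun v => exists y, mlt y (t v) /\ P y v).
Proof.
move=> dt /(def0_bex dt); apply: def0_ext => v.
by split=> [[y ly Py]|[y [ly Py]]]; exists y.
Qed.

Lemma def0_local k P v v' : definable0 k P ->
  (forall n, n < k -> v n = v' n) -> P v -> P v'.
Proof.
move=> [p _ pE] E; rewrite -!pE; congr (sat _ _ p).
by apply: funext => n; rewrite /append; case: ifP => // /E.
Qed.

Lemma tsubst_tlift s a : tsubst (up s) (tlift a) = tlift (tsubst s a).
Proof. by rewrite /tlift !tsubst_comp. Qed.

Lemma bounded_fsubst s r p : bounded p -> bounded (fsubst s r p).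
Proof.
move=> bp; elim: bp s r => {p} [a b|a b|a x||p q _ IHp _ IHq|t p _ IHp] s r /=.
- exact: bd_eq.
- exact: bd_lt.
- exact: bd_mem.
- exact: bd_bot.
- exact: bd_imp.
by rewrite tsubst_tlift; apply: bd_all.
Qed.

Lemma def0_subst k k' (s : nat -> env -> D) P :
  (forall n, n < k -> definable_tm k' (s n)) -> definable0 k P ->
  definable0 k' (fun v => P (fun n => s n v)).
Proof.
move=> ds dP; case: (dP) => p bp pE.
have /choice[a aE] n : exists a, n < k ->
    forall v, teval (append k' v e0) a = s n v.
  by case: (ltnP n k) => [/ds[a aE]|_]; [exists a|exists tzero].
exists (fsubst (fun n => if n < k then a n else tvar (k' + (n - k))) id p).
  exact: bounded_fsubst.
move=> v; rewrite sat_fsubst -pE; suff -> : (fun n => teval (append k' v e0)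
    (if n < k then a n else tvar (k' + (n - k))))
  = append k (fun n => s n v) e0 by [].
apply: funext => n; rewrite [RHS]/append; case: ifP => [/aE //|_] /=.
by rewrite /append ltnNge leq_addr addKn.
Qed.

Lemma def1_ext k P Q : (forall v, P v <-> Q v) -> definable1 k P -> definable1 k Q.
Proof. by move=> E [R dR RE]; exists R => // v; rewrite -E. Qed.

Lemma def1_def0 k P : definable0 k P -> definable1 k P.
Proof.
move=> dP; exists (fun v => P (tl v)).
  by apply: (def0_subst (s := fun n v => v n.+1)) dP => n ltn; apply: def_var.
by move=> v; split=> [Pv|[]] //; exists (mzero M).
Qed.

Lemma induction1 (P : D -> Prop) : definable1 1 (fun v => P (v 0)) ->
  P (mzero M) -> (forall x, P x -> P (madd x (mone M))) -> forall x, P x.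
Proof.
move=> [Q [p bp pE] QE] P0 PS.
have satE x : sat (x .: e0) f0 (fex p) <-> P x.
  have -> : P x <-> P ((x .: e0) 0) by [].
  rewrite QE sat_fex.
  suff E y : sat (y .: (x .: e0)) f0 p <-> Q (y .: (x .: e0)).
    by split=> -[y Hy]; exists y; apply/E.
  rewrite -pE; suff -> : append 2 (y .: (x .: e0)) e0 = y .: (x .: e0) by [].
  by rewrite !append_cons append0.
have ax : RCA0 (induction_for (fex p)).
  by apply: gen_base; right; left; apply: sigma1_induction_ax; apply: sigma1_ex.
have h := rca_sat ax e0 f0.
suff hyp : sat e0 f0 (fand (finst tzero (fex p))
    (fall (fimp (fex p) (fsucc (fex p))))) by move=> x; apply/satE; apply: h.
apply/sat_fand; split.
  move: P0; rewrite /finst sat_fsubst -satE; suff -> : (fun n => teval e0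
    match n with 0 => tzero | S m => tvar m end) = mzero M .: e0 by [].
  by apply: funext => -[].
suff stp d : P d -> sat (d .: e0) f0 (fsucc (fex p)) by move=> d /satE /stp.
move=> Pd; rewrite /fsucc sat_fsubst; move/satE: (PS d Pd).
suff -> : (fun n => teval (d .: e0) match n with
    | 0 => tadd (tvar 0) tone | S m => tvar m.+1 end)
  = madd d (mone M) .: e0 by [].
by apply: funext => -[].
Qed.

Lemma induction0 (P : D -> Prop) : definable0 1 (fun v => P (v 0)) ->
  P (mzero M) -> (forall x, P x -> P (madd x (mone M))) -> forall x, P x.
Proof. by move=> /def1_def0; apply: induction1. Qed.

(** The Pi_1 formula required by the scheme is the negation of the Sigma_1 definition of the
    complement. *)
Lemma delta1_comprehension_model (P : D -> Prop) :
  definable1 1 (fun v => P (v 0)) -> definable1 1 (fun v => ~ P (v 0)) ->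
  exists X, forall x, mmem x X <-> P x.
Proof.
move=> [Q [p bp pE] QE] [Q' [q bq qE] QE'].
have env2 x y : append 2 (y .: (x .: e0)) e0 = y .: (x .: e0).
  by rewrite !append_cons append0.
have satp x : sat (x .: e0) f0 (fex p) <-> P x.
  have -> : P x <-> P ((x .: e0) 0) by [].
  rewrite QE sat_fex.
  by split=> -[y Hy]; exists y; move: Hy; rewrite -pE env2.
have satq x : sat (x .: e0) f0 (fall (fneg q)) <-> P x.
  have -> : P x <-> ~ ~ P ((x .: e0) 0) by split=> [Px|/contrapT //]; apply.
  rewrite QE' /=; split=> [h [y]|h y].
    by rewrite -qE env2; apply: h.
  by move=> Hq; apply: h; exists y; rewrite -qE env2.
have ax : RCA0 (fimp (fall (fiff (fex p) (fall (fneg q))))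
    (comprehension_for (fex p))).
  apply: gen_base; right; right; apply: delta1_ca; first exact: sigma1_ex.
  by apply: pi1_all; apply: bd_imp => //; apply: bd_bot.
have /sat_fexS[X HX] : sat e0 f0 (comprehension_for (fex p)).
  suff hyp d : sat (d .: e0) f0 (fiff (fex p) (fall (fneg q))).
    by apply: (rca_sat ax e0 f0).
  by apply/sat_fiff; rewrite satp satq.
have {}HX x : sat (x .: e0) (X .: f0) (fiff (fmem (tvar 0) 0) (fliftS (fex p))).
  exact: HX.
by exists X => x; rewrite -satp; have /sat_fiff := HX x; rewrite /fliftS sat_fsubst.
Qed.

End Definability.

Ltac def_step :=
  lazymatch goal with
  | |- definable_tm _ _ =>
      first [ apply: def_const | apply: def_var; exact: isT
            | apply: def_add | apply: def_mul ]
  | |- definable0 _ _ =>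
      first [ apply: def0_const | assumption
            | apply: def0_mem | apply: def0_eq | apply: def0_lt
            | apply: def0_iff | apply: def0_and | apply: def0_or
            | apply: def0_exists_lt | apply: def0_bex
            | apply: def0_ball | apply: def0_imp ]
  end.

Ltac definability := repeat (progress (rewrite /tl /=) || def_step).

(** * Arithmetic in a model *)

Section BasicAxioms.
Variable M : rca_model.
Notation D := (dom M).
Local Notation "x +' y" := (madd x y) (at level 50, left associativity).
Local Notation "x *' y" := (mmul x y) (at level 40, left associativity).
Local Notation o := (mzero M).
Local Notation i := (mone M).
Implicit Types x y z : D.

Lemma basic_sat p x y : basic_axiom p -> sat (x .: (y .: @par M)) (@parS M) p.
Proof. by move=> ax; apply: rca_sat; apply: gen_base; left. Qed.

Lemma msucc_neq0 x : x +' i <> o.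
Proof. exact: (basic_sat x x ax_succ_nz). Qed.

Lemma msucc_inj x y : x +' i = y +' i -> x = y.
Proof. exact: (basic_sat x y ax_succ_inj). Qed.

Lemma madd0 x : x +' o = x.
Proof. exact: (basic_sat x x ax_add0). Qed.

Lemma maddS x y : x +' (y +' i) = x +' y +' i.
Proof. exact: (basic_sat x y ax_addS). Qed.

Lemma mmul0 x : x *' o = o.
Proof. exact: (basic_sat x x ax_mul0). Qed.

Lemma mmulS x y : x *' (y +' i) = x *' y +' x.
Proof. exact: (basic_sat x y ax_mulS). Qed.

Lemma mlt0 x : ~ mlt x o.
Proof. exact: (basic_sat x x ax_lt0). Qed.

Lemma mltS x y : mlt x (y +' i) <-> mlt x y \/ x = y.
Proof.
by have /sat_fiff h := basic_sat x y ax_ltS; rewrite -not_imp; apply: h.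
Qed.

Lemma madd0l x : o +' x = x.
Proof.
move: x; apply: induction0 => [||x IH]; first by definability.
  exact: madd0.
by rewrite maddS IH.
Qed.

Lemma maddSl x y : x +' i +' y = x +' y +' i.
Proof.
move: y; apply: induction0 => [||y IH]; first by definability.
  by rewrite !madd0.
by rewrite !maddS IH.
Qed.

Lemma maddC x y : x +' y = y +' x.
Proof.
move: y; apply: induction0 => [||y IH]; first by definability.
  by rewrite madd0 madd0l.
by rewrite maddS maddSl IH.
Qed.

Lemma maddA x y z : x +' (y +' z) = x +' y +' z.
Proof.
move: z; apply: induction0 => [||z IH]; first by definability.
  by rewrite !madd0.
by rewrite !maddS IH.
Qed.

Lemma maddI z x y : x +' z = y +' z -> x = y.
Proof.
move: z; apply: induction0 => [||z IH]; first by definability.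
  by rewrite !madd0.
by rewrite !maddS => /msucc_inj.
Qed.

Lemma mmul0l x : o *' x = o.
Proof.
move: x; apply: induction0 => [||x IH]; first by definability.
  exact: mmul0.
by rewrite mmulS IH madd0.
Qed.

Lemma mmulSl x y : (x +' i) *' y = x *' y +' y.
Proof.
move: y; apply: induction0 => [||y IH]; first by definability.
  by rewrite !mmul0 madd0.
by rewrite !mmulS IH !maddS; congr (_ +' _); rewrite -!maddA [y +' x]maddC.
Qed.

Lemma mmulC x y : x *' y = y *' x.
Proof.
move: y; apply: induction0 => [||y IH]; first by definability.
  by rewrite mmul0 mmul0l.
by rewrite mmulS mmulSl IH.
Qed.

Lemma mmulDr x y z : x *' (y +' z) = x *' y +' x *' z.
Proof.
move: z; apply: induction0 => [||z IH]; first by definability.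
  by rewrite mmul0 !madd0.
by rewrite maddS !mmulS IH maddA.
Qed.

Lemma mmulA x y z : x *' (y *' z) = x *' y *' z.
Proof.
move: z; apply: induction0 => [||z IH]; first by definability.
  by rewrite !mmul0.
by rewrite !mmulS mmulDr IH.
Qed.

Lemma mmul1 x : i *' x = x.
Proof. by rewrite mmulC -[i]madd0l mmulS mmul0 madd0l. Qed.

Lemma definable1_ex k (P : D -> (nat -> D) -> Prop) :
  definable0 k.+1 (fun v => P (v 0) (tl v)) ->
  definable1 k (fun v => exists y, P y v).
Proof. by move=> dP; exists (fun v => P (v 0) (tl v)). Qed.

Lemma mltE x y : mlt x y <-> exists z, y = x +' z +' i.
Proof.
split.
  move: y; apply: induction1 => [|/mlt0 //|y IH]; last first.
    move=> /mltS[/IH[z ->]|->]; first by exists (z +' i); rewrite maddS.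
    by exists o; rewrite madd0.
  (* Moving the quantifier in front of the implication, with default witness [o], makes the
     induction statement Sigma_1. *)
  apply: (@def1_ext _ _ (fun v => exists z, mlt x (v 0) -> v 0 = x +' z +' i)).
    move=> v; split=> [[z h] /h ?|h]; first by exists z.
    by have [/h[z E]|n] := pselect (mlt x (v 0)); [exists z|exists o => /n].
  by apply: (definable1_ex (P := fun z v => mlt x (v 0) -> v 0 = x +' z +' i));
    definability.
move=> [z ->]; move: z; apply: induction0 => [||z IH]; first by definability.
  by rewrite madd0; apply/mltS; right.
by rewrite maddS; apply/mltS; left.
Qed.

Lemma mlt_irr x : ~ mlt x x.
Proof.
move=> /mltE[z /esym]; rewrite -maddA -[in X in _ = X](madd0 x) !(maddC x).
by move=> /maddI /msucc_neq0.
Qed.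

Lemma mlt_trans x y z : mlt x y -> mlt y z -> mlt x z.
Proof.
move=> /mltE[a ->] /mltE[b ->]; apply/mltE; exists (a +' i +' b).
by rewrite -!maddA.
Qed.

Lemma mzeroP x : x = o \/ exists y, x = y +' i.
Proof.
have [|n] := pselect (x = o); first by left.
right; suff /mltE[z ->] : mlt o x by exists z; rewrite madd0l.
move: x n; apply: induction0 => [||x IH _]; first by definability.
  by [].
by apply/mltS; have [->|/IH] := pselect (x = o); [right|left].
Qed.

Lemma mlt_total x y : [\/ mlt x y, x = y | mlt y x].
Proof.
suff : mlt x y \/ x = y \/ mlt y x by move=> [|[]]; constructor.
move: y; apply: induction0 => [||y IH]; first by definability.
  case: (mzeroP x) => [->|[z ->]]; first by right; left.
  by right; right; apply/mltE; exists z; rewrite madd0l.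
case: IH => [lt|[->|/mltE[z ->]]]; first by left; apply/mltS; left.
  by left; apply/mltS; right.
case: (mzeroP z) => [->|[w ->]]; first by right; left; rewrite madd0.
by right; right; apply/mltE; exists w; rewrite maddS !maddSl.
Qed.

End BasicAxioms.

Definition num (M : rca_model) : Type := dom M.
HB.instance Definition _ (M : rca_model) := gen_eqMixin (num M).
HB.instance Definition _ (M : rca_model) := gen_choiceMixin (num M).
HB.instance Definition _ (M : rca_model) :=
  @GRing.isNmodule.Build (num M) (mzero M) (@madd M)
    (@maddA M) (@maddC M) (@madd0l M).

Section SemiRing.
Variable M : rca_model.
Lemma num_mulDl : left_distributive (@mmul M) (@madd M).
Proof. by move=> x y z; rewrite mmulC mmulDr !(mmulC z). Qed.

Lemma num_one_neq0 : (mone M : num M) != mzero M.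
Proof. by apply/eqP => E; apply: (@msucc_neq0 M (mzero M)); rewrite madd0l. Qed.
End SemiRing.

HB.instance Definition _ (M : rca_model) :=
  @GRing.Nmodule_isComNzSemiRing.Build (num M) (mone M) (@mmul M)
    (@mmulA M) (@mmulC M) (@mmul1 M) (@num_mulDl M) (@mmul0l M)
    (num_one_neq0 M).

Local Open Scope ring_scope.

(** * The ordered field of fractions *)

(* [(p, n, d)] names [(p - n) / (d + 1)], as in the type [rat]. *)
Section Fractions.
Variable M : rca_model.
Notation D := (num M).
Implicit Types (x y z : D).

Lemma num_addI z x y : x + z = y + z -> x = y.
Proof. exact: maddI. Qed.

Lemma num_ltE x y : mlt x y <-> exists z : D, y = x + z + 1.
Proof. exact: mltE. Qed.

Lemma num_succ_neq0 x : x + 1 <> 0.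
Proof. exact: msucc_neq0. Qed.

Lemma num_zeroP x : x = 0 \/ exists y : D, x = y + 1.
Proof. exact: mzeroP. Qed.

Lemma num_mulI z x y : x * (z + 1) = y * (z + 1) -> x = y.
Proof.
wlog : x y / mlt x y.
  by move=> wl E; case: (mlt_total x y) => // [/wl|/wl h]; [exact|rewrite h].
move=> /num_ltE[w ->] E; case: (@num_succ_neq0 (w * (z + 1) + z)).
by apply: (@num_addI (x * (z + 1))); rewrite add0r [RHS]E; ring.
Qed.

Definition frac : Type := (D * D * D)%type.

Definition fr_eq (a b : frac) : Prop :=
  let: (p, n, d) := a in let: (p', n', d') := b in
  p * (d' + 1) + n' * (d + 1) = p' * (d + 1) + n * (d' + 1).

Definition fr_add (a b : frac) : frac :=
  let: (p, n, d) := a in let: (p', n', d') := b in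
  (p * (d' + 1) + p' * (d + 1), n * (d' + 1) + n' * (d + 1), d * d' + d + d').

Definition fr_opp (a : frac) : frac := let: (p, n, d) := a in (n, p, d).

Definition fr_mul (a b : frac) : frac :=
  let: (p, n, d) := a in let: (p', n', d') := b in
  (p * p' + n * n', p * n' + n * p', d * d' + d + d').

Definition fr_le (a b : frac) : Prop :=
  let: (p, n, d) := a in let: (p', n', d') := b in
  exists z, p' * (d + 1) + n * (d' + 1) = p * (d' + 1) + n' * (d + 1) + z.

Lemma fr_eq_refl a : fr_eq a a.
Proof. by case: a => -[p n] d. Qed.

Lemma fr_eq_sym a b : fr_eq a b -> fr_eq b a.
Proof. by case: a b => [[p n] d] [[p' n'] d'] /= ->. Qed.

Lemma fr_eq_trans a b c : fr_eq a b -> fr_eq b c -> fr_eq a c.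
Proof.
case: a b c => [[p n] d] [[p' n'] d'] [[p2 n2] d2] /= E1 E2.
apply: (@num_mulI d').
apply: (@num_addI (n' * (d + 1) * (d2 + 1) + p' * (d + 1) * (d2 + 1))).
transitivity ((p * (d' + 1) + n' * (d + 1)) * (d2 + 1)
  + (p' * (d2 + 1) + n2 * (d' + 1)) * (d + 1)); first by ring.
by rewrite E1 E2; ring.
Qed.

Lemma fr_add_compat a a' b : fr_eq a a' -> fr_eq (fr_add a b) (fr_add a' b).
Proof.
case: a a' b => [[p n] d] [[p' n'] d'] [[p2 n2] d2] /= E.
transitivity ((p * (d' + 1) + n' * (d + 1)) * (d2 + 1) * (d2 + 1)
  + (p2 + n2) * (d + 1) * (d' + 1) * (d2 + 1)); first by ring.
by rewrite E; ring.
Qed.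

Lemma fr_mul_compat a a' b : fr_eq a a' -> fr_eq (fr_mul a b) (fr_mul a' b).
Proof.
case: a a' b => [[p n] d] [[p' n'] d'] [[p2 n2] d2] /= E.
transitivity ((p * (d' + 1) + n' * (d + 1)) * p2 * (d2 + 1)
  + (p' * (d + 1) + n * (d' + 1)) * n2 * (d2 + 1)); first by ring.
by rewrite E -[in X in _ + X]E; ring.
Qed.

Lemma fr_opp_compat a a' : fr_eq a a' -> fr_eq (fr_opp a) (fr_opp a').
Proof.
by case: a a' => [[p n] d] [[p' n'] d'] /= E; rewrite addrC -E addrC.
Qed.

Lemma fr_le_compat a a' b : fr_eq a a' -> fr_le a b -> fr_le a' b.
Proof.
case: a a' b => [[p n] d] [[p' n'] d'] [[p2 n2] d2] /= E [z zE].
have h : (p2 * (d' + 1) + n' * (d2 + 1)) * (d + 1)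
  = (p' * (d2 + 1) + n2 * (d' + 1)) * (d + 1) + z * (d' + 1).
  apply: (@num_addI (n * (d2 + 1) * (d' + 1) + p * (d' + 1) * (d2 + 1))).
  transitivity ((p2 * (d + 1) + n * (d2 + 1)) * (d' + 1)
    + (p * (d' + 1) + n' * (d + 1)) * (d2 + 1)); first by ring.
  by rewrite E zE; ring.
(* The difference in [h] is known only after multiplication by [d + 1]. Instead of dividing it, the
   opposite strict inequality is refuted and totality supplies a difference. *)
have [lt|le] := pselect (mlt (p2 * (d' + 1) + n' * (d2 + 1) : D)
  (p' * (d2 + 1) + n2 * (d' + 1) : D)).
  case/num_ltE: lt => w wE; move: h; rewrite wE => h.
  exfalso; apply: (@num_succ_neq0 (z * (d' + 1) + w * (d + 1) + d)).
  apply: (@num_addI ((p2 * (d' + 1) + n' * (d2 + 1)) * (d + 1))).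
  by rewrite add0r [RHS]h; ring.
case: (mlt_total (p2 * (d' + 1) + n' * (d2 + 1) : D)
  (p' * (d2 + 1) + n2 * (d' + 1) : D)) => [/le //|->|]; first by exists 0; rewrite addr0.
by move=> /num_ltE[w ->]; exists (w + 1); rewrite addrA.
Qed.

Lemma fr_le_opp a b : fr_le a b -> fr_le (fr_opp b) (fr_opp a).
Proof.
case: a b => [[p n] d] [[p' n'] d'] /= [z zE]; exists z.
by rewrite addrC zE; congr (_ + _); rewrite addrC.
Qed.

Lemma fr_le_compatr a b b' : fr_eq b b' -> fr_le a b -> fr_le a b'.
Proof.
move=> /fr_opp_compat E /fr_le_opp /(fr_le_compat E) /fr_le_opp.
by case: a b' {E} => [[p n] d] [[p' n'] d'].
Qed.

Definition field_of : Type := {P : frac -> Prop | exists a, P = fr_eq a}.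

Definition fcl (a : frac) : field_of := exist _ (fr_eq a) (ex_intro _ a erefl).

Definition frepr (x : field_of) : frac := sval (cid (svalP x)).

Lemma fclP a b : fcl a = fcl b <-> fr_eq a b.
Proof.
split=> [[E]|ab]; first by have := fr_eq_refl b; rewrite -E.
apply: eq_exist; apply: funext => c; apply: propext.
by split; apply: fr_eq_trans => //; apply: fr_eq_sym.
Qed.

Lemma freprK (x : field_of) : fcl (frepr x) = x.
Proof.
rewrite /frepr; case: cid => t; case: x => P hP /= E.
by apply: eq_exist; rewrite E.
Qed.

Lemma frepr_fcl a : fr_eq (frepr (fcl a)) a.
Proof. by apply/fclP; rewrite freprK. Qed.

Lemma fcl_surj (x : field_of) : exists a, x = fcl a.
Proof. by exists (frepr x); rewrite freprK. Qed.

Definition F_add (x y : field_of) := fcl (fr_add (frepr x) (frepr y)).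
Definition F_opp (x : field_of) := fcl (fr_opp (frepr x)).
Definition F_mul (x y : field_of) := fcl (fr_mul (frepr x) (frepr y)).
Definition F_le (x y : field_of) := fr_le (frepr x) (frepr y).

Lemma fr_addC a b : fr_add a b = fr_add b a.
Proof.
by case: a b => [[p n] d] [[p' n'] d'] /=; congr (_, _, _); ring.
Qed.

Lemma fr_mulC a b : fr_mul a b = fr_mul b a.
Proof.
by case: a b => [[p n] d] [[p' n'] d'] /=; congr (_, _, _); ring.
Qed.

Lemma F_addE a b : F_add (fcl a) (fcl b) = fcl (fr_add a b).
Proof.
apply/fclP; apply: fr_eq_trans (fr_add_compat _ (frepr_fcl a)) _.
by rewrite !(fr_addC a); apply: fr_add_compat; apply: frepr_fcl.
Qed.

Lemma F_mulE a b : F_mul (fcl a) (fcl b) = fcl (fr_mul a b).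
Proof.
apply/fclP; apply: fr_eq_trans (fr_mul_compat _ (frepr_fcl a)) _.
by rewrite !(fr_mulC a); apply: fr_mul_compat; apply: frepr_fcl.
Qed.

Lemma F_oppE a : F_opp (fcl a) = fcl (fr_opp a).
Proof. by apply/fclP; apply: fr_opp_compat; apply: frepr_fcl. Qed.

Lemma F_leE a b : F_le (fcl a) (fcl b) <-> fr_le a b.
Proof.
split=> h.
  exact: fr_le_compat (frepr_fcl a) (fr_le_compatr (frepr_fcl b) h).
apply: fr_le_compat (fr_eq_sym (frepr_fcl a)) _.
exact: fr_le_compatr (fr_eq_sym (frepr_fcl b)) h.
Qed.

Definition F_zero := fcl (0, 0, 0).
Definition F_one := fcl (1, 0, 0).

Lemma F_addA : associative F_add.
Proof.
move=> x y z; have [[[? ?] ?] ->] := fcl_surj x.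
have [[[? ?] ?] ->] := fcl_surj y; have [[[? ?] ?] ->] := fcl_surj z.
by rewrite !F_addE /=; apply/fclP => /=; ring.
Qed.

Lemma F_addC : commutative F_add.
Proof.
move=> x y; have [a ->] := fcl_surj x; have [b ->] := fcl_surj y.
by rewrite !F_addE fr_addC.
Qed.

Lemma F_add0 : left_id F_zero F_add.
Proof.
move=> x; have [[[? ?] ?] ->] := fcl_surj x.
by rewrite !F_addE /=; apply/fclP => /=; ring.
Qed.

Lemma F_addN : left_inverse F_zero F_opp F_add.
Proof.
move=> x; have [[[? ?] ?] ->] := fcl_surj x.
by rewrite F_oppE !F_addE /=; apply/fclP => /=; ring.
Qed.

Lemma F_mulA : associative F_mul.
Proof.
move=> x y z; have [[[? ?] ?] ->] := fcl_surj x.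
have [[[? ?] ?] ->] := fcl_surj y; have [[[? ?] ?] ->] := fcl_surj z.
by rewrite !F_mulE /=; apply/fclP => /=; ring.
Qed.

Lemma F_mulC : commutative F_mul.
Proof.
move=> x y; have [a ->] := fcl_surj x; have [b ->] := fcl_surj y.
by rewrite !F_mulE fr_mulC.
Qed.

Lemma F_mul1 : left_id F_one F_mul.
Proof.
move=> x; have [[[? ?] ?] ->] := fcl_surj x.
by rewrite !F_mulE /=; apply/fclP => /=; ring.
Qed.

Lemma F_mulDl : left_distributive F_mul F_add.
Proof.
move=> x y z; have [[[? ?] ?] ->] := fcl_surj x.
have [[[? ?] ?] ->] := fcl_surj y; have [[[? ?] ?] ->] := fcl_surj z.
by rewrite !(F_mulE, F_addE) /=; apply/fclP => /=; ring.
Qed.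

Lemma F_one_neq0 : F_one <> F_zero.
Proof.
move=> /fclP /=; rewrite !mul0r !mul1r !addr0 add0r => /eqP.
by rewrite (negbTE (oner_neq0 _)).
Qed.

Lemma F_mulV (x : field_of) : x <> F_zero -> exists y : field_of, F_mul y x = F_one.
Proof.
have [[[p n] d] ->] := fcl_surj x => nz.
case: (mlt_total p n) => [/num_ltE[z ->]|E|/num_ltE[z ->]].
- exists (fcl (0, d + 1, z)); rewrite F_mulE; apply/fclP => /=; ring.
- by case: nz; apply/fclP; rewrite /= E; ring.
exists (fcl (d + 1, 0, z)); rewrite F_mulE; apply/fclP => /=; ring.
Qed.

Definition F_inv (x : field_of) : field_of :=
  if pselect (exists y : field_of, F_mul y x = F_one) is left h then sval (cid h) else F_zero.

Lemma F_invP (x : field_of) : x <> F_zero -> F_mul (F_inv x) x = F_one.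
Proof.
move=> /F_mulV h; rewrite /F_inv; case: pselect => // h'; by case: cid.
Qed.

Lemma F_mul0 (x : field_of) : F_mul x F_zero = F_zero.
Proof.
have [[[p n] d] ->] := fcl_surj x.
by rewrite F_mulE; apply/fclP => /=; ring.
Qed.

Lemma F_inv0 : F_inv F_zero = F_zero.
Proof.
rewrite /F_inv; case: pselect => // h; exfalso; case: h => y.
by rewrite F_mul0 => /esym /F_one_neq0.
Qed.

Lemma F_le0_add (x y : field_of) : F_le F_zero x -> F_le F_zero y -> F_le F_zero (F_add x y).
Proof.
have [[[p n] d] ->] := fcl_surj x; have [[[p' n'] d'] ->] := fcl_surj y.
rewrite F_addE !F_leE /= => -[z zE] [z' zE'].
rewrite !(mul0r, addr0, mulr1, add0r) in zE zE'.
by exists (z * (d' + 1) + z' * (d + 1)); rewrite zE zE'; ring.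
Qed.

Lemma F_le0_mul (x y : field_of) : F_le F_zero x -> F_le F_zero y -> F_le F_zero (F_mul x y).
Proof.
have [[[p n] d] ->] := fcl_surj x; have [[[p' n'] d'] ->] := fcl_surj y.
rewrite F_mulE !F_leE /= => -[z zE] [z' zE'].
rewrite !(mul0r, addr0, mulr1, add0r) in zE zE'.
by exists (z * z'); rewrite zE zE'; ring.
Qed.

Lemma F_le0_anti (x : field_of) : F_le F_zero x -> F_le x F_zero -> x = F_zero.
Proof.
have [[[p n] d] ->] := fcl_surj x.
rewrite !F_leE /= => -[z zE] [z' zE']; apply/fclP => /=.
rewrite !(mul0r, addr0, mulr1, add0r, add0r) in zE zE' *.
case: (num_zeroP z') => [E|[w E]]; first by rewrite zE' E addr0.
case: (@num_succ_neq0 (z + w)); apply: (@num_addI n); rewrite add0r.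
by rewrite [RHS]zE' zE E; ring.
Qed.

Lemma F_sub_ge0 (x y : field_of) : F_le F_zero (F_add y (F_opp x)) <-> F_le x y.
Proof.
have [[[p n] d] ->] := fcl_surj x; have [[[p' n'] d'] ->] := fcl_surj y.
rewrite F_oppE F_addE !F_leE /=; split=> -[z zE]; exists z.
  transitivity ((p' * (d + 1) + n * (d' + 1)) * (0 + 1) + 0 * (d' * d + d' + d + 1)).
    by ring.
  by rewrite zE; ring.
transitivity (p' * (d + 1) + n * (d' + 1)); first by ring.
by rewrite zE; ring.
Qed.

Lemma F_le0_total (x : field_of) : F_le F_zero x \/ F_le x F_zero.
Proof.
have [[[p n] d] ->] := fcl_surj x; rewrite !F_leE /=.
case: (mlt_total p n) => [/num_ltE[z ->]|->|/num_ltE[z ->]].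
- by right; exists (z + 1); ring.
- by left; exists 0; ring.
by left; exists (z + 1); ring.
Qed.

End Fractions.

HB.instance Definition _ (M : rca_model) := gen_eqMixin (field_of M).
HB.instance Definition _ (M : rca_model) := gen_choiceMixin (field_of M).
HB.instance Definition _ (M : rca_model) :=
  @GRing.isZmodule.Build (field_of M) (F_zero M) (@F_opp M) (@F_add M)
    (@F_addA M) (@F_addC M) (@F_add0 M) (@F_addN M).
HB.instance Definition _ (M : rca_model) :=
  @GRing.Zmodule_isComNzRing.Build (field_of M) (F_one M) (@F_mul M)
    (@F_mulA M) (@F_mulC M) (@F_mul1 M) (@F_mulDl M)
    (introN eqP (@F_one_neq0 M)).

Section FieldAxioms.
Variable M : rca_model.
Implicit Types x y : field_of M.

Lemma field_of_mulVf x : x != 0 -> F_inv x * x = 1.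
Proof. by move=> /eqP; apply: F_invP. Qed.

Definition field_of_le x y : bool := `[< F_le x y >].
Definition field_of_lt x y : bool := (y != x) && field_of_le x y.
Definition field_of_norm x : field_of M := if field_of_le 0 x then x else - x.

Lemma field_of_le0_add x y :
  field_of_le 0 x -> field_of_le 0 y -> field_of_le 0 (x + y).
Proof. by move=> /asboolP hx /asboolP hy; apply/asboolP; apply: F_le0_add. Qed.

Lemma field_of_le0_mul x y :
  field_of_le 0 x -> field_of_le 0 y -> field_of_le 0 (x * y).
Proof. by move=> /asboolP hx /asboolP hy; apply/asboolP; apply: F_le0_mul. Qed.

Lemma field_of_le0_anti x : field_of_le 0 x -> field_of_le x 0 -> x = 0.
Proof. by move=> /asboolP hx /asboolP hy; apply: F_le0_anti. Qed.

Lemma field_of_sub_ge0 x y : field_of_le 0 (y - x) = field_of_le x y.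
Proof. by apply/asboolP/asboolP => /F_sub_ge0. Qed.

Lemma field_of_le0_total x : field_of_le 0 x || field_of_le x 0.
Proof.
by case: (F_le0_total x) => h; apply/orP; [left|right]; apply/asboolP.
Qed.

Lemma field_of_normN x : field_of_norm (- x) = field_of_norm x.
Proof.
rewrite /field_of_norm -[field_of_le 0 (- x)]field_of_sub_ge0 subr0.
rewrite -[- x]sub0r field_of_sub_ge0 opprB subr0 sub0r.
case: ifP => h1; case: ifP => h2 //.
  by rewrite (field_of_le0_anti h2 h1) oppr0.
by have := field_of_le0_total x; rewrite h1 h2.
Qed.

Lemma field_of_ge0_norm x : field_of_le 0 x -> field_of_norm x = x.
Proof. by rewrite /field_of_norm => ->. Qed.

End FieldAxioms.

HB.instance Definition _ (M : rca_model) :=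
  @GRing.ComNzRing_isField.Build (field_of M) (@F_inv M)
    (@field_of_mulVf M) (F_inv0 M).
HB.instance Definition _ (M : rca_model) :=
  @Num.IntegralDomain_isLeReal.Build (field_of M) (@field_of_le M)
    (@field_of_lt M) (@field_of_norm M) (@field_of_le0_add M)
    (@field_of_le0_mul M) (@field_of_le0_anti M) (@field_of_sub_ge0 M)
    (@field_of_le0_total M) (@field_of_normN M) (@field_of_ge0_norm M)
    (fun _ _ => erefl).

(** * Numbers inside their field of fractions *)

Section Embedding.
Variable M : rca_model.
Notation D := (num M).
Notation F := (field_of M).
Implicit Types (x y z : D) (a b : F).

(** Inequalities between numbers are transported to the ordered field, where the arithmetic tactics
    apply. *)
Definition toF x : F := fcl (x, 0, 0).

Lemma toFD x y : toF (x + y) = toF x + toF y.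
Proof. by rewrite [RHS]F_addE; apply/fclP => /=; ring. Qed.

Lemma toFM x y : toF (x * y) = toF x * toF y.
Proof. by rewrite [RHS]F_mulE; apply/fclP => /=; ring. Qed.

Lemma toF0 : toF 0 = 0.
Proof. by []. Qed.

Lemma toF1 : toF 1 = 1.
Proof. by []. Qed.

Definition toFE := (toFD, toFM, toF0, toF1).

Lemma toF_inj : injective toF.
Proof.
by move=> x y /fclP /=; rewrite !(mul0r, addr0, add0r, mulr1).
Qed.

Lemma field_leE a b : (a <= b) <-> F_le a b.
Proof. by split=> /asboolP. Qed.

Lemma toF_ge0 x : 0 <= toF x.
Proof.
apply/field_leE/F_leE => /=; exists x.
by rewrite !(mul0r, addr0, add0r, mulr1).
Qed.

Lemma toF_lt x y : mlt x y <-> toF x < toF y.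
Proof.
have lt1 u w : mlt u w -> toF u < toF w.
  move=> /num_ltE[z ->]; rewrite !toFE; have := toF_ge0 z; lra.
split=> [/lt1//|h]; case: (mlt_total x y) => // [E|/lt1].
  by move: h; rewrite E ltxx.
by move=> /(lt_trans h); rewrite ltxx.
Qed.

Lemma toF_ltS x y : toF x < toF y -> toF x + 1 <= toF y.
Proof.
by move=> /toF_lt /num_ltE[z ->]; rewrite !toFE; have := toF_ge0 z; lra.
Qed.

Lemma toF_sub x y : toF x <= toF y -> exists z, y = x + z.
Proof.
rewrite le_eqVlt => /orP[/eqP/toF_inj->|/toF_lt/num_ltE[z ->]].
  by exists 0; rewrite addr0.
by exists (z + 1); rewrite addrA.
Qed.

Definition fval (q : D * D * D) : F :=
  (toF q.1.1 - toF q.1.2) / (toF q.2 + 1).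

Lemma toF_succ_gt0 x : 0 < toF x + 1.
Proof. by have := toF_ge0 x; lra. Qed.

Lemma fvalE q : fval q = fcl q.
Proof.
case: q => -[p n] d; rewrite /fval /=.
have nz : toF d + 1 != 0 by rewrite gt_eqF ?toF_succ_gt0.
apply: (mulIf nz); rewrite mulfVK //.
have -> : - toF n = fcl (0, n, 0) by exact: F_oppE.
by rewrite -toF1 -toFD [LHS]F_addE [X in _ = X]F_mulE; apply/fclP => /=; ring.
Qed.

Lemma fval_surj a : exists q, fval q = a.
Proof. by have [q ->] := fcl_surj a; exists q; rewrite fvalE. Qed.

(** The bound [p + 1] is a number of the model and may be nonstandard; the field need not be
    Archimedean over the standard integers. *)
Lemma toF_arch a : exists x, a < toF x.
Proof.
have [[[p n] d] <-] := fval_surj a; exists (p + 1); rewrite /fval /= !toFE.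
rewrite ltr_pdivrMr ?toF_succ_gt0 //.
have := toF_ge0 p; have := toF_ge0 n; have := toF_ge0 d; nra.
Qed.

End Embedding.

(** * Closure properties of Sigma_1 relations, collection and pairing *)

Section NumDefinability.
Variable M : rca_model.
Notation D := (num M).
Notation env := (nat -> D).
Implicit Types (k : nat) (v : env).

Lemma num_def_add k (s t : env -> D) :
  definable_tm k s -> definable_tm k t -> definable_tm k (fun v => s v + t v).
Proof. exact: def_add. Qed.

Lemma num_def_mul k (s t : env -> D) :
  definable_tm k s -> definable_tm k t -> definable_tm k (fun v => s v * t v).
Proof. exact: def_mul. Qed.

Lemma def0_ren k k' (r : nat -> nat) (Q : env -> Prop) :
  (forall n, (n < k)%N -> (r n < k')%N) -> definable0 k Q ->
  definable0 k' (fun v => Q (fun n => v (r n))).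
Proof.
by move=> hr; apply: def0_subst => n /hr; apply: def_var.
Qed.

Lemma def0_app2 k (Q : D -> D -> Prop) (s t : env -> D) :
  definable0 2 (fun v => Q (v 0%N) (v 1%N)) ->
  definable_tm k s -> definable_tm k t ->
  definable0 k (fun v => Q (s v) (t v)).
Proof.
move=> dQ ds dt.
by apply: (def0_subst (s := s .: (fun=> t))) dQ => -[].
Qed.

Lemma def0_app4 k (Q : D -> D -> D -> D -> Prop) (s t u w : env -> D) :
  definable0 4 (fun v => Q (v 0%N) (v 1%N) (v 2%N) (v 3%N)) ->
  definable_tm k s -> definable_tm k t -> definable_tm k u -> definable_tm k w ->
  definable0 k (fun v => Q (s v) (t v) (u v) (w v)).
Proof.
move=> dQ ds dt du dw.
by apply: (def0_subst (s := s .: (t .: (u .: (fun=> w))))) dQ => -[|[|[]]].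
Qed.

Lemma mlt_common (x y : D) : exists z : D, mlt x z /\ mlt y z.
Proof.
exists (x + y + 1); split; apply/toF_lt; rewrite !toFE;
  have := toF_ge0 x; have := toF_ge0 y; lra.
Qed.

(** Two unbounded quantifiers contract to one: it ranges over common bounds for both witnesses,
    which become bounded. *)
Lemma definable1_ex1 k (P : D -> env -> Prop) :
  definable1 k.+1 (fun v => P (v 0%N) (tl v)) ->
  definable1 k (fun v => exists y, P y v).
Proof.
move=> [Q dQ QE].
pose R (u : env) := exists2 a, mlt a (u 0%N) & exists2 b, mlt b (u 0%N) &
  Q (b .: (a .: tl u)).
exists R.
  apply: (def0_bex (P := fun a u => exists2 b, mlt b (u 0%N) &
    Q (b .: (a .: tl u)))); first exact: def_var.
  apply: (def0_bex (P := fun b u => Q (b .: (u 0%N .: tl (tl u)))));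
    first by rewrite /tl /=; apply: def_var.
  pose r n := match n with 0 => 0%N | 1 => 1%N | S (S n) => n.+3 end.
  have := def0_ren (k' := k.+3) (r := r) _ dQ.
  have hr n : (n < k.+2)%N -> (r n < k.+3)%N by case: n => [|[|n]].
  move=> /(_ hr); apply: def0_ext => u.
  by suff -> : (fun n => u (r n)) = u 0%N .: (tl u 0%N .: tl (tl (tl u)));
    [|apply: funext => -[|[|n]]].
move=> v; split=> [[y]|[z [a _ [b _ Qab]]]]; last first.
  by exists a; apply/(QE (a .: v)); exists b.
move=> /(QE (y .: v))[w Qw]; have [z [yz wz]] := mlt_common y w.
by exists z, y => //; exists w.
Qed.

Lemma def1_and k (P Q : env -> Prop) : definable1 k P -> definable1 k Q ->
  definable1 k (fun v => P v /\ Q v).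
Proof.
move=> [P' dP PE] [Q' dQ QE].
apply: (@def1_ext M _ (fun v => exists z, exists y, P' (y .: v) /\ Q' (z .: v))).
  move=> v; rewrite PE QE; split=> [[z [y []]]|[[y ?] [z ?]]]; last by exists z, y.
  by split; [exists y|exists z].
apply: definable1_ex1; apply: definable1_ex; apply: def0_and.
  pose r n := if n is n'.+1 then n'.+2 else 0%N.
  have hr n : (n < k.+1)%N -> (r n < k.+2)%N by case: n.
  have := def0_ren hr dP; apply: def0_ext => u.
  suff -> : (fun n => u (r n)) = u 0%N .: tl (tl u) by [].
  by apply: funext => -[].
have hr n : (n < k.+1)%N -> (n.+1 < k.+2)%N by [].
by have := def0_ren hr dQ; apply: def0_ext => u; rewrite scons_tl.
Qed.

Lemma def1_or k (P Q : env -> Prop) : definable1 k P -> definable1 k Q ->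
  definable1 k (fun v => P v \/ Q v).
Proof.
move=> [P' dP PE] [Q' dQ QE].
exists (fun v => P' v \/ Q' v); first exact: def0_or.
move=> v; rewrite PE QE; split=> [[[y ?]|[y ?]]|[y [?|?]]]; last 2 first.
- by left; exists y.
- by right; exists y.
- by exists y; left.
by exists y; right.
Qed.

(** Sigma_1 induction on the length [u] of an initial segment, enlarging the bound at each step. The
    guard [mlt y t] lets the induction run past [t], where witnesses may fail to exist. *)
Lemma collection (Q : D -> D -> Prop) (t : D) :
  definable0 2 (fun v => Q (v 0%N) (v 1%N)) ->
  (forall y : D, mlt y t -> exists w : D, Q y w) ->
  exists z : D, forall y : D, mlt y t -> exists2 w : D, mlt w z & Q y w.
Proof.
move=> dQ hQ.
suff h u : exists z, forall y, mlt y u -> mlt y t -> exists2 w, mlt w z & Q y w.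
  by have [z hz] := h t; exists z => y lty; apply: hz.
move: u; apply: induction1 => [||u [z hz]].
- apply: (definable1_ex (P := fun z v => forall y, mlt y (v 0%N) -> mlt y t ->
    exists2 w, mlt w z & Q y w)).
  apply: def0_ball; first exact: def_var.
  apply: def0_imp; first by definability.
  apply: def0_bex; first exact: def_var.
  by apply: def0_app2; first exact: dQ; apply: def_var.
- by exists (mzero M) => y /mlt0.
have [ut|nut] := pselect (mlt u t); last first.
  exists z => y /mltS[/hz //|-> /nut]; by [].
have [w Qw] := hQ u ut; have [z' [zz' wz']] := mlt_common z w.
exists z' => y /mltS[/hz h /h[w' lw Qw']|-> _]; last by exists w.
by exists w' => //; apply: mlt_trans zz'.
Qed.

(** By [collection] the witnesses for all [y] below [t v] have a common bound, which can be
    quantified in front. *)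
Lemma def1_ball k (t : env -> D) (P : D -> env -> Prop) : definable_tm k t ->
  definable1 k.+1 (fun v => P (v 0%N) (tl v)) ->
  definable1 k (fun v => forall y, mlt y (t v) -> P y v).
Proof.
move=> dt [Q dQ QE].
apply: (@def1_ext M _ (fun v => exists z, forall y, mlt y (t v) ->
    exists2 w, mlt w z & Q (w .: (y .: v)))).
  move=> v; split=> [[z hz] y /hz[w _ Qw]|h].
    by apply/(QE (y .: v)); exists w.
  apply: (@collection (fun y w => Q (w .: (y .: v)))).
    pose s n : env -> D := match n with 0 => fun u => u 1%N | 1 => fun u => u 0%N
      | S (S n) => fun=> v n end.
    have := def0_subst (s := s) (k' := 2) _ dQ.
    have hs n : (n < k.+2)%N -> definable_tm 2 (s n).
      by move: n => [|[|n]] _; rewrite /s; [apply: def_var|apply: def_var|apply: def_const].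
    move=> /(_ hs); apply: def0_ext => u.
    by suff -> : (fun n => s n u) = u 1%N .: (u 0%N .: v);
      [|apply: funext => -[|[|n]]].
  by move=> y /h Py; apply/(QE (y .: v)).
apply: (definable1_ex (P := fun z v => forall y, mlt y (t v) ->
    exists2 w, mlt w z & Q (w .: (y .: v)))).
apply: def0_ball; first exact: def_lift.
apply: def0_bex; first by rewrite /tl /=; apply: def_var.
pose r n := match n with 0 => 0%N | 1 => 1%N | S (S n) => n.+3 end.
have hr n : (n < k.+2)%N -> (r n < k.+3)%N by case: n => [|[|n]].
have := def0_ren hr dQ; apply: def0_ext => u.
by suff -> : (fun n => u (r n)) = u 0%N .: (tl u 0%N .: tl (tl (tl u)));
  [|apply: funext => -[|[|n]]].
Qed.

Definition pair (x y : D) : D := (x + y) * (x + y) + x.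

(** [pair x y] lies between the square of [x + y] and the next square, so it determines the sum, and
    then [x]. *)
Lemma pair_inj x y x' y' : pair x y = pair x' y' -> x = x' /\ y = y'.
Proof.
wlog le : x y x' y' / toF (x + y) <= toF (x' + y').
  move=> wl E; case: (lerP (toF (x + y)) (toF (x' + y'))) => [/wl/(_ E)//|/ltW].
  by move=> /wl/(_ (esym E))[-> ->].
move=> E; have := congr1 (@toF M) E; rewrite /pair !toFE => E'.
have x0 := toF_ge0 x; have y0 := toF_ge0 y; have x0' := toF_ge0 x'.
have y0' := toF_ge0 y'.
move: le; rewrite le_eqVlt => /orP[/eqP|/toF_ltS]; rewrite !toFE => h.
  rewrite h in E'; have Ex : toF x = toF x' by lra.
  by split; apply: toF_inj => //; lra.
exfalso; clear E.
have h2 : (toF x + toF y + 1) * (toF x + toF y + 1)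
    <= (toF x' + toF y') * (toF x' + toF y') by apply: ler_pM => //; lra.
lra.
Qed.

(** False for general field elements. It bounds the second component of a pair, which enters only
    through a square. *)
Lemma toF_int (x : D) : toF x <= toF x * toF x.
Proof.
case: (num_zeroP x) => [->|[z ->]]; first by rewrite toF0 mul0r.
by rewrite !toFE; have := toF_ge0 z; nra.
Qed.

Lemma pair_gel x y : toF x <= toF (pair x y).
Proof. by rewrite !toFE; have := toF_ge0 x; have := toF_ge0 y; nra. Qed.

Lemma pair_ger x y : toF y <= toF (pair x y).
Proof.
rewrite !toFE; have := toF_ge0 x; have := toF_ge0 y; have := toF_int y; nra.
Qed.

Lemma mlt_pairl x y z : mlt (pair x y) z -> mlt x z.
Proof. by rewrite !toF_lt; apply: le_lt_trans; apply: pair_gel. Qed.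

Lemma mlt_pairr x y z : mlt (pair x y) z -> mlt y z.
Proof. by rewrite !toF_lt; apply: le_lt_trans; apply: pair_ger. Qed.

Lemma mlt_succ (x : D) : mlt x (x + 1).
Proof. by apply/toF_lt; rewrite !toFE; lra. Qed.

Lemma mlt_pair1l x y : mlt x (pair x y + 1).
Proof. exact: mlt_pairl (mlt_succ _). Qed.

Lemma mlt_pair1r x y : mlt y (pair x y + 1).
Proof. exact: mlt_pairr (mlt_succ _). Qed.

Lemma comprehension0 (P : D -> Prop) : definable0 1 (fun v => P (v 0%N)) ->
  exists X : sets M, forall x, mmem x X <-> P x.
Proof.
move=> dP; apply: delta1_comprehension_model; first exact: def1_def0.
by apply: def1_def0; apply: def0_not.
Qed.

Lemma comprehension0_pair (P : D -> D -> Prop) :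
  definable0 2 (fun v => P (v 0%N) (v 1%N)) ->
  exists X : sets M, forall x y, mmem (pair x y) X <-> P x y.
Proof.
move=> dP; have [] := @comprehension0 (fun z => exists x, mlt x (z + 1) /\
    exists y, mlt y (z + 1) /\ (z = pair x y /\ P x y)).
  apply: def0_exists_lt; first by definability.
  apply: def0_exists_lt; first by definability.
  apply: def0_and; first by rewrite /pair; definability.
  by apply: def0_app2; first exact: dP; apply: def_var.
move=> X hX; exists X => x y; rewrite hX.
split=> [[x' [_ [y' [_ [/pair_inj[-> ->]]]]]] //|Pxy].
by exists x; split; [exact: mlt_pair1l|exists y; split; [exact: mlt_pair1r|]].
Qed.

End NumDefinability.

Ltac num_def_step :=
  lazymatch goal with
  | |- definable_tm _ _ =>
      first [ apply: def_const | apply: def_var; exact: isT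
            | apply: num_def_add | apply: num_def_mul
            | apply: def_add | apply: def_mul ]
  | |- definable0 _ _ =>
      first [ apply: def0_const | assumption
            | apply: def0_mem | apply: def0_eq | apply: def0_lt
            | apply: def0_iff | apply: def0_and | apply: def0_or
            | apply: def0_exists_lt | apply: def0_bex
            | apply: def0_ball | apply: def0_imp ]
  | |- definable1 _ _ =>
      first [ solve [apply: def1_def0; repeat (progress (rewrite /tl /=) || num_def_step)]
            | apply: def1_and | apply: def1_or | apply: def1_ball
            | apply: definable1_ex1 ]
  end.

Ltac num_def := rewrite /pair; repeat (progress (rewrite /tl /=) || num_def_step).

(** * The beta function and primitive recursion *)

Section Beta.
Variable M : rca_model.
Notation D := (num M).
Implicit Types (a b c d e i j k m n p q r s t u v w x y z : D).

Lemma num_induction1 (P : D -> Prop) : definable1 1 (fun v : nat -> D => P (v 0%N)) ->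
  P 0 -> (forall x, P x -> P (x + 1)) -> forall x, P x.
Proof. exact: induction1. Qed.

Lemma num_induction0 (P : D -> Prop) : definable0 1 (fun v : nat -> D => P (v 0%N)) ->
  P 0 -> (forall x, P x -> P (x + 1)) -> forall x, P x.
Proof. exact: induction0. Qed.

Lemma num_ltS x y : mlt x (y + 1) <-> mlt x y \/ x = y.
Proof. exact: mltS. Qed.

Lemma num_lt0 x : ~ mlt x (0 : D).
Proof. exact: mlt0. Qed.

Lemma division a m : exists q r, mlt r (m + 1) /\ a = q * (m + 1) + r.
Proof.
suff [q [_ [r [lr ->]]]] : exists q, mlt q (a + 1) /\
    exists r, mlt r (m + 1) /\ a = q * (m + 1) + r by exists q, r.
move: a; apply: num_induction0 => [||a [q [lq [r [lr E]]]]]; first by num_def.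
  exists 0; split; first by rewrite add0r -[X in mlt _ X]add0r; apply: mlt_succ.
  exists 0; rewrite mul0r addr0; split=> //; apply/toF_lt; rewrite !toFE.
  exact: toF_succ_gt0.
case/num_ltE: lr => z mE; case: (num_zeroP z) => [z0|[w wE]].
  exists (q + 1); split; first by move/toF_lt: lq => lq; apply/toF_lt; rewrite !toFE in lq *; lra.
  exists 0; split; first by apply/toF_lt; rewrite !toFE; apply: toF_succ_gt0.
  by rewrite E addr0 mulrDl mul1r mE z0 addr0 addrA.
exists q; split; first by move/toF_lt: lq => lq; apply/toF_lt; rewrite !toFE in lq *; lra.
exists (r + 1); split; last by rewrite E addrA.
by rewrite mE wE; apply/num_ltE; exists w; ring.
Qed.

Lemma division_unique q r q' r' m : mlt r m -> mlt r' m ->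
  q * m + r = q' * m + r' -> r = r'.
Proof.
wlog le : q r q' r' / toF q <= toF q'.
  move=> wl h h' E; case: (lerP (toF q) (toF q')) => [/wl/(_ h h' E)//|/ltW].
  by move=> /wl/(_ h' h (esym E)).
move=> /toF_lt h /toF_lt h' E; have := congr1 (@toF M) E; rewrite !toFE => E'.
apply: toF_inj; have r0 := toF_ge0 r; have r0' := toF_ge0 r'; have q0 := toF_ge0 q.
move: le; rewrite le_eqVlt => /orP[/eqP qE|/toF_ltS qE]; first by rewrite qE in E'; lra.
have : (toF q + 1) * toF m <= toF q' * toF m by apply: ler_pM => //; lra.
lra.
Qed.

(** Goedel's function: [v] is the remainder of [a] modulo [(i + 1) b + 1]. Bounding the quotient
    keeps the relation Sigma_0. *)
Definition beta a b i v : Prop :=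
  mlt v ((i + 1) * b + 1) /\
  exists q, mlt q (a + 1) /\ a = q * ((i + 1) * b + 1) + v.

Lemma betaI q a b i v : mlt v ((i + 1) * b + 1) ->
  a = q * ((i + 1) * b + 1) + v -> beta a b i v.
Proof.
move=> lv aE; split=> //; exists q; split=> //; apply/toF_lt; rewrite aE !toFE.
have := toF_ge0 q; have := toF_ge0 v.
have : 0 <= toF q * ((toF i + 1) * toF b).
  by rewrite !mulr_ge0 ?toF_ge0 //; apply: ltW; apply: toF_succ_gt0.
lra.
Qed.

Lemma beta_le a b i v : beta a b i v -> mlt v (a + 1).
Proof.
move=> [_ [q [_ ->]]]; apply/toF_lt; rewrite !toFE.
have : 0 <= toF q * ((toF i + 1) * toF b + 1).
  rewrite mulr_ge0 ?toF_ge0 // addr_ge0 // mulr_ge0 ?toF_ge0 //.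
  by apply: ltW; apply: toF_succ_gt0.
lra.
Qed.

Lemma beta_inj a b i v w : beta a b i v -> beta a b i w -> v = w.
Proof.
move=> [lv [q [_ aE]]] [lw [q' [_ aE']]].
by apply: (division_unique (q := q) (q' := q') lv lw); rewrite -aE.
Qed.

(** The witness is [(B + 1) n!]. It is carried through a Sigma_1 induction because no factorial
    function is available yet. *)
Lemma common_multiple n (B : D) :
  exists b, mlt B b /\ forall d, mlt d n -> exists e, b = (d + 1) * e.
Proof.
move: n; apply: num_induction1 => [||n [b [lb hb]]]; first by num_def.
  by exists (B + 1); split; [apply: mlt_succ|move=> d /num_lt0].
exists (b * (n + 1)); split.
  apply/toF_lt; move/toF_lt: lb; rewrite !toFE.
  have := toF_ge0 B; have := toF_ge0 b; have := toF_ge0 n; nra.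
move=> d /num_ltS[/hb[e ->]|->]; last by exists b; rewrite mulrC.
by exists (e * (n + 1)); rewrite mulrA.
Qed.

(* The moduli [m_i = (i + 1) b + 1] are pairwise coprime: if [j - k = d] divides
   [b = d c] then [(j + 1)^2 c m_k = -1] modulo [m_j]. *)
Lemma moduli_coprime b k j d c : j = k + d + 1 -> b = (d + 1) * c -> mlt (0 : D) b ->
  exists s t, s * ((k + 1) * b + 1) = t * ((j + 1) * b + 1) + 1.
Proof.
move=> jE bE b0.
have [h|[t tE]] := num_zeroP ((j + 1) * b * ((j + 1) * c * (k + 1) + 1)).
  exfalso; move/toF_lt: b0; have := congr1 (@toF M) h; rewrite !toFE => {}h b0.
  have : 0 < (toF j + 1) * toF b * ((toF j + 1) * toF c * (toF k + 1) + 1).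
    rewrite !mulr_gt0 ?toF_succ_gt0 //.
    by rewrite ltr_wpDl // !mulr_ge0 ?toF_ge0 // ltW ?toF_succ_gt0.
  by rewrite h ltxx.
exists ((j + 1) * b * ((j + 1) * (j + 1) * c)), t.
apply: (@num_addI _ ((j + 1) * b)).
transitivity ((j + 1) * b * ((j + 1) * c * (k + 1) + 1) * ((j + 1) * b + 1)).
  by rewrite jE bE; ring.
by rewrite tE; ring.
Qed.

Lemma def0_beta (k : nat) (s t u w : (nat -> D) -> D) :
  definable_tm k s -> definable_tm k t -> definable_tm k u -> definable_tm k w ->
  definable0 k (fun v : nat -> D => beta (s v) (t v) (u v) (w v)).
Proof. by apply: def0_app4; rewrite /beta; num_def. Qed.

(** Chinese remainder theorem. The number [b] is a multiple of all differences of indices below [n],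
    which makes the moduli coprime, and it exceeds a bound for the chosen values, so that these are
    remainders. *)
Lemma beta_code (P : D -> D -> Prop) n :
  definable0 2 (fun v : nat -> D => P (v 0%N) (v 1%N)) ->
  (forall i, mlt i n -> exists v, P i v) ->
  exists a b, forall i, mlt i n -> exists v, P i v /\ beta a b i v.
Proof.
move=> dP hP; have [B hB] := collection dP hP.
have [b [lb hb]] := common_multiple n B.
have b0 : mlt (0 : D) b.
  by apply/toF_lt; move/toF_lt: lb; apply: le_lt_trans; apply: toF_ge0.
pose m i : D := (i + 1) * b + 1.
(* After [k] indices, [a] codes their values and [p] is a common multiple of their moduli that is
   invertible modulo the remaining ones. Disjunctions replace implications because Sigma_1 relations
   are closed under them. *)
suff h k : exists a p, [/\
    forall i, mlt i k -> ~ mlt i n \/ exists v, P i v /\ beta a b i v,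
    forall i, mlt i k -> ~ mlt i n \/ exists q, p = q * m i &
    forall j, mlt j n -> mlt j k \/ exists u w, u * p = w * m j + 1].
  have [a [p [h1 _ _]]] := h n; exists a, b => i lin.
  by case: (h1 i lin).
suff : exists a p,
    (forall i, mlt i k -> ~ mlt i n \/ exists v, P i v /\ beta a b i v) /\
    (forall i, mlt i k -> ~ mlt i n \/ exists q, p = q * m i) /\
    (forall j, mlt j n -> mlt j k \/ exists u w, u * p = w * m j + 1).
  by move=> [a [p [? [? ?]]]]; exists a, p.
move: k; apply: num_induction1 => [||k [a [p [h1 [h2 h3]]]]].
- rewrite /m; repeat (progress (rewrite /tl /=) || num_def_step).
  by apply: def1_def0; apply: def0_app2; first exact: dP; num_def.
- exists 0, 1; split; first by move=> i /num_lt0.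
  split; first by move=> i /num_lt0.
  by move=> j _; right; exists 1, 0; rewrite mul0r add0r mulr1.
have [lkn|nkn] := pselect (mlt k n); last first.
  exists a, p; split.
    by move=> i /num_ltS[/h1 //|->]; left.
  split; first by move=> i /num_ltS[/h2 //|->]; left.
  by move=> j lj; case: (h3 j lj) => [ljk|]; [left; apply/num_ltS; left|right].
have [lkk|[u [w uwE]]] := h3 k lkn; first by case: (mlt_irr lkk).
have [v lv Pv] := hB k lkn.
have lvm i : mlt v (m i).
  apply/toF_lt; move/toF_lt: lv; move/toF_lt: lb; rewrite !toFE.
  have := toF_ge0 i; have := toF_ge0 b; nra.
(* Modulo [m k] the number [u] inverts [p] and [(k + 1) * b] is [-1], so [p * x] is [v - a];
   subtraction is avoided. Modulo the earlier [m i] the number [p] vanishes. *)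
pose x := u * (v + a * ((k + 1) * b)).
exists (a + p * x), (p * m k); split.
  move=> i /num_ltS[lik|->]; last first.
    right; exists v; split=> //.
    apply: (@betaI (a + w * (v + a * ((k + 1) * b))) _ _ _ _ (lvm k)).
    transitivity (a + (u * p) * (v + a * ((k + 1) * b))).
      by rewrite /x; ring.
    by rewrite uwE /m; ring.
  case: (h1 i lik) => [|[y [Py [ly [q [_ aE]]]]]]; first by left.
  case: (h2 i lik) => [|[q' pE]]; first by left.
  right; exists y; split=> //; apply: (@betaI (q + q' * x)) => //.
  by rewrite pE {1}aE /m; ring.
split.
  move=> i /num_ltS[lik|->]; last by right; exists p.
  case: (h2 i lik) => [|[q' ->]]; first by left.
  by right; exists (q' * m k); ring.
move=> j ljn; case: (mlt_total j k) => [ljk|->|/num_ltE[d jE]].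
- by left; apply/num_ltS; left.
- by left; apply/num_ltS; right.
right.
have ldn : mlt d n.
  move/toF_lt: ljn => ljn; apply/toF_lt; move: ljn; rewrite jE !toFE.
  by have := toF_ge0 k; lra.
have [c bE] := hb d ldn.
have [s [t stE]] := moduli_coprime jE bE b0.
case: (h3 j ljn) => [ljk|[u' [w' E']]].
  exfalso; move/toF_lt: ljk; rewrite jE !toFE.
  by have := toF_ge0 d; lra.
exists (u' * s), (w' * t * m j + w' + t).
transitivity ((u' * p) * (s * m k)); first by ring.
by rewrite E' stE /m; ring.
Qed.

Section PrimitiveRecursion.
Variables (c0 : D) (H : D -> D -> D -> D -> Prop).
Hypothesis dH : definable0 4 (fun v : nat -> D => H (v 0%N) (v 1%N) (v 2%N) (v 3%N)).
Hypothesis H_total : forall s i x, exists y, H s i x y.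
Hypothesis H_fun : forall s i x y y', H s i x y -> H s i x y' -> y = y'.

(** [beta] with [a] and [b] codes a run that starts at [c0], follows the step relation [H] with
    parameter [s], and has [v] as its entry at [n]. Entries are remainders of [a], so [a + 1] bounds
    them and the relation is Sigma_0. *)
Definition computation a b s n v : Prop :=
  beta a b 0 c0 /\
  (forall i, mlt i n -> exists x, mlt x (a + 1) /\ exists y, mlt y (a + 1) /\
    (beta a b i x /\ (beta a b (i + 1) y /\ H s i x y))) /\
  beta a b n v.

Lemma computation_fun a b a' b' s n v v' :
  computation a b s n v -> computation a' b' s n v' -> v = v'.
Proof.
move=> [h0 [hS hv]] [h0' [hS' hv']].
suff h i : mlt i (n + 1) -> forall x, mlt x (a + 1) -> forall x', mlt x' (a' + 1) ->
    beta a b i x -> beta a' b' i x' -> x = x'.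
  exact: h (mlt_succ n) _ (beta_le hv) _ (beta_le hv') hv hv'.
move: i; apply: num_induction0 => [||i IH].
- apply: def0_imp; first by num_def.
  apply: def0_ball; first by num_def.
  apply: def0_ball; first by num_def.
  apply: def0_imp; first by apply: def0_beta; num_def.
  apply: def0_imp; first by apply: def0_beta; num_def.
  by num_def.
- move=> _ x _ x' _ hx hx'.
  by rewrite (beta_inj hx h0) (beta_inj hx' h0').
move=> lin x _ x' _ hx hx'.
have {}lin : mlt i n by move/toF_lt: lin; rewrite !toFE ltrD2r => /toF_lt.
have [y [ly [z [lz [hy [hz Hz]]]]]] := hS i lin.
have [y' [ly' [z' [lz' [hy' [hz' Hz']]]]]] := hS' i lin.
rewrite (beta_inj hx hz) (beta_inj hx' hz').
have yE : y = y' by apply: IH => //; apply/num_ltS; left.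
by rewrite -yE in Hz'; apply: H_fun Hz Hz'.
Qed.

Definition computes s n v := exists a b, computation a b s n v.

Lemma def1_computes (k : nat) (r t u : (nat -> D) -> D) :
  definable_tm k r -> definable_tm k t -> definable_tm k u ->
  definable1 k (fun v : nat -> D => computes (r v) (t v) (u v)).
Proof.
move=> dr dt du.
have d5 : definable0 5 (fun v : nat -> D =>
    computation (v 0%N) (v 1%N) (v 2%N) (v 3%N) (v 4%N)).
  apply: def0_and; first by apply: def0_beta; num_def.
  apply: def0_and; last by apply: def0_beta; num_def.
  apply: def0_ball; first by num_def.
  apply: def0_exists_lt; first by num_def.
  apply: def0_exists_lt; first by num_def.
  apply: def0_and; first by apply: def0_beta; num_def.
  apply: def0_and; first by apply: def0_beta; num_def.
  by apply: def0_app4; first exact: dH; num_def.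
apply: definable1_ex1; apply: definable1_ex.
have lift2 (f : (nat -> D) -> D) : definable_tm k f ->
    definable_tm k.+2 (fun v : nat -> D => f (tl (tl v))).
  by move=> df; apply: (def_lift (def_lift df)).
pose s : nat -> (nat -> D) -> D := fun l : nat => match l with
  | 0%N => fun v : nat -> D => v 1%N | 1%N => fun v : nat -> D => v 0%N
  | 2%N => fun v : nat -> D => r (tl (tl v)) | 3%N => fun v : nat -> D => t (tl (tl v))
  | _ => fun v : nat -> D => u (tl (tl v)) end.
have := def0_subst (s := s) (k' := k.+2) _ d5; apply.
by case=> [|[|[|[|l]]]] _; rewrite /s;
  [apply: def_var|apply: def_var|apply: lift2..].
Qed.

Lemma computes_total s n : exists v, computes s n v.
Proof.
move: n; apply: num_induction1 => [||n [v [a [b [h0 [hS hv]]]]]].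
- by apply: definable1_ex1; apply: def1_computes; num_def.
- exists c0, c0, c0; split; last split; last 1 first.
  + apply: (@betaI 0); last by rewrite mul0r add0r.
    by rewrite add0r mul1r; apply: mlt_succ.
  + apply: (@betaI 0); last by rewrite mul0r add0r.
    by rewrite add0r mul1r; apply: mlt_succ.
  by move=> i /num_lt0.
have [v' Hv'] := H_total s n v.
(* A code cannot be extended in place: the old entries are copied into a fresh code together with
   the new one. *)
pose P i y := (mlt i (n + 1) /\ beta a b i y) \/ (i = n + 1 /\ y = v').
have [||a' [b' hc]] := @beta_code P (n + 1 + 1).
- apply: def0_or; last by num_def.
  by apply: def0_and; [num_def|apply: def0_beta; num_def].
- move=> i /num_ltS[lin|->]; last by exists v'; right.
  have [q [y [ly E]]] := division a ((i + 1) * b).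
  by exists y; left; split=> //; apply: betaI E.
have nlt : ~ mlt (n + 1) (n + 1 : D) by apply: mlt_irr.
have old i y : mlt i (n + 1) -> beta a b i y -> beta a' b' i y.
  move=> lin hy; have [|z [[[_ hz]|[iE _]] hz']] := hc i.
  - by apply/num_ltS; left.
  - by rewrite (beta_inj hy hz).
  by rewrite iE in lin.
have new : beta a' b' (n + 1) v'.
  have [|z [[[/nlt //]|[_ ->]] //]] := hc (n + 1); exact: mlt_succ.
have lnS i : mlt i n -> mlt i (n + 1) by move=> lin; apply/num_ltS; left.
exists v', a', b'; split; last split=> //.
  apply: old h0; apply/toF_lt; rewrite !toFE; exact: toF_succ_gt0.
move=> i /num_ltS[lin|->].
  have [x [lx [y [ly [hx [hy Hxy]]]]]] := hS i lin.
  have hx' := old _ _ (lnS _ lin) hx.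
  have hy' : beta a' b' (i + 1) y.
    by apply: old hy; move/toF_lt: lin => lin; apply/toF_lt; rewrite !toFE ltrD2r.
  exists x; split; first exact: beta_le hx'.
  by exists y; split; first exact: beta_le hy'.
have hv'' := old _ _ (mlt_succ n) hv.
exists v; split; first exact: beta_le hv''.
by exists v'; split; first exact: beta_le new.
Qed.

Lemma primitive_recursion : exists (g : D -> D -> D) (G : sets M),
  [/\ forall s n v, mmem (pair s (pair n v)) G <-> v = g s n,
    forall s, g s 0 = c0 & forall s n, H s n (g s n) (g s (n + 1))].
Proof.
have /choice[g' gE] sn := computes_total sn.1 sn.2.
pose g s n := g' (s, n).
have {}gE s n : computes s n (g s n) by apply: (gE (s, n)).
have gU s n v : computes s n v -> v = g s n.
  by move=> [a [b h]]; have [a' [b' h']] := gE s n; apply: computation_fun h h'.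
have [||G hG] := @delta1_comprehension_model M
    (fun z => exists s n v, z = pair s (pair n v) /\ computes s n v).
- do 3 apply: definable1_ex1; apply: def1_and; first by num_def.
  by apply: def1_computes; num_def.
(* The complement of the graph is Sigma_1 because the function is total: either the number is not a
   triple, or some computation yields another value. *)
- apply: (@def1_ext M 1 (fun u : nat -> D => (forall s, mlt s (u 0%N + 1 : D) ->
      forall n, mlt n (u 0%N + 1 : D) -> forall v, mlt v (u 0%N + 1 : D) ->
        ~ (u 0%N = pair s (pair n v))) \/
      exists s n v w, u 0%N = pair s (pair n v) /\ (~ (v = w) /\ computes s n w))).
    move=> u; set z := u 0%N; split.
      move=> [h|[s [n [v [w [zE [ne /gU wE]]]]]]] [s' [n' [v' [zE' /gU vE']]]].
        apply: (h s' _ n' _ v' _ zE'); rewrite zE'; first exact: mlt_pair1l.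
          by apply: mlt_pairl (mlt_pair1r _ _).
        by apply: mlt_pairr (mlt_pair1r _ _).
      apply: ne; move: zE'; rewrite zE => /pair_inj[ss /pair_inj[nn vv]].
      by rewrite wE vv vE' ss nn.
    move=> h; have [|nh] := pselect (exists s n v, z = pair s (pair n v)).
      move=> [s [n [v zE]]]; right; exists s, n, v, (g s n); split=> //; split=> //.
      by move=> vE; apply: h; exists s, n, v; split=> //; rewrite vE; apply: gE.
    by left=> s _ n _ v _ zE; apply: nh; exists s, n, v.
  apply: def1_or; first by num_def.
  do 4 apply: definable1_ex1; apply: def1_and; first by num_def.
  by apply: def1_and; [num_def|apply: def1_computes; num_def].
exists g, G; split=> [s n v|s|s n].
- rewrite hG; split=> [[s' [n' [v' [/pair_inj[-> /pair_inj[-> ->]] /gU]]]] //|->].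
  by exists s, n, (g s n).
- have [a [b [h0 [_ hv]]]] := gE s 0; exact: beta_inj hv h0.
have [a [b [h0 [hS hv]]]] := gE s (n + 1).
have [x [lx [y [ly [hx [hy Hxy]]]]]] := hS n (mlt_succ n).
(* A computation up to [n + 1] is also one up to [n], so its entry [x] is the value [g s n]. *)
rewrite (beta_inj hv hy); suff <- : x = g s n by [].
apply: gU; exists a, b; split=> //; split=> // i lin.
by apply: hS; apply/num_ltS; left.
Qed.

End PrimitiveRecursion.
End Beta.

(** * Powers of two and strong collection *)

Section Powers.
Variable M : rca_model.
Notation D := (num M).
Notation env := (nat -> D).

(** Eliminates a function that is not a term of the language: its value is quantified and tied to
    the argument by membership in the graph. This admits [pow] to induction statements. *)
Lemma def1_graph (g : D -> D) (G : sets M) k (t : env -> D) (Q : D -> env -> Prop) :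
  (forall x y, mmem (pair x y) G <-> y = g x) -> definable_tm k t ->
  definable1 k.+1 (fun v : env => Q (v 0%N) (tl v)) ->
  definable1 k (fun v : env => Q (g (t v)) v).
Proof.
move=> hG dt dQ.
apply: (@def1_ext M _ (fun v : env => exists y, mmem (pair (t v) y) G /\ Q y v)).
  by move=> v; split=> [[y [/hG ->]] //|Qv]; exists (g (t v)); rewrite hG.
apply: definable1_ex1; apply: def1_and => //.
apply: def1_def0; apply: def0_mem.
by have dt' := def_lift dt; rewrite /pair; num_def.
Qed.

Lemma pow_exists : exists pE : (D -> D) * sets M,
  [/\ forall n y, mmem (pair n y) pE.2 <-> y = pE.1 n, pE.1 0 = 1 &
    forall n, pE.1 (n + 1) = pE.1 n + pE.1 n].
Proof.
have [|||g [G [hG g0 gS]]] := @primitive_recursion M 1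
  (fun _ _ x y => y = x + x).
- by num_def.
- by move=> _ _ x; exists (x + x).
- by move=> _ _ x y y' -> ->.
have [|E hE] := @comprehension0_pair M (fun n y => mmem (pair 0 (pair n y)) G).
  by num_def.
exists (g 0, E); split=> [n y||n] /=; first by rewrite hE hG.
  exact: g0.
exact: gS.
Qed.

Definition pow : D -> D := (sval (cid pow_exists)).1.
Definition pow_graph : sets M := (sval (cid pow_exists)).2.

Lemma pow_graphP n y : mmem (pair n y) pow_graph <-> y = pow n.
Proof. by rewrite /pow_graph /pow; case: cid => x []. Qed.

Lemma pow0 : pow 0 = 1.
Proof. by rewrite /pow; case: cid => x []. Qed.

Lemma powS n : pow (n + 1) = pow n + pow n.
Proof. by rewrite /pow; case: cid => x []. Qed.

Lemma pow_gt n : toF n + 1 <= toF (pow n).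
Proof.
move: n; apply: num_induction1 => [||n IH].
(* The inequality in the field is restated as a negated order relation between numbers of the model,
   to which the definability lemmas apply. *)
- apply: (@def1_ext M _ (fun v : env => ~ mlt (pow (v 0%N)) (v 0%N + 1))).
    move=> v; rewrite toF_lt !toFE; split; first by move/negP; rewrite -leNgt.
    by rewrite leNgt => /negP.
  apply: (def1_graph (Q := fun (y : D) (v : env) => ~ mlt y (v 0%N + 1)) pow_graphP);
  by num_def.
- by rewrite pow0 toF0 toF1 add0r.
by rewrite powS !toFE; have := toF_ge0 n; lra.
Qed.

Lemma pow_ge1 n : 1 <= toF (pow n).
Proof. by have := pow_gt n; have := toF_ge0 n; lra. Qed.

Lemma pow_gt0 n : 0 < toF (pow n).
Proof. by have := pow_ge1 n; lra. Qed.

Lemma powD m n : pow (m + n) = pow m * pow n.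
Proof.
move: n; apply: num_induction1 => [||n IH].
- apply: (def1_graph (t := fun v : env => m + v 0%N)
    (Q := fun (y : D) (v : env) => y = pow m * pow (v 0%N)) pow_graphP); first by num_def.
  apply: (def1_graph (t := fun v : env => v 1%N)
    (Q := fun (z : D) (v : env) => v 0%N = pow m * z) pow_graphP); by num_def.
- by rewrite pow0 addr0 mulr1.
by rewrite addrA !powS IH; ring.
Qed.

Definition half_pow n : field_of M := (toF (pow n))^-1.

Lemma half_pow_gt0 n : 0 < half_pow n.
Proof. by rewrite invr_gt0 pow_gt0. Qed.

Lemma half_powS n : half_pow (n + 1) + half_pow (n + 1) = half_pow n.
Proof.
rewrite /half_pow powS toFD; have := pow_gt0 n => p0; field.
by rewrite !gt_eqF ?addr_gt0.
Qed.

Lemma half_powD m n : half_pow (m + n) <= half_pow m.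
Proof.
rewrite /half_pow powD toFM invfM ler_piMr ?invr_ge0 ?toF_ge0 //.
by rewrite invf_le1 ?pow_gt0 // pow_ge1.
Qed.

Lemma half_pow_le m n : toF m <= toF n -> half_pow n <= half_pow m.
Proof. by move=> /toF_sub[z ->]; apply: half_powD. Qed.

Lemma half_pow_small (e : field_of M) : 0 < e -> exists n, half_pow n < e.
Proof.
move=> e0; have [n hn] := toF_arch e^-1; exists n.
rewrite /half_pow -[e]invrK ltf_pV2 ?posrE ?pow_gt0 ?invr_gt0 //.
by have := pow_gt n; lra.
Qed.

End Powers.

Arguments pow {M}.
Arguments half_pow {M}.

(** * Digits of the stages, strong Sigma_1 collection and the increasing sequence of partial sums *)

Section Counting.
Variable M : rca_model.
Notation D := (num M).
Notation env := (nat -> D).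
Variable th : D -> D -> Prop.
Hypothesis dth : definable0 2 (fun v : env => th (v 0%N) (v 1%N)).

Definition before (s n : D) : Prop := exists t, mlt t s /\ th n t.

Lemma before_mono s s' n : toF s <= toF s' -> before s n -> before s' n.
Proof.
move=> le [t [/toF_lt lt tht]]; exists t; split=> //; apply/toF_lt.
exact: lt_le_trans le.
Qed.

Lemma def0_before k (s t : env -> D) : definable_tm k s -> definable_tm k t ->
  definable0 k (fun v : env => before (s v) (t v)).
Proof.
apply: def0_app2; apply: def0_exists_lt; first by num_def.
by apply: def0_app2; first exact: dth; num_def.
Qed.

Lemma digits_exist : exists uU : (D -> D -> D) * sets M,
  [/\ forall s n y, mmem (pair s (pair n y)) uU.2 <-> y = uU.1 s n,
    forall s, uU.1 s 0 = 0,
    forall s n, before s n -> uU.1 s (n + 1) = uU.1 s n + uU.1 s n + 1 &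
    forall s n, ~ before s n -> uU.1 s (n + 1) = uU.1 s n + uU.1 s n].
Proof.
have [|||g [G [hG g0 gS]]] := @primitive_recursion M 0 (fun s n x y =>
    (before s n -> y = x + x + 1) /\ (~ before s n -> y = x + x)).
- apply: def0_and; apply: def0_imp; try apply: def0_not;
    try (by apply: def0_before; num_def); by num_def.
- move=> s n x; have [b|b] := pselect (before s n).
    by exists (x + x + 1).
  by exists (x + x).
- move=> s n x y y' [h1 h2] [h1' h2']; have [b|b] := pselect (before s n).
    by rewrite h1 ?h1'.
  by rewrite h2 ?h2'.
by exists (g, G); split=> // s n b; have [h1 h2] := gS s n; [apply: h1|apply: h2].
Qed.

(* [digits s n] is the binary number whose [n] digits, most significant first,
   tell whether [th i t] for some [t < s], for [i = 0, ..., n - 1]. *)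
Definition digits : D -> D -> D := (sval (cid digits_exist)).1.
Definition digits_graph : sets M := (sval (cid digits_exist)).2.

Lemma digits_graphP s n y : mmem (pair s (pair n y)) digits_graph <-> y = digits s n.
Proof. by rewrite /digits_graph /digits; case: cid => x []. Qed.

Lemma digits0 s : digits s 0 = 0.
Proof. by rewrite /digits; case: cid => x []. Qed.

Lemma digitsS1 s n : before s n -> digits s (n + 1) = digits s n + digits s n + 1.
Proof. by rewrite /digits; case: cid => x [? ? h ?]; apply: h. Qed.

Lemma digitsS0 s n : ~ before s n -> digits s (n + 1) = digits s n + digits s n.
Proof. by rewrite /digits; case: cid => x [? ? ? h]; apply: h. Qed.

Lemma def1_digits k (s t : env -> D) (Q : D -> env -> Prop) :
  definable_tm k s -> definable_tm k t ->
  definable1 k.+1 (fun v : env => Q (v 0%N) (tl v)) ->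
  definable1 k (fun v : env => Q (digits (s v) (t v)) v).
Proof.
move=> ds dt dQ.
apply: (@def1_ext M _ (fun v : env =>
    exists y, mmem (pair (s v) (pair (t v) y)) digits_graph /\ Q y v)).
  move=> v; split=> [[y [/digits_graphP ->]] //|Qv].
  by exists (digits (s v) (t v)); rewrite digits_graphP.
apply: definable1_ex1; apply: def1_and => //.
apply: def1_def0; apply: def0_mem.
by have ds' := def_lift ds; have dt' := def_lift dt; rewrite /pair; num_def.
Qed.

Lemma not_mltP (x y : D) : ~ mlt x y <-> toF y <= toF x.
Proof.
by rewrite toF_lt leNgt; split=> [/negP|/negP].
Qed.

Lemma digits_lt s n : toF (digits s n) + 1 <= toF (pow n).
Proof.
move: n; apply: num_induction1 => [||n IH].
- apply: (@def1_ext M _ (fun v : env => ~ mlt (pow (v 0%N)) (digits s (v 0%N) + 1))).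
    by move=> v; rewrite not_mltP !toFE.
  apply: (def1_graph (t := fun v : env => v 0%N)
    (Q := fun (y : D) (v : env) => ~ mlt y (digits s (v 0%N) + 1)) (@pow_graphP M)).
    by num_def.
  apply: (def1_digits (s := fun=> s) (t := fun v : env => v 1%N)
    (Q := fun (y : D) (v : env) => ~ mlt (v 0%N) (y + 1))); by num_def.
- by rewrite digits0 pow0 toF0 toF1 add0r.
by rewrite powS; have [b|b] := pselect (before s n);
  [rewrite (digitsS1 b)|rewrite (digitsS0 b)]; rewrite !toFE; lra.
Qed.

Lemma digits_mono s s' n : toF s <= toF s' -> toF (digits s n) <= toF (digits s' n).
Proof.
move=> le; move: n; apply: num_induction1 => [||n IH].
- apply: (@def1_ext M _ (fun v : env => ~ mlt (digits s' (v 0%N)) (digits s (v 0%N)))).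
    by move=> v; rewrite not_mltP.
  apply: (def1_digits (s := fun=> s') (t := fun v : env => v 0%N)
    (Q := fun (y : D) (v : env) => ~ mlt y (digits s (v 0%N)))); try by num_def.
  apply: (def1_digits (s := fun=> s) (t := fun v : env => v 1%N)
    (Q := fun (y : D) (v : env) => ~ mlt (v 0%N) y)); by num_def.
- by rewrite !digits0.
have [b|b] := pselect (before s n).
  by rewrite (digitsS1 b) (digitsS1 (before_mono le b)) !toFE; lra.
rewrite (digitsS0 b); have [b'|b'] := pselect (before s' n).
  by rewrite (digitsS1 b') !toFE; lra.
by rewrite (digitsS0 b') !toFE; lra.
Qed.

(** A new index [i] raises the number by at least [2^(n - i - 1)]: the digits before [i] are
    compared by [digits_mono], and each later step doubles the difference without lowering it. The
    factor [pow (i + 1)] clears the denominator. *)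
Lemma digits_jump s s' (i n : D) : toF s <= toF s' -> mlt i n ->
  ~ before s i -> before s' i ->
  toF (digits s n) * toF (pow (i + 1)) + toF (pow n)
    <= toF (digits s' n) * toF (pow (i + 1)).
Proof.
move=> le /num_ltE[z ->] b b'; rewrite -addrA [z + 1]addrC addrA; set j := i + 1.
move: z; apply: num_induction1 => [||z IH].
- apply: (@def1_ext M _ (fun v : env => ~ mlt (digits s' (j + v 0%N) * pow j)
      (digits s (j + v 0%N) * pow j + pow (j + v 0%N)))).
    by move=> v; rewrite not_mltP !toFE.
  apply: (def1_digits (s := fun=> s') (t := fun v : env => j + v 0%N)
    (Q := fun (y : D) (v : env) => ~ mlt (y * pow j)
      (digits s (j + v 0%N) * pow j + pow (j + v 0%N)))); try by num_def.
  apply: (def1_digits (s := fun=> s) (t := fun v : env => j + v 1%N)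
    (Q := fun (y : D) (v : env) => ~ mlt (v 0%N * pow j)
      (y * pow j + pow (j + v 1%N)))); try by num_def.
  apply: (def1_graph (t := fun v : env => j + v 2%N)
    (Q := fun (y : D) (v : env) => ~ mlt (v 1%N * pow j)
      (v 0%N * pow j + y)) (@pow_graphP M)); by num_def.
- rewrite addr0 /j (digitsS0 b) (digitsS1 b') !toFE.
  have h := digits_mono i le; have p0 := pow_gt0 (i + 1).
  have : (toF (digits s i) + toF (digits s i) + 1) * toF (pow (i + 1))
      <= (toF (digits s' i) + toF (digits s' i) + 1) * toF (pow (i + 1)).
    by rewrite ler_pM2r //; lra.
  by lra.
rewrite addrA (powS (j + z)).
have p0 := pow_gt0 j.
have [c|c] := pselect (before s (j + z)).
  by rewrite (digitsS1 c) (digitsS1 (before_mono le c)) !toFE; lra.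
rewrite (digitsS0 c); have [c'|c'] := pselect (before s' (j + z)).
  by rewrite (digitsS1 c') !toFE; lra.
by rewrite (digitsS0 c') !toFE; lra.
Qed.

(* [T] is a stage at which [digits T k] is maximal. *)
Lemma strong_collection (k : D) : exists T : D, forall i : D, mlt i k ->
  (exists t, th i t) -> before T i.
Proof.
apply: contrapT => nT.
have step T : exists T', toF T <= toF T' /\
    toF (digits T k) + 1 <= toF (digits T' k).
  apply: contrapT => nT'; apply: nT; exists T => i lik [t tht].
  apply: contrapT => nb; apply: nT'; exists (T + t + 1).
  have le : toF T <= toF (T + t + 1).
    by rewrite !toFE; have := toF_ge0 t; lra.
  split=> //.
  have b' : before (T + t + 1) i.
    exists t; split=> //; apply/toF_lt; rewrite !toFE.
    by have := toF_ge0 T; lra.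
  have := digits_jump le lik nb b'; have := pow_gt0 k; have := pow_gt0 (i + 1).
  move=> p0 p1 h; apply: toF_ltS; rewrite -(ltr_pM2r p0); lra.
(* If no stage were final, Sigma_1 induction on [v] would find stages whose [digits] reach any [v],
   even the bound [pow k] of all of them. *)
suff [s] : exists s, ~ mlt (digits s k) (pow k).
  by rewrite not_mltP; have := digits_lt s k; lra.
suff h v : exists s, ~ mlt (digits s k) v by apply: h.
move: v; apply: num_induction1 => [||v [s /not_mltP hs]].
- apply: definable1_ex1.
  by apply: (def1_digits (s := fun v : env => v 0%N) (t := fun=> k)
    (Q := fun (y : D) (v : env) => ~ mlt y (v 1%N))); num_def.
- by exists 0 => /num_lt0.
have [T' [_ h]] := step s; exists T'; apply/not_mltP; rewrite !toFE; lra.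
Qed.

Definition prefix (s n : D) : field_of M := toF (digits s n) / toF (pow n).

Lemma prefix_mono s n n' : toF n <= toF n' -> prefix s n <= prefix s n'.
Proof.
move=> /toF_sub[z ->]; rewrite /prefix.
rewrite ler_pdivrMr ?pow_gt0 // mulrAC ler_pdivlMr ?pow_gt0 // -!toFM.
move: z; apply: num_induction1 => [||z IH].
- apply: (@def1_ext M _ (fun v : env => ~ mlt (digits s (n + v 0%N) * pow n)
      (digits s n * pow (n + v 0%N)))).
    by move=> v; rewrite not_mltP.
  apply: (def1_digits (s := fun=> s) (t := fun v : env => n + v 0%N)
    (Q := fun (y : D) (v : env) => ~ mlt (y * pow n) (digits s n * pow (n + v 0%N))));
    try by num_def.
  apply: (def1_graph (t := fun v : env => n + v 1%N)
    (Q := fun (y : D) (v : env) => ~ mlt (v 0%N * pow n) (digits s n * y)) (@pow_graphP M));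
    by num_def.
- by rewrite addr0.
rewrite addrA powS; have p0 := pow_gt0 n.
by have [b|b] := pselect (before s (n + z));
  [rewrite (digitsS1 b)|rewrite (digitsS0 b)]; rewrite !toFE in IH *; lra.
Qed.

(* [specker s] is the sum of [2^-(i+1)] over the [i < s] with [th i t] for
   some [t < s]. *)
Definition specker (s : D) : field_of M := prefix s s.

Lemma prefix_mono_stage s s' n : toF s <= toF s' -> prefix s n <= prefix s' n.
Proof.
by move=> /(digits_mono n) le; rewrite /prefix ler_pM2r // invr_gt0 pow_gt0.
Qed.

Lemma specker_mono s s' : toF s <= toF s' -> specker s <= specker s'.
Proof.
move=> le; apply: le_trans (prefix_mono_stage s le) _.
exact: prefix_mono.
Qed.

Lemma specker_ge0 s : 0 <= specker s.
Proof. by rewrite divr_ge0 ?toF_ge0. Qed.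

Lemma specker_lt1 s : specker s < 1.
Proof.
by rewrite ltr_pdivrMr ?pow_gt0 // mul1r; have := digits_lt s s; lra.
Qed.

(** Once the sum is closer than [2^-(i+1)] to its limit, no new [i] can appear; this is how the
    limit decides membership. *)
Lemma specker_jump s s' (i : D) : toF s <= toF s' -> mlt i s ->
  ~ before s i -> before s' i -> specker s + half_pow (i + 1) <= specker s'.
Proof.
move=> le lis b b'; apply: (@le_trans _ _ (prefix s' s)); last exact: prefix_mono.
have h := digits_jump le lis b b'.
rewrite /specker /prefix /half_pow; have p0 := pow_gt0 s; have p1 := pow_gt0 (i + 1).
set x := toF _ in h *; set y := toF (digits s' s) in h *.
have n0 : toF (pow s) != 0 by rewrite gt_eqF.
have n1 : toF (pow (i + 1)) != 0 by rewrite gt_eqF.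
have -> : x / toF (pow s) + (toF (pow (i + 1)))^-1
    = (x * toF (pow (i + 1)) + toF (pow s)) / (toF (pow s) * toF (pow (i + 1))).
  by field; rewrite n0 n1.
have -> : y / toF (pow s)
    = (y * toF (pow (i + 1))) / (toF (pow s) * toF (pow (i + 1))).
  by field; rewrite n0 n1.
by rewrite ler_pM2r // invr_gt0 mulr_gt0.
Qed.

(** Otherwise every stage is followed by one that is larger by [e]. With [d] above [1 / e], making
    [d] such jumps would pass the bound 1. *)
Lemma specker_cauchy (e : field_of M) : 0 < e ->
  exists N, forall n, toF N <= toF n -> specker n <= specker N + e.
Proof.
move=> e0; apply: contrapT => nN.
have step N : exists n, specker N + e < specker n.
  apply: contrapT => h; apply: nN; exists N => n _; rewrite leNgt.
  by apply/negP => lt; apply: h; exists n.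
have [d hd] := toF_arch e^-1.
have de : 1 <= toF d * e.
  by rewrite -ler_pdivrMr // mul1r ltW.
suff [s] : exists s, toF d <= specker s * toF d.
  rewrite ler_pMl; first by have := specker_lt1 s; lra.
  by apply: lt_trans hd; rewrite invr_gt0.
(* This says [specker s >= k / d] with denominators cleared, so that induction on the number [k] of
   jumps is Sigma_1. *)
suff h k : exists s, ~ mlt (digits s s * d) (k * pow s).
  have [s /not_mltP hs] := h d; exists s; move: hs; rewrite !toFE => hs.
  by rewrite /specker /prefix mulrAC ler_pdivlMr ?pow_gt0.
move: k; apply: num_induction1 => [||k [s /not_mltP hs]].
- apply: definable1_ex1.
  apply: (def1_digits (s := fun v : env => v 0%N) (t := fun v : env => v 0%N)
    (Q := fun (y : D) (v : env) => ~ mlt (y * d) (v 1%N * pow (v 0%N)))); try by num_def.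
  apply: (def1_graph (t := fun v : env => v 1%N)
    (Q := fun (y : D) (v : env) => ~ mlt (v 0%N * d) (v 2%N * y)) (@pow_graphP M)); by num_def.
- by exists 0; rewrite mul0r => /num_lt0.
have [s' h] := step s; exists s'; apply/not_mltP; move: hs; rewrite !toFE => hs.
have {}hs : toF k <= specker s * toF d.
  by rewrite /specker /prefix mulrAC ler_pdivlMr ?pow_gt0.
rewrite -ler_pdivlMr ?pow_gt0 // mulrAC -/(prefix s' s') -/(specker s').
have d0 := toF_ge0 d; nra.
Qed.

End Counting.

Local Close Scope ring_scope.

(** * The meaning of Cousin's lemma in a model *)

(* The definitions of this module unfold to the satisfaction relation of their
   namesakes up to conversion, hence the negative connectives. *)
Module Sem.
Section Sem.
Variable M : rca_model.
Notation D := (num M).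
Notation set := (sets M).
Notation rat := (num M * num M * num M)%type.

Definition ex_ (A : Type) (P : A -> Prop) : Prop := ~ forall x, ~ P x.
Definition and_ (P Q : Prop) : Prop := ~ (P -> ~ Q).
Definition or_ (P Q : Prop) : Prop := ~ P -> Q.
Definition iff_ (P Q : Prop) : Prop := and_ (P -> Q) (Q -> P).
Definition allQ (P : rat -> Prop) : Prop := forall a b c, P (a, b, c).
Definition exQ (P : rat -> Prop) : Prop :=
  ex_ (fun a => ex_ (fun b => ex_ (fun c => P (a, b, c)))).

Local Notation "0" := (mzero M).
Local Notation "1" := (mone M).
Local Notation "x + y" := (madd x y).
Local Notation "x * y" := (mmul x y).
Local Notation "x < y" := (mlt x y).
Local Notation "x <= y" := (or_ (mlt x y) (x = y)).
Local Infix "&" := and_ (at level 80, right associativity).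

Definition Pair (i j : D) : D := (i + j) * (i + j) + i.

Definition Pow2 (k e : D) : Prop :=
  ex_ (fun E : set =>
    (forall z, iff_ (mmem (Pair 0 z) E) (z = 1)) &
    (forall n y, mmem (Pair n y) E ->
       forall z, iff_ (mmem (Pair (n + 1) z) E) (z = (1 + 1) * y)) &
    mmem (Pair k e) E).

Definition rpos (q : rat) : D := q.1.1.
Definition rneg (q : rat) : D := q.1.2.
Definition rden (q : rat) : D := q.2.
Definition QCode (q : rat) : D := Pair (Pair (rpos q) (rneg q)) (rden q).
Definition Q0 : rat := (0, 0, 0).
Definition Q1 : rat := (1, 0, 0).

Definition QAdd (x y : rat) : rat :=
  (rpos x * (rden y + 1) + rpos y * (rden x + 1),
   rneg x * (rden y + 1) + rneg y * (rden x + 1),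
   rden x * rden y + rden x + rden y).
Definition QOpp (x : rat) : rat := (rneg x, rpos x, rden x).
Definition QSub (x y : rat) : rat := QAdd x (QOpp y).

Definition QLt (x y : rat) : Prop :=
  rpos x * (rden y + 1) + rneg y * (rden x + 1)
  < rpos y * (rden x + 1) + rneg x * (rden y + 1).
Definition QLe (x y : rat) : Prop :=
  rpos x * (rden y + 1) + rneg y * (rden x + 1)
  <= rpos y * (rden x + 1) + rneg x * (rden y + 1).

Definition QDistLe (x y e : rat) : Prop := QLe (QSub x y) e & QLe (QSub y x) e.

Definition real : Type := D -> rat -> Prop.

Definition RealOf (X : set) : real := fun k q => mmem (Pair k (QCode q)) X.
Definition RealAt (X : set) (i : D) : real :=
  fun k q => mmem (Pair i (Pair k (QCode q))) X.

Definition IsReal (x : real) : Prop :=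
  (forall k, exQ (fun q => x k q & allQ (fun q' => x k q' -> QCode q' = QCode q))) &
  (forall k i c, allQ (fun q => allQ (fun q' =>
     Pow2 k (c + 1) -> x k q -> x (k + i) q' -> QDistLe q q' (1, 0, c)))).

Definition RLe (x y : real) : Prop :=
  forall k c, allQ (fun q => allQ (fun q' =>
    Pow2 k (c + 1) -> x k q -> y k q' -> QLe q (QAdd q' (1 + 1, 0, c)))).
Definition RLt (x y : real) : Prop := ~ RLe y x.
Definition REq (x y : real) : Prop := RLe x y & RLe y x.

Definition ROfQ (q : rat) : real := fun _ q' => QCode q' = QCode q.
Definition RAdd (x y : real) : real :=
  fun k q => exQ (fun a => exQ (fun b =>
    x (k + 1) a & y (k + 1) b & QCode q = QCode (QAdd a b))).
Definition ROpp (x : real) : real :=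
  fun k q => exQ (fun a => x k a & QCode q = QCode (QOpp a)).
Definition RSub (x y : real) : real := RAdd x (ROpp y).

Definition RDistLt (x y e : real) : Prop := RLt (RSub x y) e & RLt (RSub y x) e.
Definition RDistLe (x y e : real) : Prop := RLe (RSub x y) e & RLe (RSub y x) e.

Definition UnitPoint (x : real) : Prop :=
  IsReal x & RLe (ROfQ Q0) x & RLe x (ROfQ Q1).

Definition cts : Type := rat -> rat -> rat -> rat -> Prop.

Definition UnitRat (a : rat) : Prop := QLe Q0 a & QLe a Q1.

Definition BallLt (a r a' r' : rat) : Prop :=
  QLt (QAdd (QSub a a') r) r' & QLt (QAdd (QSub a' a) r) r'.

Definition IsCts (F : cts) : Prop :=
  allQ (fun a => allQ (fun r => allQ (fun b => allQ (fun s =>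
    F a r b s -> UnitRat a & QLt Q0 r & QLt Q0 s)))) &
  allQ (fun a => allQ (fun r => allQ (fun b => allQ (fun s =>
    allQ (fun b' => allQ (fun s' =>
    F a r b s -> F a r b' s' -> QDistLe b b' (QAdd s s'))))))) &
  allQ (fun a => allQ (fun r => allQ (fun b => allQ (fun s =>
    allQ (fun a' => allQ (fun r' =>
    F a r b s -> UnitRat a' -> QLt Q0 r' -> BallLt a' r' a r ->
    F a' r' b s)))))) &
  allQ (fun a => allQ (fun r => allQ (fun b => allQ (fun s =>
    allQ (fun b' => allQ (fun s' =>
    F a r b s -> BallLt b s b' s' -> F a r b' s')))))).

Definition InDom (F : cts) (x : real) : Prop :=
  allQ (fun e => QLt Q0 e ->
    exQ (fun a => exQ (fun r => exQ (fun b => exQ (fun s =>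
      F a r b s & RDistLt x (ROfQ a) (ROfQ r) & QLt s e))))).

Definition Value (F : cts) (x y : real) : Prop :=
  allQ (fun a => allQ (fun r => allQ (fun b => allQ (fun s =>
    F a r b s -> RDistLt x (ROfQ a) (ROfQ r) ->
    RDistLe y (ROfQ b) (ROfQ s))))).

Definition CtsAt (C : set) (n : D) : cts := fun a r b s =>
  ex_ (fun m => mmem (Pair n (Pair m
    (Pair (QCode a) (Pair (QCode r) (Pair (QCode b) (QCode s)))))) C).

Definition BaireOne (C : set) : Prop :=
  (forall n, IsCts (CtsAt C n)) &
  (forall X, UnitPoint (RealOf X) ->
     (forall n, InDom (CtsAt C n) (RealOf X)) &
     allQ (fun e => QLt Q0 e -> ex_ (fun N => forall m n, N <= m -> N <= n ->
        forall V W, IsReal (RealOf V) -> IsReal (RealOf W) ->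
          Value (CtsAt C m) (RealOf X) (RealOf V) ->
          Value (CtsAt C n) (RealOf X) (RealOf W) ->
          RDistLt (RealOf V) (RealOf W) (ROfQ e)))).

Definition LimInBall (C : set) (x : real) (y r : rat) : Prop :=
  exQ (fun s => QLt s r & ex_ (fun N => forall n, N <= n ->
    ex_ (fun V => IsReal (RealOf V) & Value (CtsAt C n) x (RealOf V) &
      RDistLt (RealOf V) (ROfQ y) (ROfQ s)))).

Definition LimGt (C : set) (x : real) (e : rat) : Prop :=
  exQ (fun y => exQ (fun r => QLe e (QSub y r) & LimInBall C x y r)).

Definition LeLim (r : real) (C : set) (x : real) : Prop :=
  allQ (fun e => RLt (ROfQ e) r -> LimGt C x e).

Definition Gauge (C : set) : Prop :=
  forall X, UnitPoint (RealOf X) ->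
    exQ (fun e => QLt Q0 e & LimGt C (RealOf X) e).

Definition FineCover (C : set) (k : D) (P R : set) : Prop :=
  (forall i, i < k ->
     UnitPoint (RealAt P i) & IsReal (RealAt R i) &
     RLt (ROfQ Q0) (RealAt R i) & LeLim (RealAt R i) C (RealAt P i)) &
  (forall i j, i < k -> j < k -> REq (RealAt P i) (RealAt P j) ->
     REq (RealAt R i) (RealAt R j)) &
  (forall X, UnitPoint (RealOf X) ->
     ex_ (fun i => i < k &
       RLt (RSub (RealAt P i) (RealAt R i)) (RealOf X) &
       RLt (RealOf X) (RAdd (RealAt P i) (RealAt R i)))).

Definition Cousin : Prop :=
  forall C, BaireOne C -> Gauge C ->
    ex_ (fun k => ex_ (fun P => ex_ (fun R => FineCover C k P R))).

End Sem.
End Sem.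

Lemma sat_CousinBaireOne (M : rca_model) (e : nat -> dom M) (f : nat -> sets M) :
  sat e f CousinBaireOne <-> Sem.Cousin M.
Proof. exact: iff_refl. Qed.

Local Open Scope ring_scope.

(** * Reals of the model as sequences in the field of fractions *)

Section Reals.
Variable M : rca_model.
Notation D := (num M).
Notation F := (field_of M).
Implicit Types (a b q r : D * D * D) (x y z : Sem.real M) (s t u : D -> F).

Lemma sem_ex (A : Type) (P : A -> Prop) : Sem.ex_ P <-> exists c, P c.
Proof. exact: not_all_not. Qed.

Lemma sem_and (P Q : Prop) : Sem.and_ P Q <-> P /\ Q.
Proof. exact: not_imp_not. Qed.

Lemma sem_or (P Q : Prop) : Sem.or_ P Q <-> P \/ Q.
Proof. exact: not_imp. Qed.

Lemma sem_iff (P Q : Prop) : Sem.iff_ P Q <-> (P <-> Q).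
Proof. exact: not_imp_not. Qed.

Lemma sem_exQ (P : D * D * D -> Prop) : Sem.exQ P <-> exists q, P q.
Proof.
rewrite /Sem.exQ sem_ex; split=> [[a /sem_ex[b /sem_ex[c Pc]]]|[[[a b] c] Pc]].
  by exists (a, b, c).
by exists a; apply/sem_ex; exists b; apply/sem_ex; exists c.
Qed.

Lemma sem_allQ (P : D * D * D -> Prop) : Sem.allQ P <-> forall q, P q.
Proof. by split=> [h [[a b] c]|h a b c]; apply: h. Qed.

Lemma sem_le (n m : D) : Sem.or_ (mlt n m) (n = m) <-> toF n <= toF m.
Proof.
rewrite sem_or toF_lt le_eqVlt; split=> [[->|->]|/orP[/eqP/toF_inj|]].
- by rewrite orbT.
- by rewrite eqxx.
- by right.
by left.
Qed.

Definition qcode q : D := pair (pair q.1.1 q.1.2) q.2.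

Lemma qcode_inj : injective qcode.
Proof.
move=> [[p n] d] [[p' n'] d'] /pair_inj[/pair_inj[/= -> ->] /= ->] //.
Qed.

Lemma fval_lt a b : Sem.QLt a b <-> fval a < fval b.
Proof.
case: a b => [[p n] d] [[p' n'] d'].
rewrite /Sem.QLt /Sem.rpos /Sem.rneg /Sem.rden /fval /=.
rewrite -[madd (mmul p _) _]/(p * (d' + 1) + n' * (d + 1)).
rewrite -[madd (mmul p' _) _]/(p' * (d + 1) + n * (d' + 1)).
rewrite toF_lt !toFE ltr_pdivrMr ?toF_succ_gt0 // mulrAC ltr_pdivlMr ?toF_succ_gt0 //.
by split; lra.
Qed.

Lemma fval_le a b : Sem.QLe a b <-> fval a <= fval b.
Proof.
case: a b => [[p n] d] [[p' n'] d'].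
rewrite /Sem.QLe /Sem.rpos /Sem.rneg /Sem.rden /fval /=.
rewrite -[madd (mmul p _) _]/(p * (d' + 1) + n' * (d + 1)).
rewrite -[madd (mmul p' _) _]/(p' * (d + 1) + n * (d' + 1)).
rewrite sem_le !toFE ler_pdivrMr ?toF_succ_gt0 // mulrAC ler_pdivlMr ?toF_succ_gt0 //.
by split; lra.
Qed.

Lemma fval_add a b : fval (Sem.QAdd a b) = fval a + fval b.
Proof.
case: a b => [[p n] d] [[p' n'] d'].
rewrite /Sem.QAdd /Sem.rpos /Sem.rneg /Sem.rden /fval /=.
rewrite -[madd (mmul p _) _]/(p * (d' + 1) + p' * (d + 1)).
rewrite -[madd (mmul n _) _]/(n * (d' + 1) + n' * (d + 1)).
rewrite -[madd (madd _ _) _]/(d * d' + d + d') !toFE.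
have h : toF d + 1 != 0 by rewrite gt_eqF ?toF_succ_gt0.
have h' : toF d' + 1 != 0 by rewrite gt_eqF ?toF_succ_gt0.
have -> : toF d * toF d' + toF d + toF d' + 1 = (toF d + 1) * (toF d' + 1) by ring.
by field; rewrite h h'.
Qed.

Lemma fval_opp a : fval (Sem.QOpp a) = - fval a.
Proof.
by rewrite /Sem.QOpp /Sem.rpos /Sem.rneg /Sem.rden /fval /= -mulNr opprB.
Qed.

Lemma fval_sub a b : fval (Sem.QSub a b) = fval a - fval b.
Proof. by rewrite /Sem.QSub fval_add fval_opp. Qed.

Lemma fval_Q0 : fval (Sem.Q0 M) = 0.
Proof. by rewrite /fval /= -[mzero M]/(0 : D) subrr mul0r. Qed.

Lemma fval_Q1 : fval (Sem.Q1 M) = 1.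
Proof.
rewrite /fval /= -[mzero M]/(0 : D) -[mone M]/(1 : D) !toFE.
by rewrite subr0 add0r divr1.
Qed.

Lemma fval_nat (p d : D) : fval (p, 0, d) = toF p / (toF d + 1).
Proof. by rewrite /fval /= toF0 subr0. Qed.

Definition fvalD := (fval_add, fval_opp, fval_sub, fval_Q0, fval_Q1).

Lemma ler_dist (c d e : F) : (c - d <= e) && (d - c <= e) = (`|c - d| <= e).
Proof.
by rewrite ler_norml andbC; congr (_ && _); apply/idP/idP; lra.
Qed.

Lemma fval_dist a b q : Sem.QDistLe a b q <-> `|fval a - fval b| <= fval q.
Proof.
rewrite /Sem.QDistLe sem_and !fval_le !fval_sub -ler_dist.
by split=> [[-> ->]|/andP].
Qed.

(** Any set [E] as in [Sem.Pow2] contains the graph of [pow] by induction, and its clauses then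
    leave no other value at [k]. *)
Lemma Pow2P k e : Sem.Pow2 (M := M) k e <-> e = pow k.
Proof.
split=> [/sem_ex[E /sem_and[h0 /sem_and[hS hk]]]|->]; last first.
  apply/sem_ex; exists (pow_graph M); apply/sem_and; split.
    by move=> z; apply/sem_iff; rewrite -[mone M]pow0; exact: pow_graphP.
  apply/sem_and; split; last by apply/pow_graphP.
  move=> n y /pow_graphP -> z; apply/sem_iff.
  rewrite -[mmul _ _]/((1 + 1) * pow n) mulrDl mul1r -powS; exact: pow_graphP.
have mem n : mmem (pair n (pow n)) E.
  move: n; apply: num_induction1 => [||n IH].
  - apply: (def1_graph (t := fun v : nat -> D => v 0%N)
      (Q := fun (y : D) (v : nat -> D) => mmem (pair (v 0%N) y) E) (@pow_graphP M));
      by num_def.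
  - by rewrite pow0; have /sem_iff[_] := h0 1; apply.
  have /sem_iff[_] := hS n _ IH (pow (n + 1)); apply.
  by rewrite -[mmul _ _]/((1 + 1) * pow n) mulrDl mul1r powS.
case: (num_zeroP k) hk => [->|[n ->]] hk.
  by have /sem_iff[/(_ hk) -> _] := h0 e; rewrite pow0.
have /sem_iff[/(_ hk) -> _] := hS n _ (mem n) e.
by rewrite powS -[mmul _ _]/((1 + 1) * pow n) mulrDl mul1r.
Qed.

Lemma Pow2_succ k (c : D) : Sem.Pow2 (M := M) k (madd c (mone M)) ->
  (toF c + 1)^-1 = half_pow k.
Proof.
by move=> /Pow2P E; rewrite /half_pow -E -[madd _ _]/(c + 1) !toFE.
Qed.

Lemma Pow2_exists (k : D) : exists c : D, Sem.Pow2 (M := M) k (madd c (mone M)).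
Proof.
have [z|[c cE]] := num_zeroP (pow k).
  by have := pow_gt0 k; rewrite z toF0 ltxx.
by exists c; apply/Pow2P; rewrite cE.
Qed.

(** The function [s] lives in the metatheory and remembers only the values of the entries, so
    comparisons of reals become inequalities in the field. *)
Definition seq_of x s : Prop :=
  (forall k, exists q, x k q) /\ (forall k q, x k q -> fval q = s k).

Definition regular s : Prop := forall k i : D, `|s k - s (k + i)| <= half_pow k.

Lemma IsReal_fun x : Sem.IsReal x -> exists xs : D -> D * D * D,
  (forall k q, x k q <-> q = xs k) /\ regular (fun k => fval (xs k)).
Proof.
move=> /sem_and[h1 h2].
have /choice[xs hxs] k : exists q, x k q /\ forall q', x k q' -> q' = q.
  have /sem_exQ[q /sem_and[xq /sem_allQ hq]] := h1 k.
  by exists q; split=> // q' /hq; apply: qcode_inj.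
exists xs; split=> [k q|k i].
  by case: (hxs k) => xk h; split=> [/h|->].
have [c hc] := Pow2_exists k.
have /sem_allQ/(_ (xs k))/sem_allQ/(_ (xs (k + i))) := h2 k i c.
move=> /(_ hc (proj1 (hxs _)) (proj1 (hxs _)))/fval_dist.
rewrite -(Pow2_succ hc).
by rewrite -[(_, mzero M, _)]/((1 : D, 0 : D, c)) fval_nat toF1 mul1r.
Qed.

Lemma seq_of_fun x (xs : D -> D * D * D) :
  (forall k q, x k q <-> q = xs k) -> seq_of x (fun k => fval (xs k)).
Proof. by move=> h; split=> [k|k q /h -> //]; exists (xs k); apply/h. Qed.

Lemma IsReal_seq x : Sem.IsReal x -> exists s, seq_of x s /\ regular s.
Proof.
move=> /IsReal_fun[xs [h r]]; exists (fun k => fval (xs k)).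
by split=> //; apply: seq_of_fun.
Qed.

Lemma IsReal_intro x (xs : D -> D * D * D) :
  (forall k q, x k q <-> q = xs k) -> regular (fun k => fval (xs k)) ->
  Sem.IsReal x.
Proof.
move=> hx rx; apply/sem_and; split=> [k|k i c].
  apply/sem_exQ; exists (xs k); apply/sem_and; split; first by apply/hx.
  by apply/sem_allQ => q /hx ->.
apply/sem_allQ => q; apply/sem_allQ => q' hc /hx -> /hx ->; apply/fval_dist.
rewrite -[(_, mzero M, _)]/((1 : D, 0 : D, c)) fval_nat toF1 mul1r (Pow2_succ hc).
exact: rx.
Qed.

Lemma RLe_seq x y s t : seq_of x s -> seq_of y t ->
  Sem.RLe x y <-> forall k, s k <= t k + half_pow k + half_pow k.
Proof.
move=> [ex xs] [ey yt]; split=> h k.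
  have [c hc] := Pow2_exists k; have [q xq] := ex k; have [q' yq'] := ey k.
  have /sem_allQ/(_ q)/sem_allQ/(_ q' hc xq yq')/fval_le := h k c.
  rewrite fval_add (xs _ _ xq) (yt _ _ yq') -(Pow2_succ hc).
  rewrite -[(_, mzero M, _)]/((1 + 1 : D, 0 : D, c)) fval_nat !toFE mulrDl mul1r.
  by rewrite addrA.
move=> c; apply/sem_allQ => q; apply/sem_allQ => q' hc xq yq'; apply/fval_le.
rewrite fval_add (xs _ _ xq) (yt _ _ yq').
rewrite -[(_, mzero M, _)]/((1 + 1 : D, 0 : D, c)) fval_nat !toFE mulrDl mul1r.
by rewrite (Pow2_succ hc) addrA.
Qed.

Lemma seq_ROfQ q : seq_of (Sem.ROfQ q) (fun=> fval q).
Proof. by split=> [k|k q' /qcode_inj -> //]; exists q. Qed.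

Lemma seq_RAdd x y s t : seq_of x s -> seq_of y t ->
  seq_of (Sem.RAdd x y) (fun k => s (k + 1) + t (k + 1)).
Proof.
move=> [ex xs] [ey yt]; split=> [k|k q].
  have [a xa] := ex (k + 1); have [b yb] := ey (k + 1); exists (Sem.QAdd a b).
  by apply/sem_exQ; exists a; apply/sem_exQ; exists b; do 2 (apply/sem_and; split=> //).
move=> /sem_exQ[a /sem_exQ[b /sem_and[xa /sem_and[yb /qcode_inj ->]]]].
by rewrite fval_add (xs _ _ xa) (yt _ _ yb).
Qed.

Lemma seq_ROpp x s : seq_of x s -> seq_of (Sem.ROpp x) (fun k => - s k).
Proof.
move=> [ex xs]; split=> [k|k q].
  have [a xa] := ex k; exists (Sem.QOpp a).
  by apply/sem_exQ; exists a; apply/sem_and.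
by move=> /sem_exQ[a /sem_and[xa /qcode_inj ->]]; rewrite fval_opp (xs _ _ xa).
Qed.

Lemma seq_RSub x y s t : seq_of x s -> seq_of y t ->
  seq_of (Sem.RSub x y) (fun k => s (k + 1) - t (k + 1)).
Proof. by move=> hx hy; apply: (seq_RAdd hx (seq_ROpp hy)). Qed.

Lemma regular_const (c : F) : regular (fun=> c).
Proof. by move=> k i; rewrite subrr normr0 ltW ?half_pow_gt0. Qed.

Lemma regularD s t : regular s -> regular t ->
  regular (fun k => s (k + 1) + t (k + 1)).
Proof.
move=> rs rt k i; rewrite -half_powS.
have := rs (k + 1) i; have := rt (k + 1) i; rewrite [k + 1 + i]addrAC.
by rewrite -!ler_dist => /andP[? ?] /andP[? ?]; apply/andP; split; lra.
Qed.

Lemma regularN s : regular s -> regular (fun k => - s k).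
Proof. by move=> rs k i; rewrite -opprD normrN; apply: rs. Qed.

Lemma regularB s t : regular s -> regular t ->
  regular (fun k => s (k + 1) - t (k + 1)).
Proof. by move=> rs rt; apply: (regularD rs (regularN rt)). Qed.

(** Comparisons are restated as inequalities that hold eventually, with a positive slack or error.
    In this form the shift of indices made by [RAdd] is harmless. *)
Definition eventually (P : D -> Prop) : Prop :=
  exists K : D, forall k : D, toF K <= toF k -> P k.

Lemma eventually_all (P : D -> Prop) : (forall k, P k) -> eventually P.
Proof. by move=> h; exists 0. Qed.

Lemma eventually_mono (P Q : D -> Prop) :
  (forall k, P k -> Q k) -> eventually P -> eventually Q.
Proof. by move=> h [K hK]; exists K => k /hK /h. Qed.

Lemma eventually_and (P Q : D -> Prop) :
  eventually P -> eventually Q -> eventually (fun k => P k /\ Q k).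
Proof.
move=> [K hK] [L hL]; exists (K + L) => k; rewrite toFD => le.
have := toF_ge0 K; have := toF_ge0 L => ? ?.
by split; [apply: hK|apply: hL]; lra.
Qed.

Lemma eventually_shift (P : D -> Prop) :
  eventually (fun k => P (k + 1)) -> eventually P.
Proof.
move=> [K hK]; exists (K + 1) => k; rewrite !toFE => le.
case: (num_zeroP k) => [k0|[j jE]].
  by have := toF_ge0 K; move: le; rewrite k0 toF0; lra.
by rewrite jE; apply: hK; move: le; rewrite jE !toFE; lra.
Qed.

Lemma eventually_succ (P : D -> Prop) :
  eventually P -> eventually (fun k => P (k + 1)).
Proof. by move=> [K hK]; exists K => k le; apply: hK; rewrite !toFE; lra. Qed.

Lemma eventually_ex (P : D -> Prop) : eventually P -> exists k, P k.
Proof. by move=> [K hK]; exists K; apply: hK. Qed.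

Lemma eventually_half_pow (e : F) : 0 < e -> eventually (fun k => half_pow k < e).
Proof.
move=> /half_pow_small[K hK]; exists K => k le.
by apply: le_lt_trans hK; apply: half_pow_le.
Qed.

Lemma eventually_regular s k : regular s ->
  eventually (fun m => `|s k - s m| <= half_pow k).
Proof. by move=> rs; exists k => m /toF_sub[i ->]; apply: rs. Qed.

(** If [s k] exceeds [t k] by more than [2 * 2^-k] at a single [k], regularity preserves a fixed
    part of the excess at all later indices. *)
Lemma RLe_eventually x y s t : seq_of x s -> seq_of y t -> regular s -> regular t ->
  Sem.RLe x y <-> forall e : F, 0 < e -> eventually (fun k => s k <= t k + e).
Proof.
move=> hx hy rs rt; rewrite (RLe_seq hx hy); split=> [h e e0|h k].
  have e2 : 0 < e / 2 by lra.
  by apply: eventually_mono (eventually_half_pow e2) => k; have := h k; lra.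
rewrite leNgt; apply/negP => lt.
have e0 : 0 < s k - (t k + half_pow k + half_pow k) by lra.
have e1 : 0 < (s k - (t k + half_pow k + half_pow k)) / 2 by lra.
have := eventually_and (h _ e1)
  (eventually_and (eventually_regular k rs) (eventually_regular k rt)).
move=> /eventually_ex[m [le []]]; rewrite -!ler_dist.
move=> /andP[? ?] /andP[? ?]; lra.
Qed.

Lemma RLt_eventually x y s t : seq_of x s -> seq_of y t -> regular s -> regular t ->
  Sem.RLt x y <-> exists2 e : F, 0 < e & eventually (fun k => s k + e <= t k).
Proof.
move=> hx hy rs rt; rewrite /Sem.RLt (RLe_seq hy hx); split=> [/existsNP[k h]|].
  have {}h : s k + half_pow k + half_pow k < t k.
    by rewrite ltNge; apply/negP.
  exists (t k - (s k + half_pow k + half_pow k)); first by lra.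
  have := eventually_and (eventually_regular k rs) (eventually_regular k rt).
  apply: eventually_mono => m []; rewrite -!ler_dist.
  move=> /andP[? ?] /andP[? ?]; lra.
move=> [e e0 ev] h.
have e2 : 0 < e / 2 by lra.
have := eventually_and ev (eventually_half_pow e2).
by move=> /eventually_ex[k [le lt]]; have := h k; lra.
Qed.

Lemma RDistLt_eventually x y z s t u :
  seq_of x s -> seq_of y t -> seq_of z u -> regular s -> regular t -> regular u ->
  Sem.RDistLt x y z <->
  exists2 e : F, 0 < e & eventually (fun k => `|s k - t k| + e <= u k).
Proof.
move=> hx hy hz rs rt ru; rewrite /Sem.RDistLt sem_and.
rewrite (RLt_eventually (seq_RSub hx hy) hz (regularB rs rt) ru).
rewrite (RLt_eventually (seq_RSub hy hx) hz (regularB rt rs) ru).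
(* The difference is read at [k + 1] but the radius at [k]; regularity of [u] absorbs the
   mismatch. *)
have close (e : F) : 0 < e -> eventually (fun k => `|u k - u (k + 1)| <= e).
  move=> e0; apply: eventually_mono (eventually_half_pow e0) => k.
  by have := ru k 1; lra.
split=> [[[e e0 h] [e' e0' h']]|[e e0 h]].
  exists (Num.min (e / 2) (e' / 2)); first by rewrite lt_min; apply/andP; split; lra.
  have [e2 e2'] : 0 < e / 2 /\ 0 < e' / 2 by split; lra.
  apply: eventually_shift.
  have := eventually_and (eventually_and h h')
    (eventually_and (close _ e2) (close _ e2')).
  apply: eventually_mono => k [[h1 h2] []]; rewrite -!ler_dist.
  move=> /andP[? ?] /andP[? ?].
  have m1 : Num.min (e / 2) (e' / 2) <= e / 2 by rewrite ge_min lexx.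
  have m2 : Num.min (e / 2) (e' / 2) <= e' / 2 by rewrite ge_min lexx orbT.
  by rewrite -lerBrDr -ler_dist; apply/andP; split; lra.
have e2 : 0 < e / 2 by lra.
have hs : eventually (fun k => `|s (k + 1) - t (k + 1)| + e <= u (k + 1)).
  case: h => K hK; exists K => k le; apply: hK; rewrite !toFE; lra.
have hsc := eventually_and hs (close _ e2).
by split; exists (e / 2) => //; apply: eventually_mono hsc => k;
  rewrite -lerBrDr -!ler_dist => -[/andP[? ?] /andP[? ?]]; lra.
Qed.

Lemma RDistLe_eventually x y z s t u :
  seq_of x s -> seq_of y t -> seq_of z u -> regular s -> regular t -> regular u ->
  Sem.RDistLe x y z <->
  forall e : F, 0 < e -> eventually (fun k => `|s k - t k| <= u k + e).
Proof.
move=> hx hy hz rs rt ru; rewrite /Sem.RDistLe sem_and.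
rewrite (RLe_eventually (seq_RSub hx hy) hz (regularB rs rt) ru).
rewrite (RLe_eventually (seq_RSub hy hx) hz (regularB rt rs) ru).
have close (e : F) : 0 < e -> eventually (fun k => `|u k - u (k + 1)| <= e).
  move=> e0; apply: eventually_mono (eventually_half_pow e0) => k.
  by have := ru k 1; lra.
split=> [[h h'] e e0|h].
  have e2 : 0 < e / 2 by lra.
  apply: eventually_shift.
  have := eventually_and (eventually_and (h _ e2) (h' _ e2)) (close _ e2).
  apply: eventually_mono => k [[h1 h2]]; rewrite -!ler_dist => /andP[? ?].
  by apply/andP; split; lra.
suff hs (e : F) : 0 < e -> eventually (fun k => `|s (k + 1) - t (k + 1)| <= u k + e).
  by split=> e /hs; apply: eventually_mono => k; rewrite -ler_dist => /andP[? ?]; lra.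
move=> e0; have e2 : 0 < e / 2 by lra.
have hs : eventually (fun k => `|s (k + 1) - t (k + 1)| <= u (k + 1) + e / 2).
  case: (h _ e2) => K hK; exists K => k le; apply: hK; rewrite !toFE; lra.
apply: eventually_mono (eventually_and hs (close _ e2)) => k [].
by rewrite -!ler_dist => /andP[? ?] /andP[? ?]; apply/andP; split; lra.
Qed.

End Reals.

(** * Definable relations between rationals *)

Section RatDefinability.
Variable M : rca_model.
Notation D := (num M).
Notation env := (nat -> D).
Notation rat := (D * D * D)%type.
Implicit Types (k : nat) (f g h : env -> rat).

Definition definable_rat k f : Prop :=
  [/\ definable_tm k (fun v => (f v).1.1), definable_tm k (fun v => (f v).1.2) &
    definable_tm k (fun v => (f v).2)].

Lemma def_rat k (p n d : env -> D) :
  definable_tm k p -> definable_tm k n -> definable_tm k d ->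
  definable_rat k (fun v => (p v, n v, d v)).
Proof. by split. Qed.

Lemma def_rat_const k (q : rat) : definable_rat k (fun=> q).
Proof. by split; apply: def_const. Qed.

Lemma def_rat_add k f g : definable_rat k f -> definable_rat k g ->
  definable_rat k (fun v => Sem.QAdd (f v) (g v)).
Proof.
move=> [? ? ?] [? ? ?].
split; rewrite /Sem.QAdd /Sem.rpos /Sem.rneg /Sem.rden /=;
  repeat first [assumption | apply: def_const | apply: def_add | apply: def_mul].
Qed.

Lemma def_rat_opp k f : definable_rat k f -> definable_rat k (fun v => Sem.QOpp (f v)).
Proof. by case. Qed.

Lemma def_rat_sub k f g : definable_rat k f -> definable_rat k g ->
  definable_rat k (fun v => Sem.QSub (f v) (g v)).
Proof. by move=> df dg; apply: def_rat_add => //; apply: def_rat_opp. Qed.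

Lemma def0_QLt k f g : definable_rat k f -> definable_rat k g ->
  definable0 k (fun v => Sem.QLt (f v) (g v)).
Proof.
move=> [? ? ?] [? ? ?]; rewrite /Sem.QLt /Sem.rpos /Sem.rneg /Sem.rden /=.
apply: def0_lt;
  repeat first [assumption | apply: def_const | apply: def_add | apply: def_mul].
Qed.

Lemma def0_QLe k f g : definable_rat k f -> definable_rat k g ->
  definable0 k (fun v => Sem.QLe (f v) (g v)).
Proof.
move=> df dg; apply: (@def0_ext M _ (fun v => ~ Sem.QLt (g v) (f v))).
  by move=> v; rewrite fval_lt fval_le leNgt; split=> /negP.
by apply: def0_not; apply: def0_QLt.
Qed.

Lemma def_qcode k f : definable_rat k f -> definable_tm k (fun v => qcode (f v)).
Proof.
move=> [? ? ?]; rewrite /qcode /pair.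
repeat first [assumption | apply: def_const | apply: num_def_add | apply: num_def_mul].
Qed.

Lemma def_pair k (s t : env -> D) : definable_tm k s -> definable_tm k t ->
  definable_tm k (fun v => pair (s v) (t v)).
Proof.
move=> ? ?; rewrite /pair.
repeat first [assumption | apply: num_def_add | apply: num_def_mul].
Qed.

(** Not an order of values: it bounds the three components of a name, so that a quantifier over
    rationals becomes three bounded number quantifiers. *)
Definition rat_lt (q : rat) (t : D) : Prop :=
  mlt q.1.1 t /\ (mlt q.1.2 t /\ mlt q.2 t).

Lemma rat_lt_qcode (q : rat) (t : D) : mlt (qcode q) t -> rat_lt q t.
Proof.
case: q => -[p n] d; rewrite /rat_lt /= => lt.
split; first exact: mlt_pairl (mlt_pairl lt).
by split; [exact: mlt_pairr (mlt_pairl lt)|exact: mlt_pairr lt].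
Qed.

Lemma def0_exists_rat k (t : env -> D) (P : rat -> env -> Prop) :
  definable_tm k t ->
  definable0 k.+3 (fun v => P (v 2%N, v 1%N, v 0%N) (tl (tl (tl v)))) ->
  definable0 k (fun v => exists q, rat_lt q (t v) /\ P q v).
Proof.
move=> dt dP.
apply: (@def0_ext M _ (fun v => exists p, mlt p (t v) /\ exists n, mlt n (t v) /\
    exists d, mlt d (t v) /\ P (p, n, d) v)).
  move=> v; split=> [[p [lp [n [ln [d [ld h]]]]]]|[[[p n] d] [[lp [ln ld]] h]]].
    by exists (p, n, d).
  by exists p; split=> //; exists n; split=> //; exists d.
apply: def0_exists_lt => //; apply: def0_exists_lt; first exact: def_lift.
by apply: def0_exists_lt; first exact: (def_lift (def_lift dt)).
Qed.

Lemma definable1_ex_rat k (P : rat -> env -> Prop) :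
  definable1 k.+3 (fun v => P (v 2%N, v 1%N, v 0%N) (tl (tl (tl v)))) ->
  definable1 k (fun v => exists q, P q v).
Proof.
move=> dP; apply: (@def1_ext M _ (fun v => exists p n d, P (p, n, d) v)).
  move=> v; split=> [[p [n [d h]]]|[[[p n] d] h]]; first by exists (p, n, d).
  by exists p, n, d.
by do 3 apply: definable1_ex1.
Qed.

Lemma real_comprehension (G : D -> rat -> Prop) :
  definable0 4 (fun v => G (v 3%N) (v 2%N, v 1%N, v 0%N)) ->
  exists X : sets M, forall (i : D) q, Sem.RealOf X i q <-> G i q.
Proof.
move=> dG; have [|X hX] := @comprehension0_pair M (fun i z =>
    exists q, rat_lt q (z + 1) /\ (z = qcode q /\ G i q)).
  apply: (def0_exists_rat (t := fun v : env => v 1%N + 1)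
    (P := fun q (v : env) => v 1%N = qcode q /\ G (v 0%N) q)); first by num_def.
  apply: def0_and.
    by apply: def0_eq; [apply: def_var|apply: def_qcode; apply: def_rat; apply: def_var].
  by have := def0_ren (k' := 5) (r := fun n => n) _ dG; apply; lia.
exists X => i q; rewrite /Sem.RealOf; split=> [/hX[q' [_ [/qcode_inj -> ]]] //|Gk].
by apply/hX; exists q; split=> //; apply: rat_lt_qcode; apply: mlt_succ.
Qed.

End RatDefinability.

Ltac rat_def_step :=
  lazymatch goal with
  | |- definable_tm _ _ =>
      first [ apply: def_const | apply: def_var; exact: isT
            | apply: def_qcode | apply: def_pair
            | apply: num_def_add | apply: num_def_mul ]
  | |- definable_rat _ _ =>
      first [ apply: def_rat_const | apply: def_rat_add
            | apply: def_rat_sub | apply: def_rat_opp | apply: def_rat ]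
  | |- definable0 _ _ =>
      first [ apply: def0_const | apply: def0_QLt | apply: def0_QLe
            | apply: def0_mem | apply: def0_eq | apply: def0_lt
            | apply: def0_and | apply: def0_or | apply: def0_exists_rat
            | apply: def0_exists_lt ]
  end.

Ltac rat_def := repeat (progress (rewrite /tl /=) || rat_def_step).

(* [lra] is slow when atoms unfold to field operations. *)
Ltac atoms_lra :=
  repeat match goal with
  | H : is_true (_ <= _) |- _ => move: H
  | H : is_true (_ < _) |- _ => move: H end;
  repeat match goal with
  | |- context [fval ?q] => move: (fval q) => ?
  | |- context [specker ?h ?n] => move: (specker h n) => ?
  | |- context [half_pow ?n] => move: (half_pow n) => ?
  | |- context [toF ?n] => move: (toF n) => ?
  end;
  intros; lra.

Ltac abs_lra :=
  repeat match goal with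
  | H : is_true (Num.norm _ <= _) |- _ =>
      move: H; rewrite ler_norml => /andP[? ?]
  | H : is_true (Num.norm _ + _ <= _) |- _ =>
      move: H; rewrite -lerBrDr ler_norml => /andP[? ?]
  end;
  try (match goal with
  | |- is_true (Num.norm _ <= _) => rewrite ler_norml
  | |- is_true (Num.norm _ + _ <= _) => rewrite -lerBrDr ler_norml
  end; apply/andP; split);
  repeat match goal with
  | H : context [Num.norm _] |- _ => move: H end;
  repeat match goal with
  | |- context [Num.norm ?x] =>
      lazymatch x with
      | context [Num.norm _] => fail
      | _ => case: (ger0P x) => ?
      end
  end;
  intros; atoms_lra.

(** * The gauge *)

Section Gauge.
Variable M : rca_model.
Notation D := (num M).
Notation F := (field_of M).
Notation env := (nat -> D).
Notation rat := (D * D * D)%type.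
Variable th : D -> D -> Prop.
Hypothesis dth : definable0 2 (fun v : env => th (v 0%N) (v 1%N)).
Notation c := (specker dth).

(** A code inside the model needs names of rationals that a set can list. These have numerator
    [digits] and denominator [pow n], stored as its predecessor. *)
Lemma specker_names : exists (cq : D -> rat) (C : sets M),
  (forall n q, mmem (pair n (qcode q)) C <-> q = cq n) /\
  (forall n, fval (cq n) = c n).
Proof.
have /choice[d hd] : forall n : D, exists d : D, pow n = d + 1.
  move=> n; have [z|//] := num_zeroP (pow n).
  by have := pow_gt0 n; rewrite z toF0 ltxx.
have [|C hC] := @comprehension0_pair M (fun n z => exists q, rat_lt q (z + 1) /\
    (z = qcode q /\ (mmem (pair n (pair n q.1.1)) (digits_graph dth) /\
      (q.1.2 = 0 /\ mmem (pair n (q.2 + 1)) (pow_graph M))))).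
  apply: (def0_exists_rat (t := fun v : env => v 1%N + 1) (P := fun q (v : env) =>
    v 1%N = qcode q /\ (mmem (pair (v 0%N) (pair (v 0%N) q.1.1)) (digits_graph dth) /\
      (q.1.2 = 0 /\ mmem (pair (v 0%N) (q.2 + 1)) (pow_graph M)))));
    by rat_def.
exists (fun n => (digits dth n n, 0, d n)), C; split=> [n q|n].
  rewrite hC; split=> [[q' [_ [/qcode_inj <- [/digits_graphP E1 [E2 /pow_graphP E3]]]]]|->].
    case: q E1 E2 E3 => -[p n'] d' /= -> ->; rewrite hd => /num_addI ->.
    by [].
  exists (digits dth n n, 0, d n); split.
    by apply: rat_lt_qcode; apply: mlt_succ.
  by split=> //=; rewrite digits_graphP pow_graphP hd.
by rewrite fval_nat /specker /prefix hd !toFE.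
Qed.

(* The ball [B(a, r)] is mapped into the closed ball of centre [b] and radius
   [s] by the 1-Lipschitz function [x |-> |x - e|]. *)
Definition dist_rel (e a r b s : F) : Prop :=
  [/\ 0 <= a <= 1, 0 < r, 0 < s & `| `|a - e| - b| + r <= s].

Lemma gauge_code : exists W : sets M, forall n (a r b s : rat),
  Sem.CtsAt W n a r b s <-> dist_rel (c n) (fval a) (fval r) (fval b) (fval s).
Proof.
have [cq [C [hC cE]]] := specker_names.
(* [dist_rel] without absolute values: the upper bound on [|a - e|] is a conjunction over both
   signs, the lower bound a disjunction. *)
pose Rel (e a r b s : rat) :=
  (Sem.QLe (Sem.Q0 M) a /\ Sem.QLe a (Sem.Q1 M)) /\
  (Sem.QLt (Sem.Q0 M) r /\ Sem.QLt (Sem.Q0 M) s) /\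
  (Sem.QLe (Sem.QAdd (Sem.QSub a e) r) (Sem.QAdd b s) /\
   Sem.QLe (Sem.QAdd (Sem.QSub e a) r) (Sem.QAdd b s)) /\
  (Sem.QLe (Sem.QAdd b r) (Sem.QAdd (Sem.QSub a e) s) \/
   Sem.QLe (Sem.QAdd b r) (Sem.QAdd (Sem.QSub e a) s)).
have RelE e a r b s :
    Rel e a r b s <-> dist_rel (fval e) (fval a) (fval r) (fval b) (fval s).
  rewrite /Rel !fval_le !fval_lt !fvalD /dist_rel.
  split=> [[[h1 h2] [[h3 h4] [[h5 h6] h7]]]|[/andP[h1 h2] h3 h4 h5]].
    split=> //; first by apply/andP.
    by case: h7 => h7; abs_lra.
  split=> //; split=> //; split; first by split; abs_lra.
  case: (lerP 0 (fval a - fval e)) => h; [left|right]; move: h5.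
    by rewrite (ger0_norm h); abs_lra.
  by rewrite (ltr0_norm h); abs_lra.
(* The free component [m] of a code stores the name [e] of [c n]. Without it nothing in the tuple
   would bound that name and the comprehension would not be Sigma_0. *)
pose code n e (a r b s : rat) : D := pair n (pair (qcode e)
  (pair (qcode a) (pair (qcode r) (pair (qcode b) (qcode s))))).
have [|W hW] := @comprehension0 M (fun z => exists n, mlt n (z + 1) /\
    exists e, rat_lt e (z + 1) /\ exists a, rat_lt a (z + 1) /\
    exists r, rat_lt r (z + 1) /\ exists b, rat_lt b (z + 1) /\
    exists s, rat_lt s (z + 1) /\ (z = code n e a r b s /\
      (mmem (pair n (qcode e)) C /\ Rel e a r b s))).
  rewrite /code /Rel.
  apply: def0_exists_lt; first by num_def.
  do 5 (apply: def0_exists_rat; first by rewrite /tl /=; num_def).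
  by rat_def.
exists W => n a r b s; rewrite /Sem.CtsAt sem_ex -cE -RelE; split.
  move=> [m /hW[n' [_ [e [_ [a' [_ [r' [_ [b' [_ [s' [_ [E [eC h]]]]]]]]]]]]]]].
  case/pair_inj: E => nE /pair_inj[_ /pair_inj[/qcode_inj aE /pair_inj
    [/qcode_inj rE /pair_inj[/qcode_inj bE /qcode_inj sE]]]].
  by move: eC h; rewrite -nE -aE -rE -bE -sE => /hC <-.
move=> h; exists (qcode (cq n)); apply/hW.
have lz := mlt_succ (code n (cq n) a r b s).
have l1 := mlt_pairr lz; have l2 := mlt_pairr l1; have l3 := mlt_pairr l2.
have l4 := mlt_pairr l3.
exists n; split; first exact: mlt_pairl lz.
exists (cq n); split; first by apply: rat_lt_qcode; apply: mlt_pairl l1.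
exists a; split; first by apply: rat_lt_qcode; apply: mlt_pairl l2.
exists r; split; first by apply: rat_lt_qcode; apply: mlt_pairl l3.
exists b; split; first by apply: rat_lt_qcode; apply: mlt_pairl l4.
exists s; split; first by apply: rat_lt_qcode; apply: mlt_pairr l4.
by split=> //; split=> //; apply/hC.
Qed.

Definition unit_seq (s : D -> F) : Prop := regular s /\
  forall e, 0 < e -> eventually (fun k => - e <= s k <= 1 + e).

Lemma unit_pointP x s : seq_of x s -> Sem.IsReal x -> regular s ->
  Sem.UnitPoint x <-> unit_seq s.
Proof.
move=> hx rx rs; rewrite /Sem.UnitPoint !sem_and.
rewrite (RLe_eventually (seq_ROfQ _) hx (regular_const _) rs) fval_Q0.
rewrite (RLe_eventually hx (seq_ROfQ _) rs (regular_const _)) fval_Q1.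
split=> [[_ [h0 h1]]|[_ h]].
  split=> // e e0; apply: eventually_mono (eventually_and (h0 e e0) (h1 e e0)).
  by move=> k [? ?]; apply/andP; split; lra.
by split=> //; split=> e /h; apply: eventually_mono => k /andP[? ?]; lra.
Qed.

(** The entries of a point of [[0,1]] may lie slightly outside, but the centre of a ball may not, so
    a late entry is clamped to 0 or 1. *)
Lemma unit_seq_near s e : unit_seq s -> 0 < e ->
  exists2 a : F, 0 <= a <= 1 & eventually (fun k => `|s k - a| <= e).
Proof.
move=> [rs us] e0; have e4 : 0 < e / 4 by lra.
have [k0 hk0] := half_pow_small e4.
have [k [/andP[h1 h2] h3]] := eventually_ex
  (eventually_and (us _ e4) (eventually_regular k0 rs)).
have [a a01 ha] : exists2 a : F, 0 <= a <= 1 & `|s k0 - a| <= e / 2.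
  case: (lerP 0 (s k0)) => h4; last first.
    by exists 0; [rewrite lexx ler01|abs_lra].
  case: (lerP (s k0) 1) => h5; last by exists 1; [rewrite lexx ler01|abs_lra].
  by exists (s k0); [rewrite h4 h5|rewrite subrr normr0; lra].
exists a => //; apply: eventually_mono (eventually_regular k0 rs) => m h.
by abs_lra.
Qed.

Lemma eventually_imp2 (P Q : D -> Prop) (R : D -> Prop) :
  (forall k, P k -> Q k -> R k) -> eventually P -> eventually Q -> eventually R.
Proof.
by move=> h hP hQ; apply: eventually_mono (eventually_and hP hQ) => k []; apply: h.
Qed.

Section WithCode.
Variable W : sets M.
Hypothesis hW : forall n (a r b s : rat),
  Sem.CtsAt W n a r b s <-> dist_rel (c n) (fval a) (fval r) (fval b) (fval s).

Lemma valueP n x y s t : seq_of x s -> seq_of y t -> unit_seq s -> regular t ->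
  Sem.Value (Sem.CtsAt W n) x y <->
  forall e, 0 < e -> eventually (fun k => `|t k - `|s k - c n| | <= e).
Proof.
move=> hx hy us rt; have rs : regular s by case: us.
split=> [h e e0|h].
  (* The ball of radius [e / 4] about [a0] gives the value up to [e / 4]; reading it off costs
     [e / 8], and so does replacing [a0] by [s k]. *)
  have e8 : 0 < e / 8 by lra.
  have [a0 a01 near] := unit_seq_near us e8.
  have [a aE] := fval_surj a0; have [r rE] := fval_surj (e / 4).
  have [b bE] := fval_surj `|a0 - c n|.
  have /sem_allQ/(_ a)/sem_allQ/(_ r)/sem_allQ/(_ b)/sem_allQ/(_ r) := h.
  rewrite hW (RDistLt_eventually hx (seq_ROfQ _) (seq_ROfQ _) rs
    (regular_const _) (regular_const _)) (RDistLe_eventually hy (seq_ROfQ _)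
    (seq_ROfQ _) rt (regular_const _) (regular_const _)) aE rE bE.
  have dr : dist_rel (c n) a0 (e / 4) `|a0 - c n| (e / 4).
    by split=> //; try lra; rewrite subrr normr0; lra.
  have nr : exists2 e' : F, 0 < e' & eventually (fun k => `|s k - a0| + e' <= e / 4).
    by exists (e / 8) => //; apply: eventually_mono near => k; lra.
  move=> /(_ dr nr _ e8); apply: eventually_imp2 near => k h1 h2.
  by abs_lra.
apply/sem_allQ => a; apply/sem_allQ => r; apply/sem_allQ => b; apply/sem_allQ => r'.
rewrite hW (RDistLt_eventually hx (seq_ROfQ _) (seq_ROfQ _) rs
  (regular_const _) (regular_const _)) (RDistLe_eventually hy (seq_ROfQ _)
  (seq_ROfQ _) rt (regular_const _) (regular_const _)).
move=> [_ _ _ h1] [e e0 near] e' e0'; apply: eventually_imp2 near (h _ e0') => k h2 h3.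
by abs_lra.
Qed.

(** [LimInBall] asks for the value as a set of the model. As [c n] is rational, the distance is
    computed entry by entry, and regularity is kept without a shift of indices. *)
Lemma dist_real X s n : seq_of (Sem.RealOf X) s -> Sem.IsReal (Sem.RealOf X) ->
  unit_seq s -> exists V t, [/\ Sem.IsReal (Sem.RealOf V), seq_of (Sem.RealOf V) t,
    regular t & forall k, t k = `|s k - c n|].
Proof.
move=> hX rX [rs _]; have [xs [xsE _]] := IsReal_fun rX.
have sE k : s k = fval (xs k).
  by have [_ /(_ k (xs k)) <- //] := hX; apply/xsE.
have [cq [C [hC cE]]] := specker_names.
pose dq k := Sem.QSub (xs k) (cq n).
pose tq k := if 0 <= fval (dq k) then dq k else Sem.QOpp (dq k).
have tE k : fval (tq k) = `|s k - c n|.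
  by rewrite /tq sE -cE -fval_sub -/(dq k); case: ger0P; rewrite ?fval_opp.
have [|V hV] := @real_comprehension M (fun k q => exists x, rat_lt x (qcode q + 1) /\
    (mmem (pair k (qcode x)) X /\
      ((Sem.QLe (Sem.Q0 M) (Sem.QSub x (cq n)) /\ qcode q = qcode (Sem.QSub x (cq n))) \/
      (Sem.QLt (Sem.QSub x (cq n)) (Sem.Q0 M) /\
        qcode q = qcode (Sem.QOpp (Sem.QSub x (cq n))))))).
  apply: (def0_exists_rat (t := fun v : env => qcode (v 2%N, v 1%N, v 0%N) + 1)
    (P := fun x (v : env) => mmem (pair (v 3%N) (qcode x)) X /\
      ((Sem.QLe (Sem.Q0 M) (Sem.QSub x (cq n)) /\
        qcode (v 2%N, v 1%N, v 0%N) = qcode (Sem.QSub x (cq n))) \/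
      (Sem.QLt (Sem.QSub x (cq n)) (Sem.Q0 M) /\
        qcode (v 2%N, v 1%N, v 0%N) = qcode (Sem.QOpp (Sem.QSub x (cq n)))))));
    by rat_def.
have {}hV k q : Sem.RealOf V k q <-> q = tq k.
  rewrite hV; split.
    move=> [x [_ [/xsE ->]]]; rewrite -/(dq k) /tq fval_le fval_lt fval_Q0.
    by move=> [[-> /qcode_inj ->]|[/lt_geF -> /qcode_inj ->]].
  move=> qE; exists (xs k); split; last first.
    split; first by apply/xsE.
    rewrite -/(dq k) qE /tq fval_le fval_lt fval_Q0.
    by case: lerP => h; [left|right].
  have [l1 [l2 l3]] : rat_lt q (qcode q + 1).
    by apply: rat_lt_qcode; apply: mlt_succ.
  (* The bounded search for [x] succeeds because [QSub] never decreases a component of its first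
     argument; [QOpp] merely exchanges the first two. *)
  have [k1 k2 k3] : [/\ toF (xs k).1.1 <= toF (dq k).1.1,
      toF (xs k).1.2 <= toF (dq k).1.2 & toF (xs k).2 <= toF (dq k).2].
    rewrite /dq /Sem.QSub /Sem.QAdd /Sem.rpos /Sem.rneg /Sem.rden /=.
    case: (xs k) (cq n) => [[p m] d] [[p' m'] d'] /=.
    have [P0 N0 D0] := And3 (toF_ge0 p) (toF_ge0 m) (toF_ge0 d).
    have [P1 N1 D1] := And3 (toF_ge0 p') (toF_ge0 m') (toF_ge0 d').
    rewrite -[madd (mmul p _) _]/(p * (d' + 1) + m' * (d + 1)).
    rewrite -[madd (mmul m _) _]/(m * (d' + 1) + p' * (d + 1)).
    rewrite -[madd (madd _ _) _]/(d * d' + d + d') !toFE.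
    by split; nra.
  have h : forall u w : D, toF u <= toF w -> mlt w (qcode q + 1) -> mlt u (qcode q + 1).
    by move=> u w le /toF_lt lt; apply/toF_lt; apply: le_lt_trans le lt.
  move: l1 l2 l3; rewrite {1 3 5}qE /tq; case: ifP => _ l1 l2 l3.
    by split; [apply: h l1|split; [apply: h l2|apply: h l3]].
  by split; [apply: h l2|split; [apply: h l1|apply: h l3]].
have rt : regular (fun k => fval (tq k)).
  by move=> k i; rewrite !tE; have := rs k i; abs_lra.
exists V, (fun k => fval (tq k)); split=> //; first exact: IsReal_intro hV rt.
exact: seq_of_fun.
Qed.

End WithCode.
End Gauge.

(** * The Baire class 1 gauge and its fine covers *)

Section Cover.
Variable M : rca_model.
Notation D := (num M).
Notation F := (field_of M).
Notation env := (nat -> D).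
Notation rat := (D * D * D)%type.
Variable th : D -> D -> Prop.
Hypothesis dth : definable0 2 (fun v : env => th (v 0%N) (v 1%N)).
Notation c := (specker dth).
Variable W : sets M.
Hypothesis hW : forall n (a r b s : rat),
  Sem.CtsAt W n a r b s <-> dist_rel (c n) (fval a) (fval r) (fval b) (fval s).

Lemma IsCts_dist n : Sem.IsCts (Sem.CtsAt W n).
Proof.
apply/sem_and; split.
  do 4 (apply/sem_allQ => ?); rewrite hW => -[/andP[h1 h2] h3 h4 _].
  do 2 (rewrite /Sem.UnitRat ?sem_and).
  by rewrite !fval_le !fval_lt !fvalD.
apply/sem_and; split.
  do 6 (apply/sem_allQ => ?); rewrite !hW => -[_ h1 h2 h3] [_ h4 h5 h6].
  by rewrite fval_dist fvalD; abs_lra.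
apply/sem_and; split.
  do 6 (apply/sem_allQ => ?); rewrite /Sem.UnitRat /Sem.BallLt !hW !sem_and.
  rewrite !fval_le !fval_lt !fvalD => -[_ h1 h2 h3] [h4 h5] h6 [h7 h8].
  by split=> //; [apply/andP|abs_lra].
do 6 (apply/sem_allQ => ?); rewrite /Sem.BallLt !hW !sem_and.
rewrite !fval_lt !fvalD => -[h0 h1 h2 h3] [h7 h8].
by split=> //; abs_lra.
Qed.

Lemma specker_close (e : F) : 0 < e ->
  exists N, forall m n, toF N <= toF m -> toF N <= toF n -> `|c m - c n| <= e.
Proof.
move=> /(specker_cauchy dth)[N hN]; exists N => m n lm ln.
have h1 := specker_mono dth lm; have h2 := specker_mono dth ln.
have h3 := hN m lm; have h4 := hN n ln.
by abs_lra.
Qed.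

Lemma unit_point_seq (x : Sem.real M) : Sem.UnitPoint x ->
  exists s : D -> F, [/\ seq_of x s, Sem.IsReal x & unit_seq s].
Proof.
move=> ux; have rx : Sem.IsReal x by move/sem_and: ux => [].
have [s [hx rs]] := IsReal_seq rx; exists s; split=> //.
by apply/(unit_pointP hx rx rs).
Qed.

Lemma BaireOne_dist : Sem.BaireOne W.
Proof.
apply/sem_and; split=> [n|X /unit_point_seq[s [hX rX us]]].
  exact: IsCts_dist.
have rs : regular s by case: us.
apply/sem_and; split=> [n|].
  apply/sem_allQ => e; rewrite fval_lt fval_Q0 => e0.
  have e4 : 0 < fval e / 4 by lra.
  have [a0 a01 near] := unit_seq_near us e4.
  have [a aE] := fval_surj a0; have [r rE] := fval_surj (fval e / 2).
  have [b bE] := fval_surj `|a0 - c n|.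
  apply/sem_exQ; exists a; apply/sem_exQ; exists r; apply/sem_exQ; exists b.
  apply/sem_exQ; exists r; apply/sem_and; split.
    apply/hW; rewrite aE rE bE; split=> //; try lra.
    by rewrite subrr normr0; lra.
  apply/sem_and; split; last by rewrite fval_lt rE; lra.
  apply/(RDistLt_eventually hX (seq_ROfQ _) (seq_ROfQ _) rs (regular_const _)
    (regular_const _)); exists (fval e / 4) => //.
  by apply: eventually_mono near => k; rewrite aE rE; lra.
apply/sem_allQ => e; rewrite fval_lt fval_Q0 => e0.
have e4 : 0 < fval e / 4 by lra.
have [N hN] := specker_close e4.
apply/sem_ex; exists N => m n /sem_le lm /sem_le ln V V' rV rV'.
have [t [hV rt]] := IsReal_seq rV; have [t' [hV' rt']] := IsReal_seq rV'.
rewrite (valueP hW m hX hV us rt) (valueP hW n hX hV' us rt') => h h'.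
apply/(RDistLt_eventually hV hV' (seq_ROfQ _) rt rt' (regular_const _)).
exists (fval e / 4) => //; have := hN m n lm ln => close.
apply: eventually_imp2 (h _ e4) (h' _ e4) => k h1 h2.
by abs_lra.
Qed.

(** Expresses convergence of the partial sums to a given real without mentioning their limit, which
    the model may lack. *)
Definition limit (s : D -> F) : Prop := forall e, 0 < e ->
  exists N, forall n, toF N <= toF n -> eventually (fun k => `|s k - c n| <= e).

Lemma not_eventually (P : D -> Prop) (K : D) : ~ eventually P ->
  exists2 k : D, toF K <= toF k & ~ P k.
Proof.
move=> nP; apply: contrapT => h; apply: nP; exists K => k le.
by apply: contrapT => nPk; apply: h; exists k.
Qed.

Lemma Gauge_dist :
  (forall X s, seq_of (Sem.RealOf X) s -> Sem.UnitPoint (Sem.RealOf X) -> ~ limit s) ->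
  Sem.Gauge W.
Proof.
move=> nl X ux; have [s [hX rX us]] := unit_point_seq ux.
have rs : regular s by case: us.
have /existsNP[e /not_implyP[e0 /forallNP far]] := nl X s hX ux.
have e8 : 0 < e / 8 by lra.
have [N hN] := specker_close e8.
have /existsNP[n0 /not_implyP[ln0 ne]] := far N.
have [K hK] := half_pow_small e8.
have [k lk /negP] := not_eventually K ne; rewrite -ltNge => fark.
have hk : half_pow k < e / 8 by apply: le_lt_trans hK; apply: half_pow_le.
have [y yE] := fval_surj `|s k - c n0|; have [r rE] := fval_surj (e / 2).
(* Three parts of [e / 8]: regularity of [s], the oscillation of [specker] beyond [N], and the slack
   of a strict inequality. The outer radius [e / 2] leaves at least [e / 2] below the centre
   [y > e]. *)
have [r' rE'] := fval_surj (3 * e / 8).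
apply/sem_exQ; exists r; apply/sem_and; split.
  by rewrite fval_lt fval_Q0 rE; lra.
apply/sem_exQ; exists y; apply/sem_exQ; exists r; apply/sem_and; split.
  by rewrite fval_le fval_sub rE yE; lra.
apply/sem_exQ; exists r'; apply/sem_and; split; first by rewrite fval_lt rE rE'; lra.
apply/sem_ex; exists N => n /sem_le ln; apply/sem_ex.
have [V [t [rV hV rt tE]]] := dist_real dth n hX rX us.
exists V; apply/sem_and; split=> //; apply/sem_and; split.
  apply/(valueP hW n hX hV us rt) => e' e0'; apply: eventually_all => m.
  by rewrite tE subrr normr0 ltW.
apply/(RDistLt_eventually hV (seq_ROfQ _) (seq_ROfQ _) rt (regular_const _)
  (regular_const _)); exists (e / 8) => //.
apply: eventually_mono (eventually_regular k rs) => m h1; rewrite yE rE' tE.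
have h2 := hN n n0 ln ln0.
by abs_lra.
Qed.

(** By [valueP] the real [V] approximates the distance with any error, and the slack [e'] of the
    strict inequality for the ball pays for it. *)
Lemma LimGt_dist (x : Sem.real M) s e : seq_of x s -> unit_seq s -> Sem.LimGt W x e ->
  exists N, forall n, toF N <= toF n -> eventually (fun k => fval e < `|s k - c n|).
Proof.
move=> hx us /sem_exQ[y /sem_exQ[r /sem_and[h1 /sem_exQ[r' /sem_and[h2 /sem_ex[N h]]]]]].
move: h1 h2; rewrite fval_le fval_lt fval_sub => h1 h2.
exists N => n /sem_le /h /sem_ex[V /sem_and[rV /sem_and[]]].
have [t [hV rt]] := IsReal_seq rV.
rewrite (valueP hW n hx hV us rt) => hv.
move=> /(RDistLt_eventually hV (seq_ROfQ _) (seq_ROfQ _) rt (regular_const _)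
  (regular_const _))[e' e0' near].
apply: eventually_imp2 (hv _ e0') near => k h3 h4.
by abs_lra.
Qed.

(** The right end of an interval is only a relation between indices and rationals; it must be a set
    to count as a point that is the limit. *)
Lemma add_real (P R : sets M) (i : D) p r :
  seq_of (Sem.RealAt P i) p -> Sem.IsReal (Sem.RealAt P i) -> regular p ->
  seq_of (Sem.RealAt R i) r -> Sem.IsReal (Sem.RealAt R i) -> regular r ->
  exists X, Sem.IsReal (Sem.RealOf X) /\
    seq_of (Sem.RealOf X) (fun k => p (k + 1) + r (k + 1)).
Proof.
move=> hP rP rp hR rR rr.
have [ps [psE _]] := IsReal_fun rP; have [rs [rsE _]] := IsReal_fun rR.
have pE k : p k = fval (ps k).
  by have [_ /(_ k (ps k)) <- //] := hP; apply/psE.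
have rE k : r k = fval (rs k).
  by have [_ /(_ k (rs k)) <- //] := hR; apply/rsE.
have [|X hX] := @real_comprehension M (fun k q =>
    exists a, rat_lt a (qcode q + 1) /\ exists b, rat_lt b (qcode q + 1) /\
    (mmem (pair i (pair (k + 1) (qcode a))) P /\
    (mmem (pair i (pair (k + 1) (qcode b))) R /\
      qcode q = qcode (Sem.QAdd a b)))).
  apply: (def0_exists_rat (t := fun v : env => qcode (v 2%N, v 1%N, v 0%N) + 1)
    (P := fun a (v : env) =>
    exists b, rat_lt b (qcode (v 2%N, v 1%N, v 0%N) + 1) /\
    (mmem (pair i (pair (v 3%N + 1) (qcode a))) P /\
    (mmem (pair i (pair (v 3%N + 1) (qcode b))) R /\
      qcode (v 2%N, v 1%N, v 0%N) = qcode (Sem.QAdd a b))))); first by rat_def.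
  by apply: def0_exists_rat; rat_def.
have {}hX k q : Sem.RealOf X k q <-> q = Sem.QAdd (ps (k + 1)) (rs (k + 1)).
  rewrite hX; split.
    by move=> [a [_ [b [_ [/psE -> [/rsE -> /qcode_inj ->]]]]]].
  move=> qE.
  have [l1 [l2 l3]] : rat_lt q (qcode q + 1).
    by apply: rat_lt_qcode; apply: mlt_succ.
  have [ha hb] : [/\ toF (ps (k + 1)).1.1 <= toF q.1.1,
      toF (ps (k + 1)).1.2 <= toF q.1.2 & toF (ps (k + 1)).2 <= toF q.2] /\
      [/\ toF (rs (k + 1)).1.1 <= toF q.1.1,
      toF (rs (k + 1)).1.2 <= toF q.1.2 & toF (rs (k + 1)).2 <= toF q.2].
    rewrite qE /Sem.QAdd /Sem.rpos /Sem.rneg /Sem.rden /=.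
    case: (ps _) (rs _) => [[p0 m] d] [[p' m'] d'] /=.
    have [P0 N0 D0] := And3 (toF_ge0 p0) (toF_ge0 m) (toF_ge0 d).
    have [P1 N1 D1] := And3 (toF_ge0 p') (toF_ge0 m') (toF_ge0 d').
    rewrite -[madd (mmul p0 _) _]/(p0 * (d' + 1) + p' * (d + 1)).
    rewrite -[madd (mmul m _) _]/(m * (d' + 1) + m' * (d + 1)).
    rewrite -[madd (madd _ _) _]/(d * d' + d + d') !toFE.
    by split; split; nra.
  have h : forall u w : D, toF u <= toF w -> mlt w (qcode q + 1) -> mlt u (qcode q + 1).
    by move=> u w le /toF_lt lt; apply/toF_lt; apply: le_lt_trans le lt.
  case: ha hb => a1 a2 a3 [b1 b2 b3].
  exists (ps (k + 1)); split.
    by split; [apply: h l1|split; [apply: h l2|apply: h l3]].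
  exists (rs (k + 1)); split.
    by split; [apply: h l1|split; [apply: h l2|apply: h l3]].
  by split; [apply/psE|split; [apply/rsE|rewrite qE]].
have sE : (fun k => p (k + 1) + r (k + 1))
    = (fun k => fval (Sem.QAdd (ps (k + 1)) (rs (k + 1)))).
  by apply: funext => k; rewrite fval_add pE rE.
exists X; split; last by rewrite sE; apply: seq_of_fun.
by apply: IsReal_intro hX _; rewrite -sE; apply: regularD.
Qed.

Lemma mlt_bound6 (x1 x2 x3 x4 x5 x6 : D) : exists t : D,
  [/\ mlt x1 t, mlt x2 t & mlt x3 t] /\ [/\ mlt x4 t, mlt x5 t & mlt x6 t].
Proof.
exists (x1 + x2 + x3 + x4 + x5 + x6 + 1).
have := toF_ge0 x1; have := toF_ge0 x2; have := toF_ge0 x3.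
have := toF_ge0 x4; have := toF_ge0 x5; have := toF_ge0 x6.
by move=> ? ? ? ? ? ?; split; split; apply/toF_lt; rewrite !toFE; atoms_lra.
Qed.

(* The stage [T] decides, for every [i < k], whether some [specker n] lies
   beyond the right end of the [i]-th interval. *)
Lemma right_end_stage (k : D) (P R : sets M) :
  (forall i, mlt i k -> Sem.IsReal (Sem.RealAt P i) /\ Sem.IsReal (Sem.RealAt R i)) ->
  exists T, forall (i : D) p r, mlt i k ->
    seq_of (Sem.RealAt P i) p -> seq_of (Sem.RealAt R i) r ->
    forall n j, p j + r j + half_pow j + half_pow j < c n ->
    exists j', p j' + r j' + half_pow j' + half_pow j' < c T.
Proof.
move=> hPR; have [cq [C [hC cE]]] := specker_names dth.
(* A certificate below [t] that some [specker n] exceeds the [i]-th right end: the [j]-th entries of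
   centre and radius err by at most [2^-j] each, and [e + 1] is [2^j]. *)
pose ph (i t : D) := exists j : D, mlt j t /\ exists a, rat_lt a t /\
  exists b, rat_lt b t /\ exists n : D, mlt n t /\ exists q, rat_lt q t /\
  exists e : D, mlt e t /\
  (mmem (pair i (pair j (qcode a))) P /\ (mmem (pair i (pair j (qcode b))) R /\
  (mmem (pair n (qcode q)) C /\ (mmem (pair j (e + 1)) (pow_graph M) /\
   Sem.QLt (Sem.QAdd (Sem.QAdd a b) (1 + 1, 0, e)) q)))).
have dph : definable0 2 (fun v : env => ph (v 0%N) (v 1%N)).
  rewrite /ph; apply: def0_exists_lt; first by num_def.
  do 2 (apply: def0_exists_rat; first by rewrite /tl /=; num_def).
  apply: def0_exists_lt; first by rewrite /tl /=; num_def.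
  apply: def0_exists_rat; first by rewrite /tl /=; num_def.
  apply: def0_exists_lt; first by rewrite /tl /=; num_def.
  by rat_def.
have phE (i t : D) p r : seq_of (Sem.RealAt P i) p -> seq_of (Sem.RealAt R i) r ->
    ph i t -> exists n j, mlt n t /\ p j + r j + half_pow j + half_pow j < c n.
  move=> [_ hp] [_ hr] [j [_ [a [_ [b [_ [n [ln [q [_ [e [_ [ha [hb [hq [he h]]]]]]]]]]]]]]]].
  move: hq he h => /hC -> /pow_graphP he.
  rewrite fval_lt !fval_add (hp _ _ ha) (hr _ _ hb).
  rewrite cE fval_nat !toFE mulrDl mul1r => h; exists n, j; split=> //.
  have hE : half_pow j = (toF e + 1)^-1 by rewrite /half_pow -he !toFE.
  by rewrite hE; lra.
have [T hT] := strong_collection dph k; exists T => i p r lik hp hr n j lt.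
have [rP rR] := hPR i lik.
have [|t [ltT pht]] := hT i lik.
  have [[a ha] hp'] := (hp.1 j, hp.2); have [[b hb] hr'] := (hr.1 j, hr.2).
  have [e0|[e eE]] := num_zeroP (pow j).
    by have := pow_gt0 j; rewrite e0 toF0 ltxx.
  have [t [[l1 l2 l3] [l4 l5 l6]]] :=
    mlt_bound6 j (qcode a) (qcode b) n (qcode (cq n)) e.
  exists t; exists j; split=> //.
  exists a; split; first exact: rat_lt_qcode.
  exists b; split; first exact: rat_lt_qcode.
  exists n; split=> //.
  exists (cq n); split; first exact: rat_lt_qcode.
  exists e; split=> //.
  split=> //; split=> //; split; first by apply/hC.
  split; first by apply/pow_graphP.
  rewrite fval_lt !fval_add (hp' _ _ ha) (hr' _ _ hb) cE fval_nat !toFE mulrDl mul1r.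
  move: lt; rewrite /half_pow eE !toFE; lra.
have [n' [j' [ln' h]]] := phE i t p r hp hr pht; exists j'; apply: lt_le_trans h _.
apply: specker_mono; move/toF_lt: ln'; move/toF_lt: ltT; lra.
Qed.

Lemma const_real (q : rat) : exists X,
  Sem.IsReal (Sem.RealOf X) /\ seq_of (Sem.RealOf X) (fun=> fval q).
Proof.
have [|X hX] := @real_comprehension M (fun _ q' => qcode q' = qcode q).
  by rat_def.
have {}hX k q' : Sem.RealOf X k q' <-> q' = q.
  by rewrite hX; split=> [/qcode_inj|->].
exists X; split; last exact: (seq_of_fun (xs := fun=> q)).
exact: (IsReal_intro (xs := fun=> q) hX (regular_const _)).
Qed.

Lemma cover_limit k P R : Sem.FineCover W k P R ->
  exists X s, [/\ seq_of (Sem.RealOf X) s, Sem.UnitPoint (Sem.RealOf X) & limit s].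
Proof.
move=> /sem_and[h1 /sem_and[_ h2]].
have [|T hT] := @right_end_stage k P R.
  move=> i /h1 /sem_and[/sem_and[rP _] /sem_and[rR _]]; by [].
have [q qE] := fval_surj (c T).
have [X0 [rX0 hX0]] := const_real q; rewrite qE in hX0.
have /h2 /sem_ex[i /sem_and[lik /sem_and[]]] : Sem.UnitPoint (Sem.RealOf X0).
  apply/(unit_pointP hX0 rX0 (regular_const _)); split; first exact: regular_const.
  move=> e e0; apply: eventually_all => _.
  have h3 := specker_ge0 dth T; have h4 := specker_lt1 dth T.
  by apply/andP; split; atoms_lra.
have /sem_and[uP /sem_and[rR /sem_and[_ le]]] := h1 i lik.
have [p [hp rP up]] := unit_point_seq uP; have rp : regular p by case: up.
have [r [hr rr]] := IsReal_seq rR.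
move=> /(RLt_eventually (seq_RSub hp hr) hX0 (regularB rp rr) (regular_const _)).
move=> [e1 e10 left_end].
move=> /(RLt_eventually hX0 (seq_RAdd hp hr) (regular_const _) (regularD rp rr)).
move=> [e2 e20 right_end].
(* If some [c n] passed the right end, so would [c T] by the choice of [T]; but [c T] lies in this
   interval. *)
have above n j : c n <= p j + r j + half_pow j + half_pow j.
  rewrite leNgt; apply/negP => /(hT i p r lik hp hr)[j' lt].
  have := eventually_and right_end (eventually_succ (eventually_and
    (eventually_regular j' rp) (eventually_regular j' rr))).
  move=> /eventually_ex[m [h3 [h4 h5]]].
  by abs_lra.
pose s k := p (k + 1) + r (k + 1).
have rs : regular s by apply: regularD.
have [X [rX hX]] := add_real hp rP rp hr rR rr.
have lim : limit s.
  apply: contrapT => /existsNP[e /not_implyP[e0 /forallNP far]].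
  (* By [above] the sum can exceed [s m] by at most [2^-m], so a distance greater than [e] has to be
     on the right side. Monotonicity carries the gap back from [n'] to [n]. *)
  have gap n : eventually (fun m => c n + e / 2 <= s m).
    have /existsNP[n' /not_implyP[ln ne]] := far n.
    have e4 : 0 < e / 4 by lra.
    have [K hK] := half_pow_small e4.
    have [m lm /negP] := not_eventually K ne; rewrite -ltNge => farm.
    have hm : half_pow m < e / 4 by apply: le_lt_trans hK; apply: half_pow_le.
    have ab := above n' (m + 1); rewrite -addrA half_powS -/(s m) in ab.
    have mono := specker_mono dth ln.
    apply: eventually_mono (eventually_regular m rs) => l hl.
    by abs_lra.
  (* [e1] is the slack at the left end and [e / 2] the gap at the right, so eventually
     [|p - c n| <= r - e3] for [n] beyond [T]. Fineness is given only for rationals below [r]; [g],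
     chosen between [r - e3] and [r], violates it. *)
  pose e3 := Num.min e1 (e / 2).
  have e30 : 0 < e3 by rewrite lt_min; apply/andP; split; lra.
  have e31 : e3 <= e1 by rewrite ge_min lexx.
  have e32 : e3 <= e / 2 by rewrite ge_min lexx orbT.
  have e38 : 0 < e3 / 8 by lra.
  have [m0 hm0] := half_pow_small e38.
  have [g gE] := fval_surj (r m0 - e3 / 2).
  have nearr := eventually_succ (eventually_regular m0 rr).
  have : Sem.RLt (Sem.ROfQ g) (Sem.RealAt R i).
    apply/(RLt_eventually (seq_ROfQ _) hr (regular_const _) rr).
    exists (e3 / 4); first by lra.
    apply: eventually_mono (eventually_regular m0 rr) => m h3; rewrite gE.
    by abs_lra.
  move/sem_allQ: le => le /le /(LimGt_dist hp up)[N hN].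
  have [n [lN lT]] : exists n, toF N <= toF n /\ toF T <= toF n.
    by exists (N + T); rewrite toFD; have := toF_ge0 N; have := toF_ge0 T; split; lra.
  have := eventually_and (eventually_succ (hN n lN)) (eventually_and nearr
    (eventually_and (gap n) left_end)).
  move=> /eventually_ex[m [h3 [h4 [h5 h6]]]]; rewrite gE /s in h3 h5.
  have mono := specker_mono dth lT.
  by abs_lra.
exists X, s; split=> //; apply/(unit_pointP hX rX rs); split=> // e e0.
have [N hN] := lim e e0.
apply: eventually_mono (hN N (lexx _)) => m h3.
have h4 := specker_ge0 dth N; have h5 := specker_lt1 dth N.
by rewrite -/(s m); apply/andP; split; abs_lra.
Qed.

End Cover.

(** * Arithmetical comprehension *)

Section Comprehension.
Variable M : rca_model.
Notation D := (num M).
Notation F := (field_of M).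
Notation env := (nat -> D).
Notation rat := (D * D * D)%type.

Lemma limit_comprehension (th : D -> D -> Prop)
    (dth : definable0 2 (fun v : env => th (v 0%N) (v 1%N))) X s :
  seq_of (Sem.RealOf X) s -> regular s -> limit dth s ->
  exists A : sets M, forall n, mmem n A <-> exists t, th n t.
Proof.
move=> hX rs lim; have [cq [C [hC cE]]] := specker_names dth.
have below n k : specker dth n <= s k + half_pow k.
  rewrite leNgt; apply/negP => lt.
  have e0 : 0 < (specker dth n - (s k + half_pow k)) / 2 by atoms_lra.
  have [N hN] := lim _ e0.
  have lN : toF N <= toF (N + n) by rewrite toFD; have := toF_ge0 n; lra.
  have ln : toF n <= toF (N + n) by rewrite toFD; have := toF_ge0 N; lra.
  have mono := specker_mono dth ln.
  have [m [h1 h2]] := eventually_ex (eventually_and (hN _ lN) (eventually_regular k rs)).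
  by abs_lra.
(* Absence of [n] is witnessed by a stage [S > n] where it has not appeared, although an entry of
   the limit plus its error [2^-k] is below [specker S + 2^-(n+1)]: a later appearance would push
   the sum past the limit. Here [e + 1] is [2^k] and [d + 1] is [2^(n+1)]. *)
have nP n : ~ (exists t, th n t) <-> exists S k : D, exists x q : rat, exists e d : D,
    ~ before th S n /\ (mlt n S /\ (mmem (pair k (qcode x)) X /\
    (mmem (pair S (qcode q)) C /\ (mmem (pair k (e + 1)) (pow_graph M) /\
    (mmem (pair (n + 1) (d + 1)) (pow_graph M) /\
      Sem.QLt (Sem.QAdd x (1, 0, e)) (Sem.QAdd q (1, 0, d))))))).
  split=> [nth|].
    have p0 := half_pow_gt0 (n + 1).
    have e0 : 0 < half_pow (n + 1) / 4 by atoms_lra.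
    have [N hN] := lim _ e0; pose S := N + n + 1.
    have lS : toF N <= toF S by rewrite !toFE; have := toF_ge0 n; lra.
    have [k [h1 h2]] := eventually_ex (eventually_and (hN S lS) (eventually_half_pow e0)).
    have [[x hx] hs] := (hX.1 k, hX.2).
    have pred m : exists e : D, pow m = e + 1.
      have [z|//] := num_zeroP (pow m); by have := pow_gt0 m; rewrite z toF0 ltxx.
    have [e eE] := pred k; have [d dE] := pred (n + 1).
    exists S, k, x, (cq S), e, d; split; first by move=> [t [_ tht]]; apply: nth; exists t.
    split.
      by apply/toF_lt; rewrite !toFE; have := toF_ge0 N; lra.
    split=> //; split; first by apply/hC.
    split; first by apply/pow_graphP.
    split; first by apply/pow_graphP.
    rewrite fval_lt !fval_add (hs _ _ hx) cE !fval_nat !toFE !mul1r.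
    have -> : (toF e + 1)^-1 = half_pow k by rewrite /half_pow eE !toFE.
    have -> : (toF d + 1)^-1 = half_pow (n + 1) by rewrite /half_pow dE !toFE.
    by abs_lra.
  move=> [S [k [x [q [e [d [nb [lnS [hx [/hC -> [/pow_graphP he [/pow_graphP hd]]]]]]]]]]]].
  rewrite fval_lt !fval_add (hX.2 _ _ hx) cE !fval_nat !toFE !mul1r => lt [t tht].
  have ek : (toF e + 1)^-1 = half_pow k by rewrite /half_pow -he !toFE.
  have dn : (toF d + 1)^-1 = half_pow (n + 1) by rewrite /half_pow -hd !toFE.
  rewrite ek dn in lt.
  have le : toF S <= toF (S + t + 1) by rewrite !toFE; have := toF_ge0 t; lra.
  have b : before th (S + t + 1) n.
    exists t; split=> //; apply/toF_lt; rewrite !toFE; have := toF_ge0 S; lra.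
  have jump := specker_jump dth le lnS nb b.
  have bel := below (S + t + 1) k.
  by clear he hd; atoms_lra.
apply: delta1_comprehension_model.
  by apply: definable1_ex; apply: def0_app2; first exact: dth; num_def.
apply: (def1_ext (fun v : env => iff_sym (nP (v 0%N)))).
do 2 apply: definable1_ex1; do 2 apply: definable1_ex_rat; do 2 apply: definable1_ex1.
apply: def1_def0; apply: def0_and; last by rat_def.
by apply: def0_not; apply: def0_before => //; rewrite /tl /=; num_def.
Qed.

Hypothesis cousin : Sem.Cousin M.

Lemma sigma1_comprehension (th : D -> D -> Prop) :
  definable0 2 (fun v : env => th (v 0%N) (v 1%N)) ->
  exists A : sets M, forall n, mmem n A <-> exists t, th n t.
Proof.
move=> dth; have [W hW] := gauge_code dth.
have [X [s [hX uX lim]]] : exists X s, [/\ seq_of (Sem.RealOf X) s,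
    Sem.UnitPoint (Sem.RealOf X) & limit dth s].
  apply: contrapT => nl.
  have /cousin : Sem.BaireOne W by apply: BaireOne_dist hW.
  case/(_ _)/sem_ex.
    apply: (Gauge_dist hW) => X s hX uX lim; apply: nl; by exists X, s.
  by move=> k /sem_ex[P /sem_ex[R /(cover_limit hW)]].
have [s' [hX' _ [rs' _]]] := unit_point_seq uX.
have E : s = s' by apply: funext => k; have [[q hq] h'] := (hX.1 k, hX'.2);
  rewrite -(h' _ _ hq) (hX.2 _ _ hq).
by rewrite -E in rs'; apply: limit_comprehension hX rs' lim.
Qed.

(** Sigma_1 comprehension turns an unbounded quantifier into membership in a set of the model, which
    is an atomic formula with a set parameter. Hence every arithmetical relation is Sigma_0 with
    parameters. *)
Lemma definable0_ex k (Q : env -> Prop) :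
  definable0 k.+1 Q -> definable0 k (fun v => exists y, Q (y .: v)).
Proof.
elim: k Q => [|[|k] IH] Q dQ.
- pose v0 : env := fun=> 0.
  apply: (@def0_ext M _ (fun=> exists y, Q (y .: v0))); last exact: def0_const.
  by move=> v; split=> -[y Qy]; exists y; apply: (def0_local dQ) Qy => -[].
- pose v0 : env := fun=> 0.
  have [|A hA] := @sigma1_comprehension (fun n t => Q (t .: (n .: v0))).
    (* The renaming [1 - n] exchanges the two variables, since [sigma1_comprehension] lists the
       witness last. *)
    have hr n : (n < 2)%N -> (1 - n < 2)%N by lia.
    have := def0_ren hr dQ; apply: def0_ext => v.
    by split; apply: (def0_local dQ) => -[|[]].
  apply: (@def0_ext M _ (fun v => mmem (v 0%N) A)); last by num_def.
  move=> v; rewrite hA.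
  by split=> -[y Qy]; exists y; apply: (def0_local dQ) Qy => -[|[]].
(* Comprehension handles one free variable; the first two are packed into a pair, which lowers the
   number of variables by one. *)
pose Q' (u : env) := exists a, mlt a (u 1%N + 1) /\ exists b, mlt b (u 1%N + 1) /\
  (u 1%N = pair a b /\ Q (u 0%N .: (a .: (b .: tl (tl u))))).
have dQ' : definable0 k.+2 Q'.
  apply: def0_exists_lt; first by num_def.
  apply: def0_exists_lt; first by num_def.
  apply: def0_and; first by num_def.
  pose r n := match n with 0 => 2%N | 1 => 1%N | 2 => 0%N | n'.+3 => n'.+4 end.
  have hr n : (n < k.+3)%N -> (r n < k.+4)%N by case: n => [|[|[|n]]].
  have := def0_ren hr dQ; apply: def0_ext => v.
  suff -> : (fun n => v (r n)) = v 2%N .: (v 1%N .: (v 0%N .: tl (tl (tl (tl v))))) by [].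
  by apply: funext => -[|[|[|n]]].
have := IH _ dQ'.
pose t n : env -> D := if n is n'.+1 then fun v => v n'.+2
  else fun v => pair (v 0%N) (v 1%N).
have ht n : (n < k.+1)%N -> definable_tm k.+2 (t n).
  by case: n => [|n] ltn; [rewrite /t; num_def|apply: def_var].
move=> /(def0_subst ht); apply: def0_ext => v; split=> [[y]|[y Qy]].
  rewrite /Q' /= => -[a [_ [b [_ [/pair_inj[<- <-] Qy]]]]]; exists y.
  by apply: (def0_local dQ) Qy => -[|[|[|n]]].
exists y; exists (v 0%N); split; first exact: mlt_pair1l.
exists (v 1%N); split; first exact: mlt_pair1r.
by split=> //; apply: (def0_local dQ) Qy => -[|[|[|n]]].
Qed.

Lemma definable_teval k (e : env) a :
  definable_tm k (fun v : env => teval (append k v e) a).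
Proof.
elim: a => [n|||a IHa b IHb|a IHa b IHb] /=; rewrite /append.
- by case: ltnP => ltn; [apply: def_var|apply: def_const].
- exact: def_const.
- exact: def_const.
- exact: def_add.
exact: def_mul.
Qed.

Lemma definable_arithmetical p : arithmetical p -> forall k (e : env) f,
  definable0 k (fun v : env => sat (append k v e) f p).
Proof.
elim: p => [a b|a b|a x||p IHp q IHq|p IHp|p IHp] //= ap k e f.
- by apply: def0_eq; apply: definable_teval.
- by apply: def0_lt; apply: definable_teval.
- by apply: def0_mem; apply: definable_teval.
- exact: def0_const.
- by case: ap => ap aq; apply: def0_imp; [apply: IHp|apply: IHq].
apply: (@def0_ext M _ (fun v : env => ~ exists d, ~ sat (append k.+1 (d .: v) e) f p)).
  move=> v; split=> [h d|h [d]]; last by rewrite append_cons.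
  by apply: contrapT => nd; apply: h; exists d; rewrite append_cons.
apply: def0_not; apply: (definable0_ex (Q := fun v => ~ sat (append k.+1 v e) f p)).
by apply: def0_not; apply: IHp.
Qed.

Lemma arithmetical_comprehension_sat p :
  generalization arithmetical_comprehension p ->
  forall (e : env) f, sat (M := M) e f p.
Proof.
elim=> {p} [_ [p ap]|p _ IH|p _ IH] e f; last 2 first.
- by move=> d; apply: IH.
- by move=> X; apply: IH.
have [|X hX] := @comprehension0 M (fun x => sat (x .: e) f p).
  apply: def0_ext (definable_arithmetical ap 1 e f) => v.
  by rewrite -[v]scons_tl append_cons append0.
apply/sat_fexS; exists X.
suff h x : sat (x .: e) (X .: f) (fiff (fmem (tvar 0) 0) (fliftS p)) by move=> x.
by apply/sat_fiff; rewrite /fliftS sat_fsubst; apply: hX.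
Qed.

End Comprehension.

Theorem theorem5p5 (p : fm) (hp : ACA0 p) :
  provable RCA0 (fimp CousinBaireOne p).
Proof.
apply: contrapT => /completeness[M0 [e0 [f0 [se sf [e [f [hT np]]]]]]].
pose M := RcaModel se sf (sat_generalization hT).
apply: np => hC.
have cousin : Sem.Cousin M by apply/(@sat_CousinBaireOne M e f).
case: hp => [/hT //|gp].
exact: (arithmetical_comprehension_sat cousin gp).
Qed.
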